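(* Let $F$ be a filtration-preserving automorphism of $\widehat L$ with $\mathrm{gr}\,F=\mathrm{id}$, and assume that the automorphism of $|A|$ induced by $F$ is an automorphism of the Lie algebra $(|A|,[\cdot,\cdot]_{\mathrm{gr}})$. Then $F$ is tangential, i.e. for every $j=1,\ldots,n$ there is a group-like element $f_j\in A$ with $F(z_j)=f_j^{-1}z_jf_j$, and there exists a group-like element $f_0\in A$ such that $F(\omega)=f_0^{-1}\omega f_0$, where $\omega=\sum_{i=1}^g[x_i,y_i]+\sum_{j=1}^n z_j$.
   Context: $\mathbb{K}$ is a field of characteristic zero. $\Sigma$ is a compact connected oriented surface of genus $g$ with $n+1$ boundary components labelled $0,\ldots,n$; $\pi=\pi_1(\Sigma,* )$ (basepoint on boundary component $0$) is free on $\alpha_i,\beta_i$ ($1\le i\le g$), $\gamma_j$ ($1\le j\le n$), $\gamma_j$ freely homotopic to the $j$th boundary component, with $\prod_i\alpha_i\beta_i\alpha_i^{-1}\beta_i^{-1}\prod_j\gamma_j=\gamma_0$ the loop around boundary component $0$. $\mathrm{gr}\,H=H/H^{(2)}\oplus H^{(2)}$ where $H=H_1(\Sigma;\mathbb{K})$ and $H^{(2)}$ is the radical of the intersection pairing, with basis $x_i,y_i$ (classes of $\alpha_i,\beta_i$) and $z_j$ (classes of $\gamma_j$). $A$ is the completed free associative algebra on $x_i,y_i,z_j$ with weights $1,1,2$ (filtered by weight), a complete Hopf algebra with primitive generators; $\widehat L$ is its primitive part (completed free Lie algebra); group-like elements are elements of $\exp(\widehat L)$. Any automorphism of $\widehat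 L$ extends to $A=U(\widehat L)$ and hence acts on $|A|=A/\overline{[A,A]}$. $\widehat{\mathfrak g}=|\widehat{\mathbb{K}\pi}|$, where $\widehat{\mathbb{K}\pi}$ is the completion of $\mathbb{K}\pi$ with respect to the unique multiplicative filtration by two-sided ideals with $\alpha_i-1,\beta_i-1$ in degree $1$ and $\gamma_j-1$ in degree $2$; the completed Goldman bracket on $\widehat{\mathfrak g}$ is filtered (of degree $-2$) and induces the Lie bracket $[\cdot,\cdot]_{\mathrm{gr}}$ on $\mathrm{gr}\,\widehat{\mathfrak g}\cong|A|$ (the necklace Lie bracket). *)

(* Defs.v *)
(* Completed free associative algebra A on letters
   x_i, y_i (weight 1), z_j (weight 2), realised as formal series
   (functions from words to K). *)
From mathcomp Require Import all_boot all_algebra.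
Set Implicit Arguments. Unset Strict Implicit. Unset Printing Implicit Defensive.
Import GRing.Theory.
Local Open Scope ring_scope.

Section Defs.
Variables (K : fieldType) (g n : nat).

(* inl (i,false) = x_i, inl (i,true) = y_i, inr j = z_j *)
Definition letter : finType := (('I_g * bool) + 'I_n)%type.
Definition word := seq letter.
Definition series := word -> K.

Definition wt (a : letter) : nat := if a is inr _ then 2%N else 1%N.
Definition wword (w : word) : nat := (\sum_(a <- w) wt a)%N.

Definition szero : series := fun _ => 0.
Definition sone : series := fun w => if w is [::] then 1 else 0.
Definition sgen (a : letter) : series := fun w => (w == [:: a])%:R.
Definition xg (i : 'I_g) : series := sgen (inl (i, false)).
Definition yg (i : 'I_g) : series := sgen (inl (i, true)).
Definition zg (j : 'I_n) : series := sgen (inr j).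
Definition sadd (f h : series) : series := fun w => f w + h w.
Definition sscale (c : K) (f : series) : series := fun w => c * f w.
Definition ssub (f h : series) : series := fun w => f w - h w.
Definition ssum (s : seq series) : series := foldr sadd szero s.
Definition smul (f h : series) : series :=
  fun w => \sum_(i < (size w).+1) f (take i w) * h (drop i w).
Definition spow (f : series) (k : nat) : series := iter k (smul f) sone.
Definition sbr (f h : series) : series := ssub (smul f h) (smul h f).

Definition sum_words (N : nat) (F : word -> K) : K :=
  \sum_(p < N.+1) \sum_(t : p.-tuple letter) F (tval t).

Definition infil (k : nat) (f : series) : Prop :=
  forall w, (wword w < k)%N -> f w = 0.

Fixpoint shuffle (u v : word) {struct u} : seq word :=
  match u with
  | [::] => [:: v]
  | a :: u' =>
      let fix sh (v : word) : seq word :=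
        match v with
        | [::] => [:: u]
        | b :: v' => map (cons a) (shuffle u' v) ++ map (cons b) (sh v')
        end in sh v
  end.

(* coefficient of u (x) v in the completed coproduct Delta f
   (letters primitive) *)
Definition coprod (f : series) (u v : word) : K := \sum_(w <- shuffle u v) f w.

(* primitive part Lhat: Delta f = f (x) 1 + 1 (x) f *)
Definition Lhat (f : series) : Prop :=
  forall u v, coprod f u v = f u * (v == [::])%:R + (u == [::])%:R * f v.

(* exponential of a series without constant term *)
Definition sexp (l : series) : series :=
  fun w => \sum_(k < (size w).+1) spow l k w / (k`!)%:R.

Definition grouplike (f : series) : Prop := exists l, Lhat l /\ f = sexp l.

(* inverse of a series with constant term 1: sum_k (1 - f)^k *)
Definition sinv (f : series) : series :=
  fun w => \sum_(k < (size w).+1) spow (ssub sone f) k w.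

(* continuous algebra endomorphism of A sending letter a to phi a
   (phi a without constant term) *)
Definition subst (phi : letter -> series) (f : series) : series :=
  fun w => sum_words (size w) (fun u => f u * foldr smul sone (map phi u) w).

Definition in_comm_closure (f : series) : Prop :=
  forall k, exists s : seq (series * series),
    infil k (ssub f (ssum [seq sbr p.1 p.2 | p <- s])).

(* equality in |A| = A / closure [A,A] *)
Definition cyc_eq (f h : series) : Prop := in_comm_closure (ssub f h).

(* necklace bracket via the double bracket
   {{x_i,y_i}} = 1(x)1, {{y_i,x_i}} = -1(x)1, {{z_j,z_j}} = z_j(x)1 - 1(x)z_j,
   others 0; term (k,l) of |{{u,v}}| for words u,v, written as a
   representative in A. *)
Definition nb_term (u v : word) (k l : nat) (w : word) : K :=
  match drop k u, drop l v with
  | a :: ua, b :: vb =>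
      let A := ua ++ take k u in
      let B := vb ++ take l v in
      match a, b with
      | inl (i, false), inl (i', true) => if i == i' then (w == A ++ B)%:R else 0
      | inl (i, true), inl (i', false) => if i == i' then - (w == A ++ B)%:R else 0
      | inr j, inr j' =>
          if j == j' then (w == inr j :: A ++ B)%:R - (w == A ++ inr j :: B)%:R
          else 0
      | _, _ => 0
      end
  | _, _ => 0
  end.

Definition nb_word (u v : word) : series :=
  fun w => \sum_(k < size u) \sum_(l < size v) nb_term u v k l w.

(* representative of the necklace bracket [|f|,|h|]_gr *)
Definition nbr (f h : series) : series :=
  fun w => sum_words (size w).+2 (fun u =>
             sum_words (size w).+2 (fun v => f u * h v * nb_word u v w)).

Definition omega : series :=
  sadd (ssum [seq sbr (xg i) (yg i) | i <- enum 'I_g])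
       (ssum [seq zg j | j <- enum 'I_n]).

End Defs.

(* Main.v *)
(* Let z be one of the z_j or omega, and P = F(z). For every k the class of z^(k+1) is
   such that [|z^(k+1)|, -] is the action on |A| of an inner derivation of A (zero for
   z_j, ad of (k+1) omega^k for omega), so z^(k+1) is central in |A|; since F preserves
   the bracket, P^(k+1) is central as well. Suppose that l in Lhat satisfies
   e^l P e^(-l) = z + q + higher terms with q primitive of weight d > 2. Taking lowest
   weights, z^k q is central for all k, so the derivation lifting [|z^k q|, -] acts by
   zero on |A|; such a derivation is inner, say ad u, and u commutes with omega because
   the derivation kills omega. Comparing coefficients on words ending in a long run of
   a letter of z (of the word x y when z = omega and g > 0) gives
   q = [z, f] + a series in z. The Adams operation psi separates symmetric degrees,
   whence q = [z, v] with v primitive of weight d - 2, and l + v improves the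
   approximation by one degree. In the limit e^l P e^(-l) = z. *)
Require Import Defs.
From HB Require Import structures.
From mathcomp Require Import all_boot all_algebra.
From mathcomp Require Import boolp zify ring.
Set Implicit Arguments. Unset Strict Implicit. Unset Printing Implicit Defensive.
Import GRing.Theory.
Local Open Scope ring_scope.

(** The quotient [|A|] is never formed. An element is tested by its cyclic derivatives [del s], and
    [tr0] stands for zero in [|A|] up to constants. In these terms the bracket is
    [nbr f h = \sum_s Dham f s * del s h], a derivation of A applied to h, and all arguments become
    comparisons of coefficients of words. All powers of z are used because the cyclic class of q
    alone says too little about q. In [|A|] the linear term of (z + q)^(k+1) is (k+1) z^k q, and
    once k exceeds the weight of q the run left by z^k marks where the cyclic word can be cut open,
    so that q becomes visible as an element of A. The series f obtained in this way need not be
    primitive, hence the separate passage to a primitive solution. Characteristic zero enters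
    through the factor k+1, the factorials of the exponential, the invertibility of 2, and the
    eigenvalue differences 2 - 2^i of [psi]. *)

(** * Sums over the factorisations of a word *)

Fixpoint splits (T : Type) (w : seq T) : seq (seq T * seq T) :=
  if w is a :: w' then ([::], w) :: [seq (a :: p.1, p.2) | p <- splits w']
  else [:: ([::], [::])].

Section SplitSums.
Variables (T : Type) (V : nmodType).
Implicit Types (w u v : seq T).

Lemma splits_nil (G : seq T * seq T -> V) : \sum_(p <- splits [::]) G p = G ([::], [::]).
Proof. by rewrite /= big_seq1. Qed.

Lemma splits_cons a w (G : seq T * seq T -> V) :
  \sum_(p <- splits (a :: w)) G p
  = G ([::], a :: w) + \sum_(p <- splits w) G (a :: p.1, p.2).
Proof. by rewrite /= big_cons big_map. Qed.

Lemma splits_cat u a v (G : seq T * seq T -> V) :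
  \sum_(p <- splits (u ++ a :: v)) G p
  = \sum_(p <- splits u) G (p.1, p.2 ++ a :: v)
    + \sum_(p <- splits v) G (u ++ a :: p.1, p.2).
Proof.
elim: u G => [|b u IH] G; first by rewrite splits_nil /= big_cons big_map.
by rewrite cat_cons !splits_cons (IH (fun p => G (b :: p.1, p.2))) addrA.
Qed.

Lemma splits_rcons w a (G : seq T * seq T -> V) :
  \sum_(p <- splits (rcons w a)) G p
  = \sum_(p <- splits w) G (p.1, rcons p.2 a) + G (rcons w a, [::]).
Proof.
rewrite -cats1 splits_cat splits_nil.
by congr (_ + _); apply: eq_bigr => p _; rewrite cats1.
Qed.

(** Coassociativity of deconcatenation. It gives associativity of the product and later regroups all
    threefold factorisations. *)
Lemma splits_assoc w (G : seq T -> seq T -> seq T -> V) :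
  \sum_(p <- splits w) \sum_(r <- splits p.1) G r.1 r.2 p.2
  = \sum_(p <- splits w) \sum_(r <- splits p.2) G p.1 r.1 r.2.
Proof.
elim: w G => [|a w IH] G; first by rewrite !splits_nil.
rewrite !splits_cons splits_nil /=.
under eq_bigr do rewrite splits_cons /=.
rewrite big_split /= (IH (fun x y z => G (a :: x) y z)) addrA; congr (_ + _).
Qed.

Lemma splits_ord w (G : seq T -> seq T -> V) :
  \sum_(p <- splits w) G p.1 p.2 = \sum_(i < (size w).+1) G (take i w) (drop i w).
Proof.
elim: w G => [|a w IH] G; first by rewrite splits_nil big_ord_recl big_ord0 addr0.
by rewrite splits_cons big_ord_recl /= (IH (fun x y => G (a :: x) y)).
Qed.

End SplitSums.

Lemma splits_catK (T : eqType) (w : seq T) p : p \in splits w -> p.1 ++ p.2 = w.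
Proof.
elim: w p => [|a w IH] p /=; first by rewrite inE => /eqP->.
by rewrite inE => /orP[/eqP-> //|/mapP[r /IH <- ->]].
Qed.

Lemma mem_splits (T : eqType) (w : seq T) p : (p \in splits w) = (p.1 ++ p.2 == w).
Proof.
apply/idP/eqP => [/splits_catK //|<-]; case: p => u v /=.
elim: u => [|a u IH] /=; first by case: v => [|b v]; rewrite ?inE eqxx.
by rewrite inE; apply/orP; right; apply/mapP; exists (u, v).
Qed.

Lemma uniq_splits (T : eqType) (w : seq T) : uniq (splits w).
Proof.
elim: w => [|a w IH] //=; rewrite map_inj_uniq ?IH ?andbT.
  by apply/mapP => -[].
by move=> [x y] [x' y'] /= [-> ->].
Qed.

(** * Formal series as a ring *)

Definition ser (K : fieldType) (g n : nat) : Type := series K g n.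

Section Ring.
Variables (K : fieldType) (g n : nat).
Local Notation A := (ser K g n).
Local Notation W := (word g n).

HB.instance Definition _ := gen_eqMixin A.
HB.instance Definition _ := gen_choiceMixin A.

Lemma ser_ext (f h : A) : (forall w, f w = h w) -> f = h.
Proof. exact: funext. Qed.

Lemma smul_splits (f h : A) w : smul f h w = \sum_(p <- splits w) f p.1 * h p.2.
Proof. by rewrite (splits_ord w (fun x y => f x * h y)). Qed.

Definition sopp (f : A) : A := fun w => - f w.

Fact saddA : associative (@sadd K g n : A -> A -> A).
Proof. by move=> f h k; apply: ser_ext => w; apply: addrA. Qed.
Fact saddC : commutative (@sadd K g n : A -> A -> A).
Proof. by move=> f h; apply: ser_ext => w; apply: addrC. Qed.
Fact sadd0 : left_id (@szero K g n : A) (@sadd K g n).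
Proof. by move=> f; apply: ser_ext => w; apply: add0r. Qed.
Fact saddN : left_inverse (@szero K g n : A) sopp (@sadd K g n).
Proof. by move=> f; apply: ser_ext => w; apply: addNr. Qed.

HB.instance Definition _ := GRing.isZmodule.Build A saddA saddC sadd0 saddN.

Fact smulA : associative (@smul K g n : A -> A -> A).
Proof.
move=> f h k; apply: ser_ext => w; rewrite !smul_splits.
under eq_bigr do rewrite smul_splits big_distrr /=.
under [RHS]eq_bigr do rewrite smul_splits big_distrl /=.
rewrite (splits_assoc w (fun x y z => f x * h y * k z)).
by apply: eq_bigr => p _; apply: eq_bigr => r _; rewrite mulrA.
Qed.

Fact smul1 : left_id (@sone K g n : A) (@smul K g n).
Proof.
move=> f; apply: ser_ext => -[|a w]; first by rewrite smul_splits splits_nil mul1r.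
by rewrite smul_splits splits_cons mul1r big1 ?addr0 // => p _; rewrite mul0r.
Qed.

Fact smulr1 : right_id (@sone K g n : A) (@smul K g n).
Proof.
move=> f; apply: ser_ext; elim/last_ind => [|w a _]; first by rewrite smul_splits splits_nil mulr1.
rewrite smul_splits splits_rcons mulr1 big1 ?add0r // => p _.
by case: (p.2) => [|? ?]; rewrite mulr0.
Qed.

Fact smulDl : left_distributive (@smul K g n : A -> A -> A) (@sadd K g n).
Proof.
move=> f h k; apply: ser_ext => w; rewrite /sadd !smul_splits -big_split.
by apply: eq_bigr => p _; rewrite mulrDl.
Qed.

Fact smulDr : right_distributive (@smul K g n : A -> A -> A) (@sadd K g n).
Proof.
move=> f h k; apply: ser_ext => w; rewrite /sadd !smul_splits -big_split.
by apply: eq_bigr => p _; rewrite mulrDr.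
Qed.

Fact sone_neq0 : (@sone K g n : A) != (0 : A).
Proof. by apply/eqP => /(congr1 (fun f : A => f [::])) /eqP; rewrite oner_eq0. Qed.

HB.instance Definition _ :=
  GRing.Zmodule_isNzRing.Build A smulA smul1 smulr1 smulDl smulDr sone_neq0.

Fact sscaleA (a b : K) (f : A) : sscale a (sscale b f) = sscale (a * b) f.
Proof. by apply: ser_ext => w; apply: mulrA. Qed.
Fact sscale1 : left_id 1 (@sscale K g n : K -> A -> A).
Proof. by move=> f; apply: ser_ext => w; apply: mul1r. Qed.
Fact sscaleDr : right_distributive (@sscale K g n : K -> A -> A) +%R.
Proof. by move=> a f h; apply: ser_ext => w; apply: mulrDr. Qed.
Fact sscaleDl (f : A) : {morph (@sscale K g n : K -> A -> A)^~ f : a b / a + b}.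
Proof. by move=> a b; apply: ser_ext => w; apply: mulrDl. Qed.

HB.instance Definition _ :=
  GRing.Zmodule_isLmodule.Build K A sscaleA sscale1 sscaleDr sscaleDl.

Fact sscaleAl (a : K) (f h : A) : a *: (f * h) = (a *: f) * h.
Proof.
apply: ser_ext => w; change (a * smul f h w = smul (sscale a f) h w).
by rewrite !smul_splits big_distrr; apply: eq_bigr => p _; rewrite /sscale /= mulrA.
Qed.

HB.instance Definition _ := GRing.Lmodule_isLalgebra.Build K A sscaleAl.

Fact sscaleAr (a : K) (f h : A) : a *: (f * h) = f * (a *: h).
Proof.
apply: ser_ext => w; change (a * smul f h w = smul f (sscale a h) w).
by rewrite !smul_splits big_distrr; apply: eq_bigr => p _; rewrite /sscale /= mulrCA.
Qed.

HB.instance Definition _ := GRing.Lalgebra_isAlgebra.Build K A sscaleAr.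

Implicit Types (f h : A) (w : W).

Lemma serM f h w : (f * h) w = \sum_(p <- splits w) f p.1 * h p.2.
Proof. exact: smul_splits. Qed.
Lemma serD f h w : (f + h) w = f w + h w. Proof. by []. Qed.
Lemma serN f w : (- f) w = - f w. Proof. by []. Qed.
Lemma serB f h w : (f - h) w = f w - h w. Proof. by []. Qed.
Lemma serZ a f w : (a *: f) w = a * f w. Proof. by []. Qed.
Lemma ser0 w : (0 : A) w = 0. Proof. by []. Qed.
Lemma ser1 w : (1 : A) w = (w == [::])%:R. Proof. by case: w. Qed.
Lemma ser_sum (I : Type) (r : seq I) (P : pred I) (F : I -> A) w :
  (\sum_(i <- r | P i) F i) w = \sum_(i <- r | P i) F i w.
Proof. by elim/big_rec2: _ => // i x y _ <-. Qed.

End Ring.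

Lemma big_splits1 (T : eqType) (V : nmodType) (u v : seq T) (G : seq T * seq T -> V) :
  (forall p, p.1 ++ p.2 = u ++ v -> p != (u, v) -> G p = 0) ->
  \sum_(p <- splits (u ++ v)) G p = G (u, v).
Proof.
move=> G0; rewrite (bigD1_seq (u, v)) ?uniq_splits ?mem_splits //= big_seq_cond big1 ?addr0 //.
by move=> p /andP[/splits_catK]; apply: G0.
Qed.

(** * Weights and cyclic derivatives *)

Section Weights.
Variables (K : fieldType) (g n : nat).
Local Notation A := (ser K g n).
Local Notation W := (word g n).
Local Notation L := (letter g n).
Implicit Types (f h q : A) (u v w : W) (s a b : L).

Definition gen s : A := @sgen K g n s.

Lemma genE s w : gen s w = (w == [:: s])%:R. Proof. by []. Qed.

Lemma wt_gt0 a : (0 < wt a)%N. Proof. by case: a. Qed.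
Lemma wword_nil : wword ([::] : W) = 0%N. Proof. by rewrite /wword big_nil. Qed.
Lemma wword_cons a w : wword (a :: w) = (wt a + wword w)%N.
Proof. by rewrite /wword big_cons. Qed.
Lemma wword_cat u v : wword (u ++ v) = (wword u + wword v)%N.
Proof. by rewrite /wword big_cat. Qed.
Lemma wword_rcons w a : wword (rcons w a) = (wword w + wt a)%N.
Proof. by rewrite -cats1 wword_cat wword_cons wword_nil addn0. Qed.
Lemma leq_size_wword w : (size w <= wword w)%N.
Proof.
elim: w => //= a w IH; rewrite wword_cons -add1n.
exact: leq_add (wt_gt0 a) IH.
Qed.
Lemma wword_eq0 w : (wword w == 0%N) = (w == [::]).
Proof.
by case: w => [|a w]; rewrite ?wword_nil // wword_cons addn_eq0 -leqn0 leqNgt wt_gt0.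
Qed.

(** Letters have positive weight, so the weight of the suffix determines the cut. *)
Lemma wword_suffix u v u' v' :
  u ++ v = u' ++ v' -> wword v = wword v' -> (u, v) = (u', v').
Proof.
elim: u u' => [|a u IH] [|a' u'] //=.
- by move=> ->.
- move=> -> /eqP; rewrite wword_cons wword_cat addnA -[X in _ == X]add0n eqn_add2r.
  by rewrite addn_eq0 -leqn0 leqNgt wt_gt0.
- move=> <- /eqP; rewrite eq_sym wword_cons wword_cat addnA -[X in _ == X]add0n eqn_add2r.
  by rewrite addn_eq0 -leqn0 leqNgt wt_gt0.
- by case=> -> /IH{}IH /IH[-> ->].
Qed.

Definition homog (d : nat) f : Prop := forall w, wword w != d -> f w = 0.

Definition hcomp (d : nat) f : A := fun w => if wword w == d then f w else 0.

Lemma homog_hcomp d f : homog d (hcomp d f).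
Proof. by move=> w; rewrite /hcomp => /negbTE->. Qed.
Lemma hcomp_homog d f : homog d f -> hcomp d f = f.
Proof. by move=> fd; apply: ser_ext => w; rewrite /hcomp; case: eqVneq => // /fd. Qed.

Lemma homog0 d : homog d 0. Proof. by []. Qed.
Lemma homogD d f h : homog d f -> homog d h -> homog d (f + h).
Proof. by move=> Hf Hh w Hw; rewrite serD Hf ?Hh ?addr0. Qed.
Lemma homogN d f : homog d f -> homog d (- f).
Proof. by move=> Hf w Hw; rewrite serN Hf ?oppr0. Qed.
Lemma homogB d f h : homog d f -> homog d h -> homog d (f - h).
Proof. by move=> Hf Hh; apply: homogD => //; apply: homogN. Qed.
Lemma homogZ d c f : homog d f -> homog d (c *: f).
Proof. by move=> Hf w Hw; rewrite serZ Hf ?mulr0. Qed.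
Lemma homog_sum d (I : Type) (r : seq I) (P : pred I) (F : I -> A) :
  (forall i, P i -> homog d (F i)) -> homog d (\sum_(i <- r | P i) F i).
Proof. by move=> HF; elim/big_ind: _ => //; [apply: homogD]. Qed.
Lemma homog1 : homog 0 1.
Proof. by move=> w; rewrite ser1 wword_eq0 => /negbTE->. Qed.
Lemma homog_gen s : homog (wt s) (gen s).
Proof.
move=> w Hw; rewrite genE; case: eqVneq => // E.
by move: Hw; rewrite E wword_cons wword_nil addn0 eqxx.
Qed.
Lemma homogM d e f h : homog d f -> homog e h -> homog (d + e) (f * h).
Proof.
move=> Hf Hh w Hw; rewrite serM big_seq big1 // => p /splits_catK Ep.
have [/eqP Hd|/Hf->] := boolP (wword p.1 == d); last by rewrite mul0r.
have [/eqP He|/Hh->] := boolP (wword p.2 == e); last by rewrite mulr0.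
by move: Hw; rewrite -Ep wword_cat Hd He eqxx.
Qed.
Lemma homogX d f k : homog d f -> homog (k * d) (f ^+ k).
Proof.
move=> Hf; elim: k => [|k IH]; first by rewrite expr0; apply: homog1.
by rewrite exprS mulSn; apply: homogM.
Qed.

Lemma infilW j k f : (j <= k)%N -> infil k f -> infil j f.
Proof. by move=> jk Hf w Hw; apply: Hf; apply: leq_trans Hw jk. Qed.
Lemma infil0 f : infil 0 f. Proof. by []. Qed.
Lemma infilD k f h : infil k f -> infil k h -> infil k (f + h).
Proof. by move=> Hf Hh w Hw; rewrite serD Hf ?Hh ?addr0. Qed.
Lemma infilN k f : infil k f -> infil k (- f).
Proof. by move=> Hf w Hw; rewrite serN Hf ?oppr0. Qed.
Lemma infilB k f h : infil k f -> infil k h -> infil k (f - h).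
Proof. by move=> Hf Hh; apply: infilD => //; apply: infilN. Qed.
Lemma infilZ k c f : infil k f -> infil k (c *: f).
Proof. by move=> Hf w Hw; rewrite serZ Hf ?mulr0. Qed.
Lemma infil_sum k (I : Type) (r : seq I) (P : pred I) (F : I -> A) :
  (forall i, P i -> infil k (F i)) -> infil k (\sum_(i <- r | P i) F i).
Proof. by move=> HF; elim/big_ind: _ => //; [apply: infilD]. Qed.
Lemma infilM j k f h : infil j f -> infil k h -> infil (j + k) (f * h).
Proof.
move=> Hf Hh w Hw; rewrite serM big_seq big1 // => p /splits_catK Ep.
have [/Hf->|Hj] := ltnP (wword p.1) j; first by rewrite mul0r.
have [/Hh->|Hk] := ltnP (wword p.2) k; first by rewrite mulr0.
by move: Hw; rewrite -Ep wword_cat ltnNge leq_add.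
Qed.
Lemma infilMl k f h : infil k f -> infil k (f * h).
Proof. by move=> Hf; rewrite -[k]addn0; apply: infilM. Qed.
Lemma infilMr k f h : infil k h -> infil k (f * h).
Proof. by move=> Hf; rewrite -[k]add0n; apply: infilM. Qed.
Lemma infilX j f k : infil j f -> infil (k * j) (f ^+ k).
Proof. by move=> Hf; elim: k => // k IH; rewrite exprS mulSn; apply: infilM. Qed.
Lemma infil_homog d f : homog d f -> infil d f.
Proof. by move=> Hf w Hw; apply: Hf; rewrite neq_ltn Hw. Qed.
Lemma infil_hcomp d f : infil d f -> infil d.+1 (f - hcomp d f).
Proof.
move=> Hf w; rewrite ltnS leq_eqVlt serB /hcomp => /orP[->|Hw]; first by rewrite subrr.
by rewrite Hf // (ltn_eqF Hw) subr0.
Qed.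
Lemma infil_eq f h : (forall k, infil k (f - h)) -> f = h.
Proof.
move=> H; apply: ser_ext => w; apply/eqP; rewrite -subr_eq0.
by apply/eqP/(H (wword w).+1).
Qed.

(** Only the cut before the suffix of weight [m] contributes. This is how right factors are stripped
    off words with a prescribed tail. *)
Lemma mul_homr m f h v t : homog m h -> wword t = m -> (f * h) (v ++ t) = f v * h t.
Proof.
move=> Hh Ht; rewrite serM big_splits1 // => -[x y] /= E Exy.
have [Hy|/Hh->] := eqVneq (wword y) m; last by rewrite mulr0.
by move: Exy; rewrite (wword_suffix E) ?eqxx // Ht.
Qed.

Lemma mul_genl s f a w : (gen s * f) (a :: w) = (a == s)%:R * f w.
Proof.
rewrite serM splits_cons genE mul0r add0r -[f w]/(f w) -{2}[f]mul1r serM big_distrr.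
by apply: eq_bigr => -[x y] _; rewrite genE ser1 eqseq_cons /= -mulnb natrM mulrA.
Qed.

Lemma mul_genr s f a w : (f * gen s) (rcons w a) = f w * (a == s)%:R.
Proof.
rewrite serM splits_rcons genE mulr0 addr0 -{2}[f]mulr1 serM big_distrl.
apply: eq_bigr => -[x y] _; rewrite genE ser1 /= -(cats0 [:: s]) /= -[[:: s]]/(rcons [::] s).
by rewrite eqseq_rcons -mulrA -natrM mulnb.
Qed.

Lemma mul_genl0 s f : (gen s * f) [::] = 0.
Proof. by rewrite serM splits_nil genE mul0r. Qed.
Lemma mul_genr0 s f : (f * gen s) [::] = 0.
Proof. by rewrite serM splits_nil genE mulr0. Qed.

(* On words, [cd s f h] sums [v * h * u] over the factorisations [u s v] of [f]. *)
Definition cd s f h : A :=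
  fun w => \sum_(p <- splits w) \sum_(r <- splits p.2) f (r.2 ++ s :: p.1) * h r.1.
(** The cyclic derivative: a word [u s v] contributes [v u]. It is invariant under rotation
    ([delC]), hence defined on [|A|]. *)
Definition del s f := cd s f 1.

Lemma cdDl s f f' h : cd s (f + f') h = cd s f h + cd s f' h.
Proof.
apply: ser_ext => w; rewrite serD -big_split; apply: eq_bigr => p _.
by rewrite -big_split; apply: eq_bigr => r _; rewrite /= mulrDl.
Qed.
Lemma cdZl s c f h : cd s (c *: f) h = c *: cd s f h.
Proof.
apply: ser_ext => w; rewrite serZ big_distrr; apply: eq_bigr => p _.
by rewrite big_distrr; apply: eq_bigr => r _; rewrite /= serZ mulrA.
Qed.
Lemma cdNl s f h : cd s (- f) h = - cd s f h.
Proof. by rewrite -scaleN1r cdZl scaleN1r. Qed.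
Lemma cdBl s f f' h : cd s (f - f') h = cd s f h - cd s f' h.
Proof. by rewrite cdDl cdNl. Qed.
Lemma cd0l s h : cd s 0 h = 0.
Proof. by rewrite -[in LHS](scale0r (1 : A)) cdZl scale0r. Qed.
Lemma cd_suml s (I : Type) (r : seq I) (P : pred I) (F : I -> A) h :
  cd s (\sum_(i <- r | P i) F i) h = \sum_(i <- r | P i) cd s (F i) h.
Proof. by apply: (big_morph (cd s ^~ h)) => [f f'|]; rewrite ?cdDl ?cd0l. Qed.

(** The letter [s] is cut out of one factor, and the other factor joins [h] in the gap. The argument
    [h] of [cd] exists so that this Leibniz rule closes up, which it does not for [del] alone. *)
Lemma cdM s f f' h : cd s (f * f') h = cd s f (f' * h) + cd s f' (h * f).
Proof.
apply: ser_ext => w; rewrite serD /cd.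
under eq_bigr => p _ do under eq_bigr => r _ do
  rewrite serM splits_cat mulrDl !big_distrl /=.
under eq_bigr do rewrite big_split /=.
rewrite big_split /= addrC; congr (_ + _).
  under eq_bigr do rewrite exchange_big /=.
  rewrite (splits_assoc w (fun x y z => \sum_(r <- splits z) f (r.2 ++ s :: x) * f' y * h r.1)).
  apply: eq_bigr => p _.
  under [RHS]eq_bigr do rewrite serM big_distrr /=.
  rewrite (splits_assoc p.2 (fun x y z => f (z ++ s :: p.1) * (f' x * h y))).
  by apply: eq_bigr => r _; apply: eq_bigr => q _; rewrite mulrA.
apply: eq_bigr => p _.
under [RHS]eq_bigr do rewrite serM big_distrr /=.
rewrite (splits_assoc p.2 (fun x y z => f' (z ++ s :: p.1) * (h x * f y))).
apply: eq_bigr => r _; apply: eq_bigr => q _ /=.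
by rewrite [f' _ * (_ * _)]mulrCA mulrC [f _ * _]mulrC.
Qed.

Lemma cd1 s h : cd s 1 h = 0.
Proof.
apply: ser_ext => w; rewrite /cd big1 // => p _; rewrite big1 // => r _.
by rewrite ser1; case: (r.2) => [|? ?]; rewrite mul0r.
Qed.

Lemma cd_gen s a h : cd s (gen a) h = (s == a)%:R *: h.
Proof.
apply: ser_ext => w; rewrite /cd serZ -[h in RHS]mul1r serM big_distrr.
apply: eq_bigr => p _.
have -> : h p.2 = \sum_(r <- splits p.2) h r.1 * (1 : A) r.2 by rewrite -serM mulr1.
rewrite /= !big_distrr; apply: eq_bigr => -[x y] _; rewrite genE !ser1 /=.
case: y => [|b y] /=; last by rewrite !mulr0 eqseq_cons; case: y => [|? ?]; rewrite andbF mul0r.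
by rewrite eqseq_cons mulr1 -mulnb natrM mulrA.
Qed.

Lemma delM s f h : del s (f * h) = cd s f h + cd s h f.
Proof. by rewrite /del cdM mulr1 mul1r. Qed.
Lemma delC s f h : del s (f * h) = del s (h * f).
Proof. by rewrite !delM addrC. Qed.
Lemma delE s f w : del s f w = \sum_(p <- splits w) f (p.2 ++ s :: p.1).
Proof.
apply: eq_bigr => p _; case: (p.2) => [|a v]; first by rewrite splits_nil ser1 mulr1.
by rewrite splits_cons ser1 mulr1 big1 ?addr0 // => r _; rewrite ser1 mulr0.
Qed.

Lemma cdX s f h k : cd s (f ^+ k) h = \sum_(i < k) cd s f (f ^+ (k - i.+1) * h * f ^+ i).
Proof.
elim: k h => [|k IH] h; first by rewrite expr0 cd1 big_ord0.
rewrite exprS cdM IH big_ord_recl subn1 expr0 mulr1 -pred_Sn; congr (_ + _).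
by apply: eq_bigr => i _; rewrite subSS -!mulrA -exprS.
Qed.

Lemma delX s f k : del s (f ^+ k.+1) = k.+1%:R *: cd s f (f ^+ k).
Proof.
rewrite /del cdX (eq_bigr (fun=> cd s f (f ^+ k))) => [|i _].
  by rewrite sumr_const card_ord scaler_nat.
by rewrite mulr1 -exprD subSS subnK // -ltnS.
Qed.

End Weights.

Lemma pascal_sum (R : nzRingType) k (H : nat -> nat -> R) :
  \sum_(i < k.+2) 'C(k.+1, i)%:R * H i (k.+1 - i)%N
  = \sum_(i < k.+1) 'C(k, i)%:R * H i.+1 (k - i)%N
    + \sum_(i < k.+1) 'C(k, i)%:R * H i (k.+1 - i)%N.
Proof.
rewrite big_ord_recl [X in _ = _ + X]big_ord_recl !bin0 addrCA; congr (_ + _).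
rewrite (_ : \sum_(i < k) _ = \sum_(i < k.+1) 'C(k, i.+1)%:R * H i.+1 (k - i)%N); last first.
  by rewrite [RHS]big_ord_recr /= bin_small // mul0r addr0; apply: eq_bigr => i _; rewrite /= subSS.
rewrite -big_split.
by apply: eq_bigr => i _; rewrite lift0 subSS binS natrD mulrDl addrC.
Qed.

(** * Shuffles and primitive series *)

Section Shuffle.
Variables (K : fieldType) (g n : nat).
Local Notation A := (ser K g n).
Local Notation W := (word g n).
Local Notation L := (letter g n).
Implicit Types (f h q : A) (u v w : W) (s a b : L).

Lemma shuffle0r u : shuffle u [::] = [:: u].
Proof. by case: u. Qed.
Lemma shuffle_cons a u b v :
  shuffle (a :: u) (b :: v)
  = map (cons a) (shuffle u (b :: v)) ++ map (cons b) (shuffle (a :: u) v).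
Proof. by []. Qed.

Lemma shuffle_ind (P : W -> W -> Prop) :
  (forall v, P [::] v) -> (forall u, P u [::]) ->
  (forall a u b v, P u (b :: v) -> P (a :: u) v -> P (a :: u) (b :: v)) ->
  forall u v, P u v.
Proof.
move=> P0 Pr PS; elim=> [|a u IHu] //; elim=> [|b v IHv] //.
exact: PS.
Qed.

Arguments shuffle : simpl never.

Lemma big_shuffle_cons (V : nmodType) a u b v (F : W -> V) :
  \sum_(w <- shuffle (a :: u) (b :: v)) F w
  = \sum_(w <- shuffle u (b :: v)) F (a :: w) + \sum_(w <- shuffle (a :: u) v) F (b :: w).
Proof. by rewrite shuffle_cons big_cat !big_map. Qed.

Lemma mem_shuffle u v w : w \in shuffle u v -> perm_eq w (u ++ v).
Proof.
move: u v w; apply: shuffle_ind => [v w|u w|a u b v IH1 IH2 w].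
- by rewrite inE => /eqP->.
- by rewrite shuffle0r inE cats0 => /eqP->.
rewrite shuffle_cons mem_cat => /orP[] /mapP[x Hx ->].
  by rewrite cat_cons perm_cons IH1.
rewrite -cat1s perm_sym -[b :: v]cat1s perm_catCA cat1s perm_sym -cat1s perm_cat2l.
exact: IH2.
Qed.

Lemma wword_shuffle u v w : w \in shuffle u v -> wword w = (wword u + wword v)%N.
Proof. by move=> /mem_shuffle E; rewrite -wword_cat /wword (perm_big _ E). Qed.

Lemma size_shuffle u v w : w \in shuffle u v -> size w = (size u + size v)%N.
Proof. by move=> /mem_shuffle/perm_size; rewrite size_cat. Qed.

Lemma shuffle_sumC (V : nmodType) u v (F : W -> V) :
  \sum_(w <- shuffle u v) F w = \sum_(w <- shuffle v u) F w.
Proof.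
move: u v F; apply: shuffle_ind => [v F|u F|a u b v IH1 IH2 F]; rewrite ?shuffle0r //.
by rewrite !big_shuffle_cons addrC IH1 IH2.
Qed.

Lemma shuffle_sumA (V : nmodType) u v w (F : W -> V) :
  \sum_(x <- shuffle v w) \sum_(y <- shuffle u x) F y
  = \sum_(x <- shuffle u v) \sum_(y <- shuffle x w) F y.
Proof.
elim: u v w F => [|a u IHu] v w F.
  by rewrite [RHS]big_seq1; apply: eq_bigr => x _; rewrite big_seq1.
elim: v w F => [|b v IHv] w F; first by rewrite big_seq1 shuffle0r big_seq1.
elim: w F => [|c w IHw] F.
  by rewrite big_seq1; apply: eq_bigr => x _; rewrite shuffle0r big_seq1.
rewrite !big_shuffle_cons.
under eq_bigr do rewrite big_shuffle_cons.
under [X in _ + X = _]eq_bigr do rewrite big_shuffle_cons.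
under [in RHS]eq_bigr do rewrite big_shuffle_cons.
under [X in _ = _ + X]eq_bigr do rewrite big_shuffle_cons.
have /= IHu' := IHu (b :: v) (c :: w) (fun y => F (a :: y)).
rewrite big_shuffle_cons /= in IHu'.
rewrite !big_split /= [in LHS]addrACA IHu' IHv IHw big_shuffle_cons /=.
by rewrite -[RHS]addrA; congr (_ + _); rewrite addrCA.
Qed.

(** Deconcatenation is a morphism for the shuffle product; dually, the coproduct is multiplicative
    ([coprodM]). *)
Lemma shuffle_splits (V : nmodType) u v (G : W -> W -> V) :
  \sum_(w <- shuffle u v) \sum_(p <- splits w) G p.1 p.2
  = \sum_(p <- splits u) \sum_(r <- splits v)
      \sum_(x <- shuffle p.1 r.1) \sum_(y <- shuffle p.2 r.2) G x y.
Proof.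
move: u v G; apply: shuffle_ind => [v G|u G|a u b v IH1 IH2 G].
- rewrite big_seq1 splits_nil; apply: eq_bigr => p _.
  by rewrite !big_seq1.
- rewrite shuffle0r big_seq1; apply: eq_bigr => p _.
  by rewrite splits_nil !shuffle0r !big_seq1.
rewrite big_shuffle_cons.
under eq_bigr do rewrite splits_cons.
under [X in _ + X = _]eq_bigr do rewrite splits_cons.
rewrite !big_split /= (IH1 (fun x y => G (a :: x) y)) (IH2 (fun x y => G (b :: x) y)).
rewrite addrACA -(big_shuffle_cons a u b v (fun w => G [::] w)).
rewrite [in RHS]splits_cons /= [in RHS]splits_cons /= !big_seq1 -addrA; congr (_ + _).
under [X in _ = _ + X]eq_bigr do rewrite splits_cons /= shuffle0r big_seq1.
under [X in X + _ = _]eq_bigr do rewrite splits_cons /= shuffle0r big_seq1.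
rewrite [in LHS]splits_cons /=.
rewrite addrCA; congr (_ + _); first by apply: eq_bigr => r _; rewrite !big_seq1.
rewrite -big_split; apply: eq_bigr => p _; rewrite /= -addrA; congr (_ + _).
by rewrite -big_split; apply: eq_bigr => r _; rewrite big_shuffle_cons.
Qed.

Lemma coprodDl f h u v : coprod (f + h) u v = coprod f u v + coprod h u v.
Proof. by rewrite /coprod -big_split. Qed.
Lemma coprodZl c f u v : coprod (c *: f) u v = c * coprod f u v.
Proof. by rewrite /coprod big_distrr. Qed.
Lemma coprodNl f u v : coprod (- f) u v = - coprod f u v.
Proof. by rewrite -scaleN1r coprodZl mulN1r. Qed.
Lemma coprod0l f v : coprod f [::] v = f v.
Proof. by rewrite /coprod big_seq1. Qed.
Lemma coprod0r f u : coprod f u [::] = f u.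
Proof. by rewrite /coprod shuffle0r big_seq1. Qed.
Lemma coprodC f u v : coprod f u v = coprod f v u.
Proof. exact: shuffle_sumC. Qed.

(** Contraction of the coproduct of [f] with the word [u], that is, the adjoint of shuffling with
    [u]. *)
Definition shmul u f : A := coprod f u.

Lemma shmulE u f v : shmul u f v = coprod f u v. Proof. by []. Qed.
Lemma shmul0 f : shmul [::] f = f.
Proof. by apply: ser_ext => w; rewrite shmulE coprod0l. Qed.
Lemma coprod_shmul u f v w :
  coprod (shmul u f) v w = \sum_(x <- shuffle u v) coprod f x w.
Proof. exact: shuffle_sumA. Qed.

Lemma coprodM f h u v :
  coprod (f * h) u v
  = \sum_(p <- splits u) \sum_(r <- splits v) coprod f p.1 r.1 * coprod h p.2 r.2.
Proof.
rewrite /coprod; under eq_bigr do rewrite serM.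
rewrite (shuffle_splits u v (fun x y => f x * h y)).
by apply: eq_bigr => p _; apply: eq_bigr => r _; rewrite big_distrlr.
Qed.

Lemma LhatP f :
  Lhat f <-> f [::] = 0 /\ (forall u v, u != [::] -> v != [::] -> coprod f u v = 0).
Proof.
split=> [Hf|[f0 Hf] u v]; last first.
  have [->|u0] := eqVneq u [::].
    by rewrite coprod0l f0 mul0r add0r mul1r.
  have [->|v0] := eqVneq v [::]; first by rewrite coprod0r f0 mulr0 mulr1 addr0.
  by rewrite Hf // mulr0 mul0r addr0.
split=> [|u v /negbTE u0 /negbTE v0]; last by rewrite Hf u0 v0 mulr0 mul0r addr0.
have := Hf [::] [::]; rewrite coprod0l eqxx mulr1 mul1r => /eqP.
by rewrite -subr_eq0 opprD addNKr oppr_eq0 => /eqP.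
Qed.

Lemma Lhat_nil f : Lhat f -> f [::] = 0. Proof. by move=> /LhatP[]. Qed.
Lemma Lhat_0 : Lhat (0 : A).
Proof. by move=> u v; rewrite /coprod big1 // !ser0 mul0r mulr0 addr0. Qed.
Lemma LhatD f h : Lhat f -> Lhat h -> Lhat (f + h).
Proof. by move=> Hf Hh u v; rewrite coprodDl Hf Hh mulrDl mulrDr addrACA. Qed.
Lemma LhatZ c f : Lhat f -> Lhat (c *: f).
Proof. by move=> Hf u v; rewrite coprodZl Hf mulrDr mulrA mulrCA. Qed.
Lemma Lhat_sum (I : Type) (r : seq I) (P : pred I) (F : I -> A) :
  (forall i, P i -> Lhat (F i)) -> Lhat (\sum_(i <- r | P i) F i).
Proof. by move=> HF; elim/big_ind: _ => //; [apply: Lhat_0 | apply: LhatD]. Qed.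
Lemma Lhat_hcomp d f : Lhat f -> Lhat (hcomp d f).
Proof.
move=> /LhatP[f0 Hf]; apply/LhatP; split=> [|u v u0 v0]; first by rewrite /hcomp f0 if_same.
rewrite /coprod big_seq (eq_bigr (fun w =>
  if (wword u + wword v == d)%N then f w else 0)) => [|w /wword_shuffle E]; last by rewrite /hcomp E.
case: (_ == d); last by rewrite big1.
by have := Hf u v u0 v0; rewrite /coprod big_seq.
Qed.
Lemma Lhat_gen s : Lhat (gen K s).
Proof.
apply/LhatP; split=> // u v u0 v0; rewrite /coprod big_seq big1 // => w /size_shuffle Hw.
rewrite genE; case: eqVneq => // E; move: Hw; rewrite E.
by case: u u0 => // a [|b u] _; case: v v0.
Qed.

Lemma splits_nil1 v (F : W -> K) :
  \sum_(p <- splits v) (p.1 == [::])%:R * F p.2 = F v.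
Proof.
rewrite -[RHS]/((F : A) v) -[F in RHS](@mul1r A) serM.
by apply: eq_bigr => p _; rewrite ser1.
Qed.
Lemma splits_nil2 v (F : W -> K) :
  \sum_(p <- splits v) F p.1 * (p.2 == [::])%:R = F v.
Proof.
rewrite -[RHS]/((F : A) v) -[F in RHS](@mulr1 A) serM.
by apply: eq_bigr => p _; rewrite ser1.
Qed.

(** This is Delta (f h) = (f (x) 1 + 1 (x) f) Delta h, read at u (x) v. *)
Lemma coprod_Lhatl f h u v : Lhat f ->
  coprod (f * h) u v = (f * shmul v h) u + (f * shmul u h) v.
Proof.
move=> Hf; rewrite coprodM.
under eq_bigr do under eq_bigr do rewrite Hf mulrDl.
under eq_bigr do rewrite big_split.
rewrite big_split /= !serM; congr (_ + _).
  apply: eq_bigr => p _; rewrite shmulE coprodC -(splits_nil1 v) big_distrr /=.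
  by apply: eq_bigr => r _; rewrite mulrA.
rewrite exchange_big; apply: eq_bigr => r _ /=.
rewrite shmulE -(splits_nil1 u (fun x => coprod h x r.2)) big_distrr /=.
by apply: eq_bigr => p _; rewrite -mulrA mulrCA.
Qed.

Lemma coprod_Lhatr f h u v : Lhat f ->
  coprod (h * f) u v = (shmul v h * f) u + (shmul u h * f) v.
Proof.
move=> Hf; rewrite coprodM.
under eq_bigr do under eq_bigr do rewrite Hf mulrDr.
under eq_bigr do rewrite big_split.
rewrite big_split /= !serM; congr (_ + _).
  apply: eq_bigr => p _; rewrite shmulE coprodC -(splits_nil2 v) big_distrl /=.
  by apply: eq_bigr => r _; rewrite mulrA mulrAC.
rewrite exchange_big; apply: eq_bigr => r _ /=.
rewrite shmulE -(splits_nil2 u (fun x => coprod h x r.1)) big_distrl /=.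
by apply: eq_bigr => p _; rewrite mulrA.
Qed.

Lemma shmul_Lhat f u : Lhat f -> u != [::] -> shmul u f = f u *: 1.
Proof.
move=> Hf /negbTE u0; apply: ser_ext => w.
by rewrite shmulE Hf u0 mul0r addr0 serZ ser1.
Qed.

Lemma Lhat_br f h : Lhat f -> Lhat h -> Lhat (f * h - h * f).
Proof.
move=> Hf Hh; apply/LhatP; split=> [|u v u0 v0].
  by rewrite serB !serM !splits_nil !Lhat_nil // !mul0r subrr.
rewrite coprodDl coprodNl coprod_Lhatl // coprod_Lhatr // !shmul_Lhat //.
by rewrite -!scalerAr -!scalerAl !mulr1 !mul1r subrr.
Qed.

Lemma coprodX f k u v : Lhat f ->
  coprod (f ^+ k) u v = \sum_(i < k.+1) 'C(k, i)%:R * ((f ^+ i) u * (f ^+ (k - i)) v).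
Proof.
move=> Hf; elim: k u v => [|k IH] u v.
  rewrite big_ord_recl big_ord0 addr0 mul1r expr0 !ser1.
  case: (eqVneq u [::]) => [->|u0]; first by rewrite coprod0l ser1 mul1r.
  rewrite mul0r /coprod big_seq big1 // => w /size_shuffle; rewrite ser1; case: w => //= /esym/eqP.
  by rewrite addn_eq0 size_eq0 (negbTE u0).
have sh x : shmul x (f ^+ k) = \sum_(i < k.+1) ('C(k, i)%:R * (f ^+ i) x) *: f ^+ (k - i).
  apply: ser_ext => w; rewrite shmulE IH ser_sum.
  by apply: eq_bigr => i _; rewrite serZ mulrA.
rewrite (pascal_sum _ (fun i j => (f ^+ i) u * (f ^+ j) v)) exprS coprod_Lhatl // !sh.
rewrite !big_distrr /= !ser_sum; congr (_ + _).
  rewrite (reindex_inj rev_ord_inj) /=; apply: eq_bigr => i _.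
  rewrite -scalerAr serZ subSS bin_sub -1?ltnS // -exprS subKn -1?ltnS //.
  by rewrite -!mulrA; congr (_ * _); rewrite mulrC.
by apply: eq_bigr => i _; rewrite -scalerAr serZ -exprS -subSn -1?ltnS // mulrA.
Qed.

(* Multiplication after the coproduct, the second Adams operation of the Hopf algebra. *)
Definition psi f : A := fun w => \sum_(p <- splits w) coprod f p.1 p.2.

Lemma psiD f h : psi (f + h) = psi f + psi h.
Proof.
apply: ser_ext => w; rewrite serD -big_split.
by apply: eq_bigr => p _; rewrite coprodDl.
Qed.
Lemma psiZ c f : psi (c *: f) = c *: psi f.
Proof.
apply: ser_ext => w; rewrite serZ big_distrr.
by apply: eq_bigr => p _; rewrite coprodZl.
Qed.
Lemma psiB f h : psi (f - h) = psi f - psi h.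
Proof. by rewrite psiD -scaleN1r psiZ scaleN1r. Qed.

Lemma psi_nil f : psi f [::] = f [::].
Proof. by rewrite /psi splits_nil coprod0l. Qed.

Lemma psi_Lhat f : Lhat f -> psi f = 2%:R *: f.
Proof.
move=> Hf; apply: ser_ext => w; rewrite serZ mulr_natl mulr2n /psi.
under eq_bigr do rewrite Hf.
by rewrite big_split (splits_nil1 w f) (splits_nil2 w f).
Qed.

(** With Delta h = sum h' (x) h'', both psi (f h) and psi (h f) contain the sum of h' f h''. It
    cancels in the difference, leaving f psi h - psi h f. *)
Lemma psi_br f h : Lhat f -> psi (f * h - h * f) = f * psi h - psi h * f.
Proof.
move=> Hf; apply: ser_ext => w; rewrite psiB !serB /psi.
under eq_bigr do rewrite coprod_Lhatl // !serM.
under [X in _ - X = _]eq_bigr do rewrite coprod_Lhatr // !serM.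
rewrite !big_split /=.
under eq_bigr do under eq_bigr do rewrite shmulE coprodC.
rewrite (splits_assoc w (fun x y z => f x * coprod h y z)).
under [X in _ + X - _]eq_bigr do under eq_bigr do rewrite shmulE.
under [X in _ - (X + _)]eq_bigr do under eq_bigr do rewrite shmulE coprodC mulrC.
rewrite (splits_assoc w (fun x y z => f y * coprod h x z)) opprD addrA addrK.
rewrite !serM; congr (_ - _); first by apply: eq_bigr => p _; rewrite big_distrr.
under eq_bigr do under eq_bigr do rewrite shmulE.
rewrite -(splits_assoc w (fun x y z => coprod h x y * f z)).
by apply: eq_bigr => p _; rewrite big_distrl.
Qed.

Lemma psiX f k : Lhat f -> psi (f ^+ k) = (2 ^ k)%:R *: f ^+ k.
Proof.
move=> Hf; apply: ser_ext => w; rewrite /psi serZ.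
under eq_bigr do rewrite coprodX //.
rewrite exchange_big /= -[2%N]/(1 + 1)%N expnDn natr_sum big_distrl /=.
apply: eq_bigr => i _; rewrite !exp1n !muln1.
have -> : f ^+ k = f ^+ i * f ^+ (k - i) by rewrite -exprD subnKC // -ltnS.
by rewrite serM big_distrr.
Qed.

(** The adjoint of [psi] sends [u] to the sum of the shuffles of [p.1] with [p.2], and it is
    multiplicative because the shuffle product is commutative. *)
Lemma shmul_psi u f :
  shmul u (psi f) = \sum_(p <- splits u) psi (shmul p.1 (shmul p.2 f)).
Proof.
apply: ser_ext => w; rewrite ser_sum shmulE /coprod /psi.
rewrite (shuffle_splits u w (fun x y => coprod f x y)).
apply: eq_bigr => p _; apply: eq_bigr => r _; rewrite coprod_shmul.
apply: eq_bigr => x _; rewrite coprodC coprod_shmul.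
by apply: eq_bigr => y _; rewrite coprodC.
Qed.

Lemma shmul_shmul u v f : shmul v (shmul u f) = \sum_(x <- shuffle u v) shmul x f.
Proof. by apply: ser_ext => w; rewrite ser_sum shmulE coprod_shmul. Qed.

(** The pairing of [f] with the shuffle product of the words in [ws]. *)
Fixpoint shev f (ws : seq W) : K := if ws is w :: ws' then shev (shmul w f) ws' else f [::].

(** Orthogonality to the k-th power of the augmentation ideal of the shuffle algebra; under U(L) =
    S(L) this means symmetric degree less than k. *)
Definition shvanish k f : Prop :=
  forall ws, size ws = k -> [::] \notin ws -> shev f ws = 0.

Lemma shevD f h ws : shev (f + h) ws = shev f ws + shev h ws.
Proof.
elim: ws f h => //= w ws IH f h; rewrite -IH; congr (shev _ _).
by apply: ser_ext => x; rewrite serD !shmulE coprodDl.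
Qed.
Lemma shevZ c f ws : shev (c *: f) ws = c * shev f ws.
Proof.
elim: ws f => //= w ws IH f; rewrite -IH; congr (shev _ _).
by apply: ser_ext => x; rewrite serZ !shmulE coprodZl.
Qed.
Lemma shev0 ws : shev 0 ws = 0.
Proof. by rewrite -(scale0r (0 : A)) shevZ mul0r. Qed.
Lemma shev_sum (I : Type) (r : seq I) (P : pred I) (F : I -> A) ws :
  shev (\sum_(i <- r | P i) F i) ws = \sum_(i <- r | P i) shev (F i) ws.
Proof. by apply: (big_morph (shev ^~ ws)) => [f f'|]; rewrite ?shevD ?shev0. Qed.

(** Two factors are merged by shuffling them. The merging needs a factor to start from: [shvanish 0]
    only says that the constant term vanishes. *)
Lemma shvanishS k f : shvanish k.+1 f -> shvanish k.+2 f.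
Proof.
move=> Hf [|u [|v ws]] //= [sz]; rewrite !inE !negb_or => /and3P[u0 v0 ws0].
rewrite shmul_shmul shev_sum big_seq big1 // => x /size_shuffle Hx.
apply: (Hf (x :: ws)) => /=; first by rewrite sz.
rewrite inE negb_or ws0 andbT eq_sym -size_eq0 Hx addn_eq0 size_eq0 negb_and.
by rewrite eq_sym u0.
Qed.

Lemma shvanish_leq j k f : (j <= k)%N -> shvanish j.+1 f -> shvanish k.+1 f.
Proof.
move=> /subnKC <-; elim: (k - j)%N => [|e IH] Hf; first by rewrite addn0.
by rewrite addnS; apply/shvanishS/IH.
Qed.

Lemma shvanish_shmul k f u : u != [::] -> shvanish k.+1 f -> shvanish k (shmul u f).
Proof.
move=> u0 Hf ws sz ws0; apply: (Hf (u :: ws)) => /=; first by rewrite sz.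
by rewrite inE negb_or ws0 eq_sym u0.
Qed.

(* psi^* is multiplicative for the shuffle product and psi^* w = 2 w modulo
   proper shuffles, hence psi acts as 2^k modulo deeper shuffles. *)
Lemma shev_psi k f ws :
  shvanish k.+1 f -> size ws = k -> [::] \notin ws -> shev (psi f) ws = (2 ^ k)%:R * shev f ws.
Proof.
elim: k f ws => [|k IH] f ws Hf.
  by move=> /size0nil-> _ /=; rewrite psi_nil mul1r.
case: ws => // u ws [sz]; rewrite inE negb_or eq_sym => /andP[u0 ws0] /=.
rewrite shmul_psi shev_sum.
have Hu := shvanish_shmul u0 Hf.
case: u u0 Hu => // a u u0 Hu; rewrite splits_cons /= shmul0.
case/lastP: u u0 Hu => [|u b] u0 Hu.
  by rewrite splits_nil /= shmul0 -mulr2n IH // expnS natrM -mulrA [RHS]mulr_natl.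
rewrite splits_rcons /= shmul0 IH // big1_seq ?add0r => [|p _].
  by rewrite -mulr2n expnS natrM -mulrA [RHS]mulr_natl.
have Hg : shvanish k (shmul (a :: p.1) (shmul (rcons p.2 b) f)).
  apply: shvanish_shmul => //; apply: shvanish_shmul => //.
  by rewrite -size_eq0 size_rcons.
(* A proper cut of the first word produces two nonempty factors, so the term vanishes one order
   earlier. [shvanishS] does not cover [k = 0], where only a constant term is left. *)
case: k {IH Hf Hu} Hg sz (IH) => [|k] Hg sz IH; last first.
  by rewrite IH ?Hg ?mulr0 //; apply: shvanishS.
by rewrite (size0nil sz) /= psi_nil; apply: (Hg [::]).
Qed.

Lemma shvanish_psi k f : shvanish k.+1 f -> shvanish k (psi f - (2 ^ k)%:R *: f).
Proof.
move=> Hf ws sz ws0; rewrite -scaleN1r scalerA shevD shevZ (shev_psi Hf) //.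
by rewrite mulN1r mulNr subrr.
Qed.

(** A word of weight d has at most d letters, and each nonempty factor uses up at least one of
    them. *)
Lemma shvanish_homog d f : homog d f -> shvanish d.+1 f.
Proof.
have gen_ ws : forall (f : A) (e : nat), (forall w, (e < size w)%N -> f w = 0) ->
    (e < size ws)%N -> [::] \notin ws -> shev f ws = 0.
  elim: ws => [|u ws IH] // {}f e Hf sz; rewrite inE negb_or => /andP[u0 ws0] /=.
  case: e sz Hf => [|e] sz Hf.
    case: ws IH ws0 sz => [|v ws] IH ws0 sz /=.
      by rewrite shmulE coprod0r Hf // lt0n size_eq0 eq_sym.
    rewrite (_ : shmul u f = 0) ?shev0 //; last first.
      apply: ser_ext => w; rewrite shmulE /coprod big_seq big1 // => x /size_shuffle Hx.
      by rewrite Hf // Hx addn_gt0 lt0n size_eq0 eq_sym u0.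
    by rewrite -[shev _ _]/(shev 0 (v :: ws)) shev0.
  apply: (IH _ e) => // w Hw; rewrite shmulE /coprod big_seq big1 // => x /size_shuffle Hx.
  apply: Hf; rewrite Hx -addn1 addnC leq_add //.
  by rewrite lt0n size_eq0 eq_sym.
move=> Hf ws sz ws0; apply: (gen_ ws _ d) => // [w Hw|]; last by rewrite sz.
by apply: Hf; rewrite neq_ltn (leq_trans Hw (leq_size_wword w)) orbT.
Qed.

Lemma shvanish2_Lhat f : f [::] = 0 -> shvanish 2 f -> Lhat f.
Proof.
move=> f0 Hf; apply/LhatP; split=> // u v u0 v0.
rewrite -[LHS](coprod0r (shmul u f)) -(Hf [:: u; v]) //.
by rewrite !inE negb_or !(eq_sym [::]) u0.
Qed.

(** The product of the operators [psi - 2^j] for j from 2 to m+1. It kills the symmetric degrees 2,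
    ..., m+1 and rescales degree one, hence is a multiple of the projection to primitives on series
    without constant term of degree at most m+1. *)
Fixpoint psi_proj (m : nat) f : A :=
  if m is m'.+1 then psi_proj m' (psi f - (2 ^ m.+1)%:R *: f) else f.

Lemma psi_proj_shvanish m f : shvanish m.+2 f -> shvanish 2 (psi_proj m f).
Proof. by elim: m f => //= m IH f Hf; apply/IH/shvanish_psi. Qed.

Lemma psi_projD m f h : psi_proj m (f + h) = psi_proj m f + psi_proj m h.
Proof.
elim: m f h => //= m IH f h; rewrite -IH; congr psi_proj.
by rewrite psiD scalerDr opprD addrACA.
Qed.

Lemma psi_proj_nil m f : f [::] = 0 -> psi_proj m f [::] = 0.
Proof.
elim: m f => //= m IH f f0; apply: IH.
by rewrite serB serZ psi_nil f0 mulr0 subr0.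
Qed.

Lemma psi_proj_br m f h : Lhat f ->
  psi_proj m (f * h - h * f) = f * psi_proj m h - psi_proj m h * f.
Proof.
move=> Hf; elim: m h => //= m IH h; rewrite -IH; congr psi_proj.
rewrite psi_br // mulrBr mulrBl -scalerAl -scalerAr scalerBr !opprD !opprK.
by rewrite !addrA; congr (_ + _); rewrite addrAC.
Qed.

Lemma psi_proj_eigen m f c :
  psi f = c *: f -> psi_proj m f = (\prod_(i < m) (c - (2 ^ i.+2)%:R)) *: f.
Proof.
elim: m f => [|m IH] f Hf /=; first by rewrite big_ord0 scale1r.
rewrite IH; last by rewrite Hf -scalerBl psiZ Hf !scalerA mulrC.
by rewrite Hf -scalerBl scalerA big_ord_recr.
Qed.

Hypothesis K0 : [pchar K] =i pred0.

(* Powers of psi separate the symmetric degrees of U(L) = S(L), and psi commutes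
   with ad z, so the Lie part of u already solves the equation. *)
Lemma Lhat_commutator (z q f : A) (mu : K) (d r : nat) :
  Lhat z -> Lhat q -> homog d f -> (0 < d)%N -> (1 < r)%N ->
  q = z * f - f * z + mu *: z ^+ r ->
  exists2 h : A, Lhat h & q = z * h - h * z.
Proof.
(* [m >= d - 1] makes the projection of [f] primitive, and [m > r] ensures that [psi - 2^(r+2)],
   which kills [z ^+ r.+2], is among the factors. *)
move=> Hz Hq Hf d0; case: r => [|[|r]] // _ Eq; pose m := maxn d.-1 r.+1.
pose c := \prod_(i < m) (2%:R - (2 ^ i.+2)%:R : K).
have c0 : c != 0.
  apply/prodf_neq0 => i _; rewrite subr_eq0 eq_sym -subr_eq0 -natrB ?(@leq_pexp2l 2 1) //.
  by have /pcharf0P -> := K0; rewrite subn_eq0 -ltnNge (@ltn_exp2l 2 1).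
have := congr1 (psi_proj m) Eq; rewrite psi_projD psi_proj_br //.
rewrite (psi_proj_eigen _ (psi_Lhat Hq)) -/c.
rewrite (@psi_proj_eigen _ (mu *: z ^+ r.+2) (2 ^ r.+2)%:R); last by rewrite psiZ psiX // !scalerA mulrC.
have r_m : (r < m)%N by rewrite leq_max leqnn orbT.
rewrite (bigD1 (Ordinal r_m)) //= subrr mul0r scale0r addr0 => E.
exists (c^-1 *: psi_proj m f).
  apply: LhatZ; apply: shvanish2_Lhat.
    by apply: psi_proj_nil; apply: Hf; rewrite wword_nil neq_ltn d0.
  apply: psi_proj_shvanish; apply: (shvanish_leq _ (shvanish_homog Hf)).
  by rewrite /m -ltnS -[X in (X < _)%N](prednK d0) !ltnS leq_maxl.
by rewrite -scalerAl -scalerAr -scalerBr -E scalerA mulVf // scale1r.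
Qed.

End Shuffle.

Lemma big_ord_trunc (V : nmodType) (m k : nat) (F : nat -> V) :
  (m <= k)%N -> (forall a, (m <= a)%N -> F a = 0) -> \sum_(a < k) F a = \sum_(a < m) F a.
Proof.
move=> mk F0; rewrite (big_ord_widen k F mk) [LHS](bigID (fun a : 'I_k => (a < m)%N)) /=.
by rewrite [X in _ + X]big1 ?addr0 // => a; rewrite -leqNgt; apply: F0.
Qed.

Lemma rcons_nseq (T : Type) k (t : T) : rcons (nseq k t) t = nseq k.+1 t.
Proof. by elim: k => //= k ->. Qed.

(** * Commutator equations *)

Section Runs.
Variables (K : fieldType) (g n : nat).
Local Notation A := (ser K g n).
Local Notation W := (word g n).
Local Notation L := (letter g n).
Implicit Types (f h q z : A) (u v w : W) (s t x y : L).

(** The cut between [v] and the run is counted in the first sum; in the second, [a] is the length of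
    the tail left to the right of the cut. *)
Lemma splits_nseq (V : nmodType) v M t (G : W * W -> V) :
  \sum_(p <- splits (v ++ nseq M t)) G p
  = \sum_(p <- splits v) G (p.1, p.2 ++ nseq M t)
    + \sum_(a < M) G (v ++ nseq (M - a) t, nseq a t).
Proof.
elim: M G => [|M IH] G.
  by rewrite cats0 big_ord0 addr0; apply: eq_bigr => -[? ?] _; rewrite cats0.
rewrite -rcons_nseq -rcons_cat splits_rcons (IH (fun p => G (p.1, rcons p.2 t))) /= -addrA.
congr (_ + _); first by apply: eq_bigr => p _; rewrite rcons_cat.
rewrite big_ord_recl subn0 addrC -rcons_nseq rcons_cat; congr (_ + _).
by apply: eq_bigr => a _; rewrite lift0 subSS rcons_nseq.
Qed.

Definition ldrop u f : A := fun w => f (u ++ w).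

(** The factorisations are grouped by the suffix that is moved to the front of the word of [f]. When
    [w] ends in a long run, this suffix is a piece of the run unless [f] vanishes by weight. *)
Lemma cd_suffix s f h w :
  cd s f h w = \sum_(p <- splits w) (ldrop (rcons p.2 s) f * h) p.1.
Proof.
rewrite /cd -(splits_assoc w (fun i j k => f (k ++ s :: i) * h j)).
apply: eq_bigr => p _; rewrite serM; apply: eq_bigr => r _.
by rewrite /ldrop cat_rcons.
Qed.

(** The part of (z + q)^k linear in q. Its commutator with z telescopes ([powsum_br]). *)
Definition powsum k z q : A := \sum_(i < k) z ^+ (k - i.+1) * q * z ^+ i.

Lemma powsumS k z q : powsum k.+1 z q = z * powsum k z q + q * z ^+ k.
Proof.
rewrite /powsum big_ord_recr /= subnn expr0 mul1r big_distrr; congr (_ + _).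
by apply: eq_bigr => i _; rewrite /= subSn // exprS !mulrA.
Qed.

Lemma powsum_br k z q : z * powsum k z q - powsum k z q * z = z ^+ k * q - q * z ^+ k.
Proof.
have Er : powsum k.+1 z q = powsum k z q * z + z ^+ k * q.
  rewrite /powsum big_ord_recl subn1 /= mulr1 addrC big_distrl; congr (_ + _).
  by apply: eq_bigr => i _; rewrite /= subSS exprSr !mulrA.
by apply/eqP; rewrite subr_eq addrAC -subr_eq opprK -powsumS Er addrC.
Qed.

Lemma mulX_run (z f : A) m u c k v :
  homog m z -> wword u = m -> z u = c ->
  (f * z ^+ k) (v ++ flatten (nseq k u)) = c ^+ k * f v.
Proof.
move=> Hz Hu zu; elim: k v f => [|k IH] v f; first by rewrite /= cats0 !expr0 mulr1 mul1r.
rewrite /= catA exprS mulrA IH (mul_homr _ _ Hz Hu) zu exprSr -mulrA.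
by congr (_ * _); rewrite mulrC.
Qed.

Lemma flatten_nseq1 k t : flatten (nseq k [:: t]) = nseq k t.
Proof. by elim: k => //= k ->. Qed.

Lemma mulX_runD (z f : A) m u c j k v :
  homog m z -> wword u = m -> z u = c -> (j <= k)%N ->
  (f * z ^+ k) (v ++ flatten (nseq j u)) = c ^+ j * (f * z ^+ (k - j)) v.
Proof.
move=> Hz Hu zu jk; rewrite -[in LHS](subnK jk) exprD mulrA.
exact: mulX_run Hz Hu zu.
Qed.

(* From P + cd s q z^k = e, where P = \sum z^(k-1-i) q z^i, the letter t occurring
   in z with coefficient 1: multiplying words by t^k on the right inverts right
   multiplication by z^k, which turns [z, P] = z^k q - q z^k into a formula for q. *)
Lemma letter_run (m B k : nat) z q (e : A) s t :
  homog m z -> wt t = m -> z [:: t] = 1 ->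
  (forall w, (B < wword w)%N -> q w = 0) -> (B < k)%N ->
  powsum k z q + cd s q (z ^+ k) = e ->
  (forall v, v != [::] -> (z * e - e * z) (v ++ nseq k t) = 0) ->
  exists f : A, q = z * f - f * z + \sum_(a < k) q (nseq a t) *: z ^+ a.
Proof.
move=> Hz Ht zt Hq Bk EP He.
have m0 : (0 < m)%N by rewrite -Ht wt_gt0.
have Hu : wword [:: t] = m by rewrite wword_cons wword_nil addn0.
have run f j l v : (j <= l)%N -> (f * z ^+ l) (v ++ nseq j t) = (f * z ^+ (l - j)) v.
  by move=> jl; rewrite -flatten_nseq1 (mulX_runD _ _ Hz Hu zt jl) expr1n mul1r.
have big_q u v a : (B <= a)%N -> q (u ++ nseq a t ++ s :: v) = 0.
  move=> Ba; apply: Hq; apply: leq_trans (leq_size_wword _).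
  by rewrite !size_cat size_nseq /= addnCA !addnS ltnS (leq_trans Ba) ?leq_addr.
pose T3 := cd s q (z ^+ k).
pose Q a := ldrop (rcons (nseq a t) s) q.
have Q0 a : (B <= a)%N -> Q a = 0.
  by move=> Ba; apply: ser_ext => v; rewrite /Q /ldrop cat_rcons (big_q [::]).
have T3run M v : (B <= M <= k)%N ->
    T3 (v ++ nseq M t) = \sum_(a < B) (Q a * z ^+ (k - (M - a))) v.
  move=> /andP[BM Mk]; rewrite /T3 cd_suffix splits_nseq big1 ?add0r => [|p _]; last first.
    rewrite (_ : ldrop _ q = 0) ?mul0r //; apply: ser_ext => x.
    by rewrite /ldrop cat_rcons -catA big_q.
  rewrite (big_ord_trunc (F := fun a => (Q a * z ^+ k) (v ++ nseq (M - a) t)) BM) => [|a Ba].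
    apply: eq_bigr => a _; rewrite run //; apply: leq_trans Mk; exact: leq_subr.
  by rewrite Q0 // mul0r.
(* [T3] with the right factor z^k undone. Only tails shorter than [B] survive, so [f] is the sum of
   the [Q a * z ^+ a]. *)
pose f : A := fun v => T3 (v ++ nseq k t); exists f.
apply: ser_ext => v; rewrite serD ser_sum serB.
(* The empty word is treated apart: below, a prefix reaching into the run must weigh more than [m],
   which requires [v] to be nonempty. *)
have [->|v0] := eqVneq v [::].
  rewrite !serM !splits_nil /= mulrC subrr add0r.
  case: k Bk {EP He run T3 T3run f} => // k Bk; rewrite big_ord_recl big1 => [|a _].
    by rewrite serZ expr0 ser1 mulr1 addr0.
  by rewrite serZ (homogX Hz) ?mulr0 // wword_nil lift0 mulSn eq_sym addn_eq0 -leqn0 leqNgt m0.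
have EB : z ^+ k * q - q * z ^+ k = (z * e - e * z) - (z * T3 - T3 * z).
  rewrite -powsum_br (_ : powsum k z q = e - T3); last by rewrite -EP addrK.
  by rewrite mulrBr mulrBl !opprB addrACA [RHS]addrACA [- (z * T3) - _]addrC.
have := congr1 (fun h : A => h (v ++ nseq k t)) EB.
rewrite [in RHS]serB He // sub0r !serB.
have -> : (q * z ^+ k) (v ++ nseq k t) = q v by rewrite run // subnn expr0 mulr1.
have -> : (T3 * z) (v ++ nseq k t) = (f * z) v.
  have k0 : (0 < k)%N by apply: leq_trans Bk.
  (* One letter of the run is spent on the factor [z], so [T3] is read on a run of length [k - 1];
     hence the strict bound [B < k]. *)
  have BkP : (B <= k.-1 <= k)%N by rewrite leq_pred -ltnS prednK // Bk.
  have -> : nseq k t = rcons (nseq k.-1 t) t by rewrite rcons_nseq prednK.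
  rewrite -cats1 catA (mul_homr _ _ Hz Hu) zt mulr1 T3run //.
  have -> : f = \sum_(a < B) Q a * z ^+ a.
    apply: ser_ext => w; rewrite /f T3run ?leqnn ?(ltnW Bk) // ser_sum.
    apply: eq_bigr => a _; rewrite subKn //.
    by apply: ltnW; apply: ltn_trans Bk.
  rewrite big_distrl ser_sum; apply: eq_bigr => a _.
  have ak : (a <= k.-1)%N by apply: (leq_trans (ltnW (ltn_ord a))); case/andP: BkP.
  by rewrite /= -mulrA -exprSr -{1}(prednK k0) subSn ?leq_subr // subKn.
have -> : (z * T3) (v ++ nseq k t) = (z * f) v.
  rewrite !serM splits_nseq [X in _ + X]big1 ?addr0 // => a _.
  rewrite Hz ?mul0r // wword_cat neq_ltn; apply/orP; right.
  case: (ltnP a k) (ltn_ord a) => // ak _; rewrite -(subnSK ak) wword_cons Ht.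
  by rewrite addnCA -addn1 leq_add2l addn_gt0 lt0n wword_eq0 v0.
have -> : (z ^+ k * q) (v ++ nseq k t) = \sum_(a < k) (q (nseq a t) *: z ^+ a) v.
  rewrite serM splits_nseq big1 ?add0r => [|p _].
    apply: eq_bigr => a _; rewrite -[z ^+ k]mul1r run ?leq_subr //.
    by rewrite subKn ?mul1r ?serZ 1?mulrC // ltnW.
  rewrite Hq ?mulr0 //; apply: leq_trans Bk _; apply: leq_trans (leq_size_wword _).
  by rewrite size_cat size_nseq leq_addl.
by move=> E; rewrite -[LHS](subKr (\sum_(a < k) (q (nseq a t) *: z ^+ a) v)) E opprK addrC.
Qed.

Definition xyrun x y k : W := flatten (nseq k [:: x; y]).

Lemma xyrunS x y k : rcons (rcons (xyrun x y k) x) y = xyrun x y k.+1.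
Proof. by elim: k => //= k IH; rewrite /xyrun /= -/(xyrun x y k) IH. Qed.
Lemma xyrun_shift x y k : rcons (xyrun x y k) x = x :: xyrun y x k.
Proof. by elim: k => //= k IH; rewrite /xyrun /= -/(xyrun x y k) IH. Qed.
Lemma size_xyrun x y k : size (xyrun x y k) = k.*2.
Proof. by elim: k => //= k ->. Qed.

Lemma splits_xyrun (V : nmodType) v M x y (G : W * W -> V) :
  \sum_(p <- splits (v ++ xyrun x y M)) G p
  = \sum_(p <- splits v) G (p.1, p.2 ++ xyrun x y M)
    + (\sum_(a < M) G (v ++ xyrun x y (M - a), xyrun x y a)
       + \sum_(a < M) G (rcons (v ++ xyrun x y (M - a.+1)) x, y :: xyrun x y a)).
Proof.
elim: M G => [|M IH] G.
  by rewrite cats0 !big_ord0 !addr0; apply: eq_bigr => -[? ?] _; rewrite cats0.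
rewrite -xyrunS -!rcons_cat !splits_rcons (IH (fun p => G (p.1, rcons (rcons p.2 x) y))) /=.
have -> : \sum_(a < M.+1) G (v ++ xyrun x y (M.+1 - a), xyrun x y a)
    = G (rcons (rcons (v ++ xyrun x y M) x) y, [::])
      + \sum_(a < M) G (v ++ xyrun x y (M - a), rcons (rcons (xyrun x y a) x) y).
  rewrite big_ord_recl subn0 -xyrunS -!rcons_cat; congr (_ + _).
  by apply: eq_bigr => a _; rewrite lift0 subSS xyrunS.
have -> : \sum_(a < M.+1) G (rcons (v ++ xyrun x y (M.+1 - a.+1)) x, y :: xyrun x y a)
    = G (rcons (v ++ xyrun x y M) x, [:: y])
      + \sum_(a < M) G (rcons (v ++ xyrun x y (M - a.+1)) x,
                        y :: rcons (rcons (xyrun x y a) x) y).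
  rewrite big_ord_recl subn1; congr (_ + _).
  by apply: eq_bigr => a _; rewrite lift0 subSS xyrunS.
rewrite -!addrA; congr (_ + _); first by apply: eq_bigr => p _; rewrite -!rcons_cat.
rewrite [RHS]addrCA; congr (_ + _); rewrite addrCA [RHS]addrCA.
by congr (_ + _); rewrite addrC.
Qed.

(* The words (xy)^k also fit z = [x, y] + ... shifted by one letter, where they pair
   with (yx)^k and contribute a multiple of (-1)^k; comparing two consecutive k
   removes this contribution. *)
Lemma xy_run (z q : A) x y d :
  (2%:R : K) != 0 ->
  homog 2 z -> wt x = 1%N -> wt y = 1%N -> x != y -> z [:: x; y] = 1 -> z [:: y; x] = -1 ->
  homog d q -> (2 < d)%N ->
  (forall k, (d.+2 <= k)%N -> exists2 e : A, z * e = e * z &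
     gen K x * (powsum k z q - e) - (powsum k z q - e) * gen K x = cd y q (z ^+ k)) ->
  exists f : A, forall v, wword v = d ->
    q v = (z * f - f * z + \sum_(a < d) q (xyrun x y a) *: z ^+ a) v.
Proof.
move=> K2 Hz Hx Hy xy zxy zyx Hq d2 HE.
have w_xy : wword [:: x; y] = 2 by rewrite !wword_cons wword_nil Hx Hy.
have w_yx : wword [:: y; x] = 2 by rewrite !wword_cons wword_nil Hx Hy.
have run (f : A) j k v : (j <= k)%N ->
    (f * z ^+ k) (v ++ xyrun x y j) = (f * z ^+ (k - j)) v.
  by move=> jk; rewrite /xyrun (mulX_runD _ _ Hz w_xy zxy jk) expr1n mul1r.
have run' (f : A) j k v : (j <= k)%N ->
    (f * z ^+ k) (rcons (v ++ xyrun x y j) x) = (-1) ^+ j * (f * z ^+ (k - j)) (rcons v x).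
  by move=> jk; rewrite rcons_cat xyrun_shift -cat_rcons /xyrun (mulX_runD _ _ Hz w_yx zyx jk).
have long u a v : (d <= a)%N -> q (u ++ xyrun x y a ++ v) = 0.
  move=> da; apply: Hq; rewrite neq_ltn; apply/orP; right.
  apply: leq_trans (leq_size_wword _); rewrite !size_cat size_xyrun addnCA -addnn -addnA.
  rewrite -addn1 leq_add // addn_gt0; apply/orP; left.
  by apply: leq_trans da; apply: ltn_trans d2.
have sgn M a : (a < M)%N -> (-1) ^+ (M - a.+1) = (-1) ^+ M * (-1) ^+ a.+1 :> K.
  move=> aM; rewrite -[in RHS](subnK aM) exprD -mulrA -exprD.
  by rewrite [X in _ * X](_ : _ = 1) ?mulr1 // addnn -signr_odd odd_double.
(* A tail of (xy)^M is (xy)^a or y(xy)^a. The second cut splits a pair, and what precedes it reads v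
   x (yx)^j, on which each factor z gives -1. *)
pose Q a := ldrop (rcons (xyrun x y a) y) q.
pose Q' a := ldrop (rcons (y :: xyrun x y a) y) q.
have Q0 a : (d <= a)%N -> Q a = 0.
  by move=> da; apply: ser_ext => v; rewrite /Q /ldrop cat_rcons (long [::]).
have Q'0 a : (d <= a)%N -> Q' a = 0.
  by move=> da; apply: ser_ext => v; rewrite /Q' /ldrop cat_rcons (long [:: y]).
have T3run k M v : (d <= M <= k)%N ->
    cd y q (z ^+ k) (v ++ xyrun x y M)
    = \sum_(a < d) (Q a * z ^+ (k - (M - a))) v
      + (-1) ^+ M * \sum_(a < d) (-1) ^+ a.+1 * (Q' a * z ^+ (k - (M - a.+1))) (rcons v x).
  move=> /andP[dM Mk]; rewrite cd_suffix splits_xyrun big1 ?add0r => [|p _]; last first.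
    rewrite (_ : ldrop _ q = 0) ?mul0r //; apply: ser_ext => w.
    by rewrite /ldrop cat_rcons -catA long.
  congr (_ + _).
    rewrite (big_ord_trunc (F := fun a => (Q a * z ^+ k) (v ++ xyrun x y (M - a))) dM) => [|a da].
      by apply: eq_bigr => a _; rewrite run // (leq_trans (leq_subr _ _) Mk).
    by rewrite Q0 // mul0r.
  rewrite (big_ord_trunc
    (F := fun a => (Q' a * z ^+ k) (rcons (v ++ xyrun x y (M - a.+1)) x)) dM) => [|a da].
    rewrite big_distrr; apply: eq_bigr => a _ /=.
    rewrite run' ?(leq_trans (leq_subr _ _) Mk) // sgn ?mulrA //.
    exact: leq_trans (ltn_ord a) dM.
  by rewrite Q'0 // mul0r.
pose f0 : A := ldrop [:: x] (\sum_(a < d) Q a * z ^+ a).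
(* [Y1], [Y2], [Y3] are the contributions of the split pairs to [z * P], [P * z] and [z ^+ k * q].
   They carry the sign (-1)^k, while [X] gathers what does not depend on k. *)
pose Y1 v := \sum_(a < d) (-1) ^+ a.+1 * (Q' a * z ^+ a.+1) (rcons v x).
pose Y2 v := \sum_(a < d) (-1) ^+ a.+1 * (Q' a * z ^+ a.+2) (rcons v x).
pose Y3 v := \sum_(a < d) (-1) ^+ a.+1 * ((z ^+ a.+1) (rcons v x) * q (y :: xyrun x y a)).
pose Y v := Y3 v - (\sum_(p <- splits v) z p.1 * Y1 (x :: p.2)) - Y2 (x :: v).
pose X v := (\sum_(a < d) q (xyrun x y a) *: z ^+ a) v - ((z * f0) v - (f0 * z) v).
have main k v : (d.+2 <= k)%N -> wword v = d -> q v = X v + (-1) ^+ k * Y v.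
  move=> dk Hv; have [e He HT] := HE k dk.
  have k0 : (0 < k)%N by apply: leq_trans dk.
  have dk0 : (d <= k)%N by apply: leq_trans dk; rewrite -addn2 leq_addr.
  set P := powsum k z q - e in HT.
  (* On a word beginning with x and ending with y only the term x P of [x, P] survives, so the
     equation determines P on all words ending in y. This is why [f0] prepends an x. *)
  have PE w : P (rcons w y) = cd y q (z ^+ k) (x :: rcons w y).
    rewrite -HT serB mul_genl eqxx mul1r -rcons_cons mul_genr.
    by rewrite eq_sym (negbTE xy) mulr0 subr0.
  have Prun w j : (0 < j)%N -> P (w ++ xyrun x y j) = cd y q (z ^+ k) ((x :: w) ++ xyrun x y j).
    by case: j => // j _; rewrite -xyrunS -!rcons_cat PE.
  have EB : z ^+ k * q - q * z ^+ k = z * P - P * z.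
    by rewrite /P mulrBr mulrBl He opprB addrA subrK -powsum_br.
  have := congr1 (fun h : A => h (v ++ xyrun x y k)) EB; rewrite !serB.
  rewrite (run q k k v (leqnn _)) subnn expr0 mulr1.
  have -> : (z ^+ k * q) (v ++ xyrun x y k)
      = (\sum_(a < d) q (xyrun x y a) *: z ^+ a) v + (-1) ^+ k * Y3 v.
    rewrite serM splits_xyrun big1 ?add0r => [|p _].
      congr (_ + _).
        rewrite (big_ord_trunc
          (F := fun a => (z ^+ k) (v ++ xyrun x y (k - a)) * q (xyrun x y a)) dk0) => [|a da].
          rewrite ser_sum; apply: eq_bigr => a _.
          rewrite -[z ^+ k]mul1r run ?leq_subr // subKn ?mul1r ?serZ 1?mulrC //.
          exact: leq_trans (ltnW (ltn_ord a)) dk0.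
        by have := long [::] a [::] da; rewrite cats0 /= => ->; rewrite mulr0.
      rewrite (big_ord_trunc
        (F := fun a => (z ^+ k) (rcons (v ++ xyrun x y (k - a.+1)) x) * q (y :: xyrun x y a)) dk0)
        => [|a da].
        rewrite big_distrr; apply: eq_bigr => a _ /=.
        have ak : (a < k)%N by apply: leq_trans dk0.
        by rewrite -[z ^+ k]mul1r run' ?leq_subr // subKn // mul1r sgn // !mulrA.
      by have := long [:: y] a [::] da; rewrite cats0 /= => ->; rewrite mulr0.
    by have := long p.2 k [::] dk0; rewrite cats0 => ->; rewrite mulr0.
  have -> : (P * z) (v ++ xyrun x y k) = (f0 * z) v - (-1) ^+ k * Y2 (x :: v).
    rewrite -(prednK k0) -xyrunS -!rcons_cat -!cats1 -catA (mul_homr _ _ Hz w_xy) zxy mulr1.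
    rewrite Prun; last by rewrite -ltnS prednK //; apply: leq_trans dk.
    rewrite T3run; last by rewrite leq_pred -ltnS prednK // (leq_trans _ dk).
    congr (_ + _).
      transitivity (((\sum_(a < d) Q a * z ^+ a) * z) (x :: v)); last first.
        rewrite serM splits_cons Hz ?mulr0 ?add0r ?serM //.
        by rewrite wword_cons Hx Hv neq_ltn; apply/orP; right; rewrite add1n ltnS ltnW.
      rewrite big_distrl ser_sum; apply: eq_bigr => a _ /=.
      have ak : (a <= k.-1)%N by rewrite -ltnS prednK //; apply: leq_trans dk0.
      by rewrite -mulrA -exprSr -{1}(prednK k0) subSn ?leq_subr // subKn.
    rewrite exprS mulN1r mulNr opprK; congr (_ * _); apply: eq_bigr => a _.
    have ak : (a < k.-1)%N.
      by rewrite -ltnS prednK //; apply: leq_trans dk; rewrite ltnS ltnS ltnW.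
    by rewrite -{1}(prednK k0) subSn ?leq_subr // subKn.
  have -> : (z * P) (v ++ xyrun x y k)
      = (z * f0) v + (-1) ^+ k * \sum_(p <- splits v) z p.1 * Y1 (x :: p.2).
    rewrite serM splits_xyrun [X in _ + (X + _)]big1 => [|a _].
      rewrite [X in _ + (_ + X)]big1 ?addr0 => [|a _].
    - rewrite big_distrr serM -big_split; apply: eq_bigr => p _.
      rewrite Prun // T3run ?leqnn ?dk0 // mulrDr; congr (_ + _).
        congr (_ * _); rewrite /f0 /ldrop ser_sum; apply: eq_bigr => a _.
        by rewrite subKn //; apply: leq_trans (ltnW (ltn_ord a)) dk0.
      rewrite /= mulrCA; congr (_ * (_ * _)); apply: eq_bigr => a _.
      by rewrite subKn //; apply: leq_trans dk0.
    - rewrite Hz ?mul0r // wword_rcons wword_cat Hv neq_ltn Hx addn1 -addSn.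
      by apply/orP; right; apply: ltn_addr; apply: ltnW.
    - rewrite Hz ?mul0r // wword_cat Hv neq_ltn.
      by apply/orP; right; apply: ltn_addr.
  move=> E; rewrite -[LHS](subKr ((\sum_(a < d) q (xyrun x y a) *: z ^+ a) v + (-1) ^+ k * Y3 v)) E.
  by rewrite /X /Y; ring.
exists (- f0) => v Hv.
have := main d.+2 v (leqnn _) Hv; rewrite {1}(main d.+3 v (leqnSn _) Hv) => /addrI/eqP.
rewrite exprS mulN1r mulNr -subr_eq0 -opprD oppr_eq0 -mulr2n -mulr_natl mulf_eq0 (negbTE K2) /=.
move=> /eqP Y0; rewrite (main d.+2 v) // Y0 addr0 /X serD serB mulrN mulNr !serN opprK.
by rewrite [RHS]addrC opprB [X in _ = _ + X]addrC.
Qed.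

Lemma hcompD d f h : hcomp d (f + h) = hcomp d f + hcomp d h.
Proof. by apply: ser_ext => w; rewrite serD /hcomp; case: ifP; rewrite ?addr0. Qed.
Lemma hcompN d f : hcomp d (- f) = - hcomp d f.
Proof. by apply: ser_ext => w; rewrite serN /hcomp; case: ifP; rewrite ?oppr0. Qed.
Lemma hcomp_mull m d z f : homog m z -> hcomp (m + d) (z * f) = z * hcomp d f.
Proof.
move=> Hz; apply: ser_ext => w; rewrite [LHS]/hcomp !serM.
rewrite (_ : (if _ then _ else _) = \sum_(p <- splits w)
  (if wword w == (m + d)%N then z p.1 * f p.2 else 0)); last by case: ifP => // _; rewrite big1.
rewrite big_seq [RHS]big_seq; apply: eq_bigr => p /splits_catK <-; rewrite wword_cat /hcomp.
by have [->|/Hz->] := eqVneq (wword p.1) m; rewrite ?eqn_add2l ?mul0r ?if_same //; case: ifP; rewrite ?mulr0.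
Qed.
Lemma hcomp_mulr m d z f : homog m z -> hcomp (m + d) (f * z) = hcomp d f * z.
Proof.
move=> Hz; apply: ser_ext => w; rewrite [LHS]/hcomp !serM.
rewrite (_ : (if _ then _ else _) = \sum_(p <- splits w)
  (if wword w == (m + d)%N then f p.1 * z p.2 else 0)); last by case: ifP => // _; rewrite big1.
rewrite big_seq [RHS]big_seq; apply: eq_bigr => p /splits_catK <-; rewrite wword_cat /hcomp.
by rewrite addnC; have [->|/Hz->] := eqVneq (wword p.2) m;
  rewrite ?eqn_add2l ?mulr0 ?if_same //; case: ifP; rewrite ?mul0r.
Qed.

(** In weight d only the component of f of weight d - 2 and the power z^(d/2) contribute; d > 2
    makes this exponent at least 2, as [Lhat_commutator] requires. *)
Lemma Lhat_solve (z q f : A) d k (c : nat -> K) :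
  [pchar K] =i pred0 -> Lhat z -> Lhat q -> homog 2 z -> homog d q -> (2 < d)%N ->
  (forall v, wword v = d -> q v = (z * f - f * z + \sum_(a < k) c a *: z ^+ a) v) ->
  exists h : A, [/\ Lhat h, homog (d - 2) h & q = z * h - h * z].
Proof.
move=> K0 Lz Lq Hz Hq d2 E; have Ed := subnKC (ltnW d2).
have [h Lh Eh] : exists2 h : A, Lhat h & q = z * h - h * z.
  have d20 : (0 < d - 2)%N by rewrite subn_gt0.
  pose F mu r : A := z * hcomp (d - 2) f - hcomp (d - 2) f * z + mu *: z ^+ r.
  suff [mu [r r1 Eq]] : exists mu, exists2 r, (1 < r)%N & q = F mu r.
    exact: (Lhat_commutator K0 Lz Lq (@homog_hcomp _ _ _ (d - 2) f) d20 r1 Eq).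
  have ES w : (\sum_(a < k) c a *: z ^+ a) w = \sum_(a < k | (a * 2 == wword w)%N) c a * (z ^+ a) w.
    rewrite ser_sum [RHS]big_mkcond; apply: eq_bigr => a _; case: eqVneq => // /eqP Ha.
    by rewrite serZ (homogX Hz) ?mulr0 // eq_sym; apply/eqP.
  have EF w mu r : wword w = d -> F mu r w = (z * f - f * z) w + mu * (z ^+ r) w.
    move=> Hw; rewrite /F -{1}(hcomp_mull _ _ Hz) -(hcomp_mulr _ _ Hz) Ed serD !serB serZ.
    by rewrite /hcomp Hw eqxx.
  have EF0 w mu r : wword w != d -> (r * 2 = d)%N \/ mu = 0 -> F mu r w = 0.
    move=> Hw Hr; rewrite /F -{1}(hcomp_mull _ _ Hz) -(hcomp_mulr _ _ Hz) Ed serD !serB serZ.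
    rewrite /hcomp (negbTE Hw) subrr add0r; case: Hr => [Er|->]; last by rewrite mul0r.
    by rewrite (homogX Hz) ?mulr0 // Er.
  have [dodd|deven] := boolP (odd d).
    (* No power of z has odd weight; the exponent 2 with coefficient 0 is a placeholder. *)
    exists 0, 2 => //; apply: ser_ext => w; have [Hw|Hw] := eqVneq (wword w) d; last first.
      by rewrite Hq // EF0 //; right.
    rewrite E // EF // mul0r serD ES big1 // => a; rewrite Hw => /eqP Ha.
    by rewrite -Ha oddM andbF in dodd.
  have Er : (d./2 * 2 = d)%N by rewrite muln2 even_halfK.
  exists (if (d./2 < k)%N then c d./2 else 0), d./2.
    by rewrite -(@ltn_pmul2r 2) // Er mul1n.
  apply: ser_ext => w; have [Hw|Hw] := eqVneq (wword w) d; last by rewrite Hq // EF0 //; left.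
  rewrite E // EF // serD ES; congr (_ + _); case: ifP => Hk; last first.
    rewrite mul0r big1 // => a; rewrite Hw -Er eqn_pmul2r // => /eqP Ha.
    by rewrite -Ha ltn_ord in Hk.
  rewrite (big_pred1 (Ordinal Hk)) // => a /=.
  by rewrite Hw -[X in _ == X]Er eqn_pmul2r.
exists (hcomp (d - 2) h); split; [exact: Lhat_hcomp | exact: homog_hcomp | ].
rewrite -(hcomp_mull _ _ Hz) -(hcomp_mulr _ _ Hz) Ed -hcompN -hcompD -Eh.
by rewrite hcomp_homog.
Qed.

(** Commute z^(e+1) past f and read the result on v t^(e+1): this run is too heavy for f, so f only
    sees a shorter piece t^a of it, and z^(e+1-a) strips off the rest. *)
Lemma centralizer_letter (z f : A) m e t :
  homog m z -> wt t = m -> z [:: t] = 1 -> homog e f -> z * f = f * z ->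
  f = \sum_(a < e.+1) f (nseq a t) *: z ^+ a.
Proof.
move=> Hz Ht zt Hf C; have Hu : wword [:: t] = m by rewrite wword_cons wword_nil addn0.
have run (h : A) j l v : (j <= l)%N -> (h * z ^+ l) (v ++ nseq j t) = (h * z ^+ (l - j)) v.
  by move=> jl; rewrite -flatten_nseq1 (mulX_runD _ _ Hz Hu zt jl) expr1n mul1r.
have Ce : z ^+ e.+1 * f = f * z ^+ e.+1 by apply/esym/commrX/esym.
apply: ser_ext => v; rewrite ser_sum.
have -> : f v = (f * z ^+ e.+1) (v ++ nseq e.+1 t) by rewrite run // subnn expr0 mulr1.
rewrite -Ce serM splits_nseq big1 ?add0r => [|p _].
  apply: eq_bigr => a _; rewrite -[z ^+ e.+1]mul1r run ?leq_subr //.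
  by rewrite subKn ?mul1r ?serZ 1?mulrC // ltnW.
rewrite Hf ?mulr0 // neq_ltn; apply/orP; right.
by apply: leq_trans (leq_size_wword _); rewrite size_cat size_nseq leq_addl.
Qed.

End Runs.

Lemma addr_swap2 (V : zmodType) (a b c b' c' : V) :
  a + (b + c) + (b' - b) + (c' - c) = a + b' + c'.
Proof. by rewrite -addrA [X in _ + X]addrACA -opprD -(addrA a) (addrC (b + c)) subrK addrA. Qed.

Lemma not_all_pred1 (T : eqType) (t : T) w : ~~ all (pred1 t) w ->
  exists k y u, y != t /\ w = nseq k t ++ y :: u.
Proof.
elim: w => //= y w IH; have [->|yt] := eqVneq y t; last by exists 0%N, y, w.
by move=> /IH[k [x [u [xt ->]]]]; exists k.+1, x, u.
Qed.

Lemma wword_nseq g n k (t : letter g n) : wword (nseq k t) = (k * wt t)%N.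
Proof. by elim: k => [|k IH]; rewrite ?wword_nil //= wword_cons IH mulSn. Qed.

(** * Derivations acting by zero on |A| *)

Section Inner.
Variables (K : fieldType) (g n : nat).
Local Notation A := (ser K g n).
Local Notation W := (word g n).
Local Notation L := (letter g n).
Implicit Types (f h q z : A) (u v w b : W) (s t x y a : L).

Definition mono b : A := foldr (fun a f => gen K a * f) 1 b.

Lemma monoE b w : mono b w = (w == b)%:R.
Proof.
elim: b w => [|a b IH] [|c w] /=; rewrite ?ser1 // ?mul_genl0 // mul_genl IH.
by rewrite eqseq_cons -mulnb natrM.
Qed.

Lemma mono_cat u v : mono (u ++ v) = mono u * mono v.
Proof. by elim: u => [|a u IH] /=; rewrite ?mul1r // IH mulrA. Qed.
Lemma mono_nseq k t : mono (nseq k t) = gen K t ^+ k.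
Proof. by elim: k => //= k ->; rewrite exprS. Qed.

(* Vanishing in |A| modulo constants, detected by the cyclic derivatives. *)
Definition tr0 f : Prop := forall s, del s f = 0.

Lemma tr0D f h : tr0 f -> tr0 h -> tr0 (f + h).
Proof. by move=> Hf Hh s; rewrite /del cdDl -!/(del s _) Hf Hh addr0. Qed.
Lemma tr0Z c f : tr0 f -> tr0 (c *: f).
Proof. by move=> Hf s; rewrite /del cdZl -!/(del s _) Hf scaler0. Qed.
Lemma tr0N f : tr0 f -> tr0 (- f).
Proof. by move=> Hf; rewrite -scaleN1r; apply: tr0Z. Qed.
Lemma tr0B f h : tr0 f -> tr0 h -> tr0 (f - h).
Proof. by move=> Hf Hh; apply/tr0D/tr0N. Qed.
Lemma tr0_br f h : tr0 (f * h - h * f).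
Proof. by move=> s; rewrite /del cdBl -!/(del s _) delC subrr. Qed.
Lemma tr0_0 : tr0 (0 : A).
Proof. by move=> s; rewrite /del cd0l. Qed.
Lemma tr0_sum (I : Type) (r : seq I) (P : pred I) (F : I -> A) :
  (forall i, P i -> tr0 (F i)) -> tr0 (\sum_(i <- r | P i) F i).
Proof. by move=> HF; elim/big_ind: _ => //; [apply: tr0_0 | apply: tr0D]. Qed.

Lemma sum_letter a (F : L -> A) w : (\sum_s gen K s * F s) (a :: w) = F a w.
Proof.
rewrite ser_sum (bigD1 a) //= mul_genl eqxx mul1r big1 ?addr0 // => s /negbTE sa.
by rewrite mul_genl eq_sym sa mul0r.
Qed.
Lemma sum_letter_r a (F : L -> A) w : (\sum_s F s * gen K s) (rcons w a) = F a w.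
Proof.
rewrite ser_sum (bigD1 a) //= mul_genr eqxx mulr1 big1 ?addr0 // => s /negbTE sa.
by rewrite mul_genr eq_sym sa mulr0.
Qed.

(** Both sides are the sum of all rotations of the nonempty words of [f]. *)
Lemma del_euler f : \sum_s gen K s * del s f = \sum_s del s f * gen K s.
Proof.
apply: ser_ext => -[|a w].
  by rewrite !ser_sum !big1 // => s _; rewrite ?mul_genl0 ?mul_genr0.
rewrite sum_letter; case/lastP: w => [|w c].
  by rewrite (@sum_letter_r a _ [::]) .
rewrite -rcons_cons sum_letter_r !delE splits_rcons splits_cons /= addrC cats1.
congr (_ + _); apply: eq_bigr => p _; rewrite cat_rcons //.
Qed.

(** Inner derivations act by zero on [|A|]. The identity is kept in A, with explicit commutators, so
    that it can also be transported by a substitution. *)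
Lemma ad_del f h : \sum_s (gen K s * f - f * gen K s) * del s h
  = \sum_s (gen K s * (f * del s h) - (f * del s h) * gen K s).
Proof.
have E : \sum_s f * (gen K s * del s h) = \sum_s f * (del s h * gen K s).
  by rewrite -!big_distrr /= del_euler.
under [LHS]eq_bigr do rewrite mulrBl -!mulrA.
under [RHS]eq_bigr do rewrite -!mulrA.
by rewrite !sumrB E.
Qed.

Lemma tr0_ad f h : tr0 (\sum_s (gen K s * f - f * gen K s) * del s h).
Proof. by rewrite ad_del; apply: tr0_sum => s _; apply: tr0_br. Qed.

Section TraceZero.
Hypothesis K0 : [pchar K] =i pred0.

Lemma natr_neq0 k : (k%:R == 0 :> K) = (k == 0%N).
Proof. by have /pcharf0P := K0. Qed.

Lemma tr0_scale c f : c != 0 -> tr0 (c *: f) -> tr0 f.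
Proof. by move=> c0 /(tr0Z c^-1); rewrite scalerA mulVf // scale1r. Qed.

(** The cyclic derivative of q t^k along t is the expression of [letter_run] with z = t. This leaves
    a polynomial in t, whose coefficients are then read off its trace. *)
Lemma trace_commutator t q B :
  (forall w, (B < wword w)%N -> q w = 0) ->
  (forall k, tr0 (q * gen K t ^+ k)) ->
  exists f : A, q = gen K t * f - f * gen K t.
Proof.
move=> Hq Htr; pose k := B.+1.
have tt : gen K t [:: t] = 1 by rewrite genE eqxx.
have E : powsum k (gen K t) q + cd t q (gen K t ^+ k) = 0.
  rewrite -(Htr k t) delM cdX addrC; congr (_ + _); apply: eq_bigr => i _.
  by rewrite cd_gen eqxx scale1r.
have H0 v : v != [::] -> (gen K t * 0 - 0 * gen K t) (v ++ nseq k t) = 0.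
  by rewrite mulr0 mul0r subrr.
have [f Ef] := letter_run (@homog_gen K g n t) (erefl _) tt Hq (leqnn B.+1) E H0.
exists f; rewrite Ef big1 ?addr0 // => a _; set R := \sum_(a < k) _ in Ef.
suff -> : q (nseq a t) = 0 by rewrite scale0r.
(* The extra factor t makes the constant term of [R] visible, since cyclic derivatives do not see
   constants. *)
have trR : tr0 (R * gen K t).
  rewrite (_ : R = q - (gen K t * f - f * gen K t)); last by rewrite Ef addrC addKr.
  rewrite mulrBl; apply: tr0B; first exact: (Htr 1%N).
  by rewrite mulrBl -mulrA; apply: tr0_br.
have := congr1 (fun h : A => h (nseq a t)) (trR t).
rewrite big_distrl /= /del cd_suml ser_sum (bigD1 a) //= big1 ?addr0 => [|c ca].
  rewrite -scalerAl -exprSr cdZl serZ -[cd t _ 1]/(del t _) delX cd_gen eqxx scale1r serZ.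
  rewrite -mono_nseq monoE eqxx mulr1 => /eqP.
  by rewrite mulf_eq0 natr_neq0 orbF => /eqP.
rewrite -scalerAl -exprSr cdZl serZ -[cd t _ 1]/(del t _) delX cd_gen eqxx scale1r serZ.
rewrite -mono_nseq monoE; case: eqVneq => [/(congr1 size)|]; last by rewrite !mulr0.
by rewrite !size_nseq => E'; rewrite -val_eqE /= -E' eqxx in ca.
Qed.

(** Moving one t from the right end to the left end makes the two halves of the commutator
    telescope; the end letters x and y, different from t, remove the boundary terms. *)
Lemma br_zero_sum t (h : A) x u v y (k : nat) :
  x != t -> y != t -> x :: u = rcons v y ->
  \sum_(i < k.+1) (gen K t * h - h * gen K t) (nseq i t ++ (x :: u) ++ nseq (k - i) t) = 0.
Proof.
move=> xt yt E; under eq_bigr do rewrite serB.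
rewrite sumrB big_ord_recl [X in _ - X]big_ord_recr /= mul_genl (negbTE xt) mul0r add0r.
have -> : nseq k t ++ x :: u ++ nseq (k - k) t = rcons (nseq k t ++ v) y.
  by rewrite subnn cats0 E rcons_cat.
rewrite mul_genr (negbTE yt) mulr0 addr0; apply/eqP.
rewrite subr_eq0; apply/eqP; apply: eq_bigr => i _ /=.
rewrite mul_genl eqxx mul1r -(subnSK (ltn_ord i)) -rcons_nseq -rcons_cat -rcons_cons -rcons_cat mul_genr eqxx mulr1.
by [].

Qed.

Definition wbounded m f : Prop := forall w, (m < wword w)%N -> f w = 0.

Lemma homog_wbounded m f : homog m f -> wbounded m f.
Proof. by move=> Hf w Hw; apply: Hf; rewrite neq_ltn Hw orbT. Qed.
Lemma wboundedM l m f h : wbounded l f -> wbounded m h -> wbounded (l + m) (f * h).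
Proof.
move=> Hf Hh w Hw; rewrite serM big_seq big1 // => p /splits_catK E.
have [Hl|/Hf->] := leqP (wword p.1) l; last by rewrite mul0r.
have [Hm|/Hh->] := leqP (wword p.2) m; last by rewrite mulr0.
by move: Hw; rewrite -E wword_cat ltnNge leq_add.
Qed.
Lemma wboundedD l m f h : wbounded l f -> wbounded m h -> wbounded (maxn l m) (f + h).
Proof. by move=> Hf Hh w; rewrite gtn_max serD => /andP[/Hf-> /Hh->]; rewrite addr0. Qed.

Section Derivation.
Variables (t : L) (d : L -> A) (B : nat).
Hypothesis d_bound : forall s w, (B < wword w)%N -> d s w = 0.
Hypothesis dt0 : d t = 0.
Hypothesis d_tr : forall b, tr0 (\sum_s d s * del s (mono b)).

(** Up to rotation, D(f) h for the derivation D with values [d]; thus [G f 1] represents the trace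
    of D(f). *)
Let G (f h : A) : A := \sum_s d s * cd s f h.

Let GM f f' h : G (f * f') h = G f (f' * h) + G f' (h * f).
Proof. by rewrite /G -big_split; apply: eq_bigr => s _; rewrite cdM mulrDr. Qed.
Let Ggen s h : G (gen K s) h = d s * h.
Proof.
rewrite /G (bigD1 s) //= cd_gen eqxx scale1r big1 ?addr0 // => x /negbTE xs.
by rewrite cd_gen xs scale0r mulr0.
Qed.
Let GX k h : G (gen K t ^+ k) h = 0.
Proof.
rewrite /G (bigD1 t) //= dt0 mul0r add0r big1 // => x /negbTE xt.
by rewrite cdX big1 ?mulr0 // => i _; rewrite cd_gen xt scale0r.
Qed.

(** Since D(t) = 0, the vanishing trace of D(s t^k x t^m), rotated, is that of the left side times
    t^m, for every m. *)
Let br2 s x k : exists h : A,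
  d s * (gen K t ^+ k * gen K x) + gen K s * (gen K t ^+ k * d x) = gen K t * h - h * gen K t.
Proof.
apply: (@trace_commutator t _ (maxn (B + (k * wt t + wt x)) (wt s + (k * wt t + B)))) => [w Hw|m].
  have Ht : wbounded (k * wt t) (gen K t ^+ k).
    exact/homog_wbounded/homogX/homog_gen.
  apply: (wboundedD (wboundedM (@d_bound s) (wboundedM Ht (homog_wbounded (@homog_gen K g n x))))
    (wboundedM (homog_wbounded (@homog_gen K g n s)) (wboundedM Ht (@d_bound x)))) Hw.
have := d_tr (s :: nseq k t ++ x :: nseq m t).
rewrite -[\sum_s _]/(G _ 1) /= mono_cat /= !mono_nseq !(GM, GX, Ggen, addr0, add0r, mulr1, mul1r) => H.
rewrite mulrDl -!mulrA; have := tr0D H (tr0_br (gen K s * gen K t ^+ k) (d x * gen K t ^+ m)).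
by rewrite -!mulrA -addrA [X in _ + X]addrC subrK.
Qed.

Let br3 s : exists h : A,
  d s * (gen K s * gen K s) + gen K s * (d s * gen K s) + gen K s * (gen K s * d s)
  = gen K t * h - h * gen K t.
Proof.
have Hs := homog_wbounded (@homog_gen K g n s).
apply: trace_commutator => [|m].
  exact: (wboundedD (wboundedD (wboundedM (@d_bound s) (wboundedM Hs Hs))
    (wboundedM Hs (wboundedM (@d_bound s) Hs))) (wboundedM Hs (wboundedM Hs (@d_bound s)))).
have := d_tr (s :: s :: s :: nseq m t).
rewrite -[\sum_s _]/(G _ 1) /= !mono_nseq !(GM, GX, Ggen, addr0, add0r, mulr1, mul1r) => H.
have := tr0D (tr0D H (tr0_br (gen K s) (d s * gen K s * gen K t ^+ m)))
             (tr0_br (gen K s * gen K s) (d s * gen K t ^+ m)).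
by rewrite !mulrDl -!mulrA addr_swap2.
Qed.

Lemma mul_powl (h : A) k u v : (size u <= k)%N ->
  (gen K t ^+ k * h) (u ++ v) = (all (pred1 t) u)%:R * (gen K t ^+ (k - size u) * h) v.
Proof.
elim: u k => [|y u IH] k /=; first by rewrite subn0 mul1r.
by case: k => // k uk; rewrite exprS -mulrA mul_genl IH // subSS mulrA -natrM mulnb.
Qed.

(** [br2] with exponent N = [size u] is tested by [br_zero_sum] on y u t^N x, where only the two
    extreme paddings contribute. Hence [d s] vanishes on t^k y u unless y = s and u is a power of
    t. *)
Let factA s x y (k : nat) u : s != t -> x != t -> y != t ->
  d s (nseq k t ++ y :: u)
  + (y == s)%:R * ((all (pred1 t) u)%:R * d x (nseq (size u) t ++ x :: nseq k t)) = 0.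
Proof.
move=> st xt yt; have [h Eh] := br2 s x (size u); pose N := size u.
have E : y :: rcons (u ++ nseq N t) x = rcons (y :: u ++ nseq N t) x by [].
have := br_zero_sum h k yt xt E.
rewrite -Eh; under eq_bigr do rewrite serD.
rewrite big_split /= big_ord_recr big1 ?add0r /= => [|i _]; last first.
  rewrite -(subnSK (ltn_ord i)) -rcons_nseq -rcons_cat -rcons_cons -rcons_cat.
  by rewrite mulrA mul_genr eq_sym (negbTE xt) mulr0.
rewrite big_ord_recl big1 ?addr0 => [|i _]; last first.
  by rewrite lift0 /= mul_genl eq_sym (negbTE st) mul0r.
rewrite subnn subn0 cats0 /= mul_genl cat_rcons -catA mul_powl // subnn expr0 mul1r => <-.
congr (_ + _); rewrite add0r -cats1 -catA -cat_cons catA.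
rewrite (mul_homr _ _ (homogM (homogX (k := N) (@homog_gen K g n t)) (@homog_gen K g n x))).
  by rewrite mul_powl ?size_nseq // subnn expr0 mul1r all_pred1_nseq genE eqxx !mulr1.
by rewrite wword_cat wword_nseq wword_cons wword_nil addn0.
Qed.

Hypothesis K2 : (2%:R : K) != 0.

Let double0 (c : K) : c + c = 0 -> c = 0.
Proof. by rewrite -mulr2n -mulr_natl => /eqP; rewrite mulf_eq0 (negbTE K2) => /eqP. Qed.

Let factB s k : s != t -> d s (nseq k t) = 0.
Proof.
move=> st; have [h] := br2 s s 0; rewrite expr0 !mul1r => Eh.
have := br_zero_sum h k st st (erefl (rcons [::] s)); rewrite -Eh.
under eq_bigr do rewrite serD.
rewrite big_split /= big_ord_recr big1 ?add0r /= => [|i _]; last first.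
  rewrite -(subnSK (ltn_ord i)) -rcons_nseq -rcons_cons -rcons_cat.
  by rewrite mul_genr eq_sym (negbTE st) mulr0.
rewrite big_ord_recl big1 ?addr0 => [|i _]; last first.
  by rewrite lift0 /= mul_genl eq_sym (negbTE st) mul0r.
rewrite subnn subn0 /= mul_genl eqxx mul1r add0r cats1 mul_genr eqxx mulr1.
exact: double0.
Qed.

(** On s u s only the middle term of [br3] survives: u begins and ends with t, so neither the prefix
    nor the suffix of the word is s s. *)
Let factC s j k : s != t -> d s (nseq j.+1 t ++ s :: nseq k.+1 t) = 0.
Proof.
move=> st; have [h Eh] := br3 s; pose u := nseq j.+1 t ++ s :: nseq k.+1 t.
have := br_zero_sum h 0 st st (erefl (rcons (s :: u) s)).
rewrite big_ord_recl big_ord0 addr0 -Eh !serD subnn cats0 -[nseq 0 t ++ _]/(s :: rcons u s).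
have -> : (d s * (gen K s * gen K s)) (s :: rcons u s) = 0.
  rewrite mulrA -rcons_cons mul_genr eqxx mulr1 /u -[nseq k.+1 t](rcons_nseq k t).
  by rewrite -rcons_cons -rcons_cat -rcons_cons mul_genr eq_sym (negbTE st) mulr0.
have -> : (gen K s * (gen K s * d s)) (s :: rcons u s) = 0.
  by rewrite mul_genl eqxx mul1r /u /= mul_genl eq_sym (negbTE st) mul0r.
by rewrite add0r addr0 mul_genl eqxx mul1r mul_genr eqxx mulr1.
Qed.

(** By the preceding relations [d s] lives on the words s t^k and t^k s, with opposite coefficients
    that do not depend on s. These are the coefficients of [s, R] for R with t^k-coefficient
    [r k]. *)
Lemma derivation_inner : exists f : A, forall s, d s = gen K s * f - f * gen K s.
Proof.
have [s0 s0t|noL] := pickP (fun s => s != t); last first.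
  exists 0 => s; rewrite mulr0 mul0r subrr.
  by have /negbFE/eqP -> := noL s.
pose r k := d s0 (s0 :: nseq k t).
pose R : A := fun w => (all (pred1 t) w)%:R * r (size w).
have anti s x k : s != t -> x != t -> d s (s :: nseq k t) = - d x (rcons (nseq k t) x).
  move=> st xt; have := factA 0 (nseq k t) st xt st.
  by rewrite eqxx all_pred1_nseq !mul1r size_nseq cats1 => /eqP; rewrite addr_eq0 => /eqP.
have rl s k : s != t -> d s (s :: nseq k t) = r k.
  by move=> st; rewrite (anti _ s0) // -(anti s0 s0).
have rr s k : s != t -> d s (rcons (nseq k t) s) = - r k.
  by move=> st; rewrite -[LHS]opprK -(anti s0 s).
exists R => s; apply: ser_ext => w; rewrite serB.
have [->|st] := eqVneq s t.
  rewrite dt0; suff -> : gen K t * R = R * gen K t by rewrite subrr.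
  apply: ser_ext => -[|y v]; first by rewrite mul_genl0 mul_genr0.
  rewrite mul_genl; case/lastP: v => [|v z]; first by rewrite -[[:: y]]/(rcons [::] y) mul_genr mulrC.
  rewrite -rcons_cons mul_genr /R [RHS]mulrAC !mulrA -!natrM !mulnb /= all_rcons size_rcons /=.
  by rewrite -andbA [all _ v && _]andbC.
have [/all_pred1P Ew|] := boolP (all (pred1 t) w).
  rewrite Ew factB //; case: (size w) => [|k] /=; first by rewrite mul_genl0 mul_genr0 subrr.
  by rewrite mul_genl eq_sym (negbTE st) mul0r -[t :: _]/(nseq k.+1 t) -rcons_nseq mul_genr eq_sym (negbTE st) mulr0 subrr.
move=> /not_all_pred1[k [y [u [yt Ew]]]]; rewrite {w}Ew.
have := factA k u st st yt.
have [/andP[/eqP-> /all_pred1P->]|ysu] := boolP ((y == s) && all (pred1 t) u); last first.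
  rewrite mulrA -natrM mulnb (negbTE ysu) mul0r addr0 => ->.
  have -> : (gen K s * R) (nseq k t ++ y :: u) = 0.
    case: k => [|k] /=; last by rewrite mul_genl eq_sym (negbTE st) mul0r.
    by rewrite mul_genl /R mulrA -natrM mulnb (negbTE ysu) mul0r.
  rewrite sub0r; case/lastP: u ysu => [|u z] ysu.
    by rewrite cats1 mul_genr; case: (y == s) ysu => //; rewrite mulr0 oppr0.
  rewrite -rcons_cons -rcons_cat mul_genr /R all_cat /= (negbTE yt) andbF.
  by rewrite !mul0r oppr0.
(* For k = 0 the words s t^k and t^k s coincide, so the coefficient equals its own negative. *)
move=> _; have r0 : r 0%N = 0 by apply: double0; rewrite -{1}(rl s 0%N st) (rr s 0%N st) addNr.
have Rn j : R (nseq j t) = r j by rewrite /R all_pred1_nseq size_nseq mul1r.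
case: k (size u) => [|k] [|j]; rewrite ?cats0 ?cats1.
- by rewrite /= (rl s 0%N st) mul_genl -[[:: s]]/(rcons [::] s) mul_genr eqxx mul1r mulr1 subrr r0.
- rewrite /= mul_genl eqxx mul1r (rl s j.+1 st) (Rn j.+1) -[t :: _]/(nseq j.+1 t).
  by rewrite -rcons_nseq -rcons_cons mul_genr eq_sym (negbTE st) mulr0 subr0.
- by rewrite (rr s k.+1 st) /= mul_genl eq_sym (negbTE st) mul0r -rcons_cons mul_genr eqxx mulr1 sub0r (Rn k.+1).
rewrite factC // /= mul_genl eq_sym (negbTE st) mul0r -[t :: nseq j t]/(nseq j.+1 t).
by rewrite -rcons_nseq -rcons_cons -rcons_cat -rcons_cons mul_genr eq_sym (negbTE st) mulr0 subrr.
Qed.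

End Derivation.

(* If the derivation D sending each letter s to d s acts by zero on A/[A,A], then D
   is inner: D(t^k) = 0 gives d t = [t, f]; replacing D by D - ad f, the relations
   D(s t^k x) = 0 and D(s s s t^k) = 0 give d s = [s, R] with R a series in t. *)
Lemma trace_zero_inner (d : L -> A) (e : nat) :
  (forall s, homog (wt s + e) (d s)) ->
  (forall b, tr0 (\sum_s d s * del s (mono b))) ->
  exists2 f : A, homog e f & forall s, d s = gen K s * f - f * gen K s.
Proof.
move=> d_homog d_tr; have K2 : (2%:R : K) != 0 by rewrite natr_neq0.
suff [f Hf] : exists f : A, forall s, d s = gen K s * f - f * gen K s.
  exists (hcomp e f) => [|s]; first exact: homog_hcomp.
  have Hs := @homog_gen K g n s.
  by rewrite -(hcomp_mull _ _ Hs) -(hcomp_mulr _ _ Hs) -hcompN -hcompD -Hf hcomp_homog.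
case: (pickP (@predT L)) => [t _|L0]; last by exists 0 => s; have := L0 s.
have Ht := @homog_gen K g n t.
have [||f Hf] := @trace_commutator t (d t) (wt t + e).
- exact/homog_wbounded.
- move=> k; have := d_tr (nseq k.+1 t); rewrite mono_nseq (bigD1 t) //= big1 ?addr0 => [|s st].
    by rewrite delX cd_gen eqxx scale1r -scalerAr => /tr0_scale; apply; rewrite natr_neq0.
  by rewrite delX cd_gen (negbTE st) scale0r scaler0 mulr0.
pose f' := hcomp e f; pose d' s := d s - (gen K s * f' - f' * gen K s).
have Hf' : homog e f' by apply: homog_hcomp.
have d'_bound s : wbounded (2 + e) (d' s).
  have Hs := @homog_gen K g n s.
  have H : homog (wt s + e) (d' s).
    apply: homogB => //; apply: homogB; first exact: homogM.
    by rewrite addnC; apply: homogM.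
  move=> w Hw; apply: H; rewrite neq_ltn; apply/orP; right; apply: leq_ltn_trans Hw.
  by rewrite leq_add2r; case: (s).
have d't : d' t = 0.
  rewrite /d' -(hcomp_mull _ _ Ht) -(hcomp_mulr _ _ Ht) -hcompN -hcompD -Hf.
  by rewrite hcomp_homog ?subrr.
have d'_tr b : tr0 (\sum_s d' s * del s (mono b)).
  under eq_bigr do rewrite mulrBl.
  by rewrite sumrB; apply: tr0B => //; apply: tr0_ad.
have [h Hh] := derivation_inner d'_bound d't d'_tr K2.
exists (f' + h) => s; have := Hh s; rewrite /d' => /eqP; rewrite subr_eq => /eqP ->.
by rewrite mulrDr mulrDl opprD [RHS]addrACA [RHS]addrC.
Qed.

End TraceZero.
End Inner.

Lemma big_delta (T : eqType) (R : pzSemiRingType) (r : seq T) (c : T) :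
  uniq r -> \sum_(p <- r) (p == c)%:R = (c \in r)%:R :> R.
Proof.
move=> Ur; have [cr|/negbTE cr] := boolP (c \in r).
  rewrite (bigD1_seq c) //= eqxx big1 ?addr0 // => p /negbTE->; exact.
rewrite big_seq big1 // => p pr; case: eqVneq => // E.
by rewrite -E pr in cr.
Qed.

(** * The necklace bracket *)

Section Necklace.
Variables (K : fieldType) (g n : nat).
Local Notation A := (ser K g n).
Local Notation W := (word g n).
Local Notation L := (letter g n).
Implicit Types (f h q z : A) (u v w : W) (s t x y a b : L) (N : nat).

Lemma sum_words_delta N (F : W -> K) w : (size w <= N)%N ->
  sum_words N (fun u => (u == w)%:R * F u) = F w.
Proof.
move=> wN; rewrite -ltnS in wN; rewrite /sum_words (bigD1 (Ordinal wN)) //= [X in _ + X]big1 ?addr0.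
  rewrite (bigD1 (in_tuple w)) //= eqxx mul1r big1 ?addr0 // => t tw.
  case: eqVneq => [E|]; last by rewrite mul0r.
  by case/eqP: tw; apply: val_inj.
move=> p pw; rewrite big1 // => t _; case: eqVneq => [E|]; last by rewrite mul0r.
by case/eqP: pw; apply: val_inj; rewrite /= -E size_tuple.
Qed.

Lemma eq_sum_words N (F G : W -> K) :
  (forall u, (size u <= N)%N -> F u = G u) -> sum_words N F = sum_words N G.
Proof.
move=> E; apply: eq_bigr => p _; apply: eq_bigr => t _; apply: E.
by rewrite size_tuple -ltnS.
Qed.

Lemma sum_wordsD N (F G : W -> K) :
  sum_words N (fun u => F u + G u) = sum_words N F + sum_words N G.
Proof. by rewrite /sum_words -big_split; apply: eq_bigr => p _; rewrite big_split. Qed.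

Lemma sum_wordsM N c (F : W -> K) : sum_words N (fun u => c * F u) = c * sum_words N F.
Proof. by rewrite /sum_words big_distrr; apply: eq_bigr => p _; rewrite big_distrr. Qed.

Lemma exchange_sum_words N (I : Type) (r : seq I) (P : pred I) (F : W -> I -> K) :
  sum_words N (fun u => \sum_(i <- r | P i) F u i)
  = \sum_(i <- r | P i) sum_words N (fun u => F u i).
Proof.
rewrite /sum_words [RHS]exchange_big; apply: eq_bigr => p _.
by rewrite exchange_big.
Qed.

Lemma exchange_sum_words2 N M (F : W -> W -> K) :
  sum_words N (fun u => sum_words M (F u)) = sum_words M (fun v => sum_words N (F ^~ v)).
Proof.
rewrite exchange_sum_words; apply: eq_bigr => p _.
by rewrite exchange_sum_words.
Qed.

Lemma sum_words0 N : sum_words N (fun _ : W => 0 : K) = 0.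
Proof. by rewrite /sum_words big1 // => p _; rewrite big1. Qed.

(* Cutting u at a letter a and closing up amounts to the cyclic derivative. *)
Lemma sum_words_cut N f (H : L -> W -> K) :
  sum_words N.+1 (fun u => f u * \sum_(p <- splits u)
    if p.2 is a :: v then H a (v ++ p.1) else 0)
  = \sum_a sum_words N (fun w => del a f w * H a w).
Proof.
(* The letters [a] of [u] at which cutting and closing up gives [w] correspond to the factorisations
   w = q1 q2 with u = q2 a q1. *)
have count a u w : \sum_(p <- splits u) (if p.2 is b :: v then ((b == a) && (v ++ p.1 == w))%:R else 0)
    = \sum_(q <- splits w) (u == q.2 ++ a :: q.1)%:R :> K.
  transitivity (\sum_(p <- splits u) \sum_(q <- splits w) (p == (q.2, a :: q.1))%:R : K).
    rewrite big_seq [RHS]big_seq; apply: eq_bigr => -[x [|b y]] _ /=.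
      by rewrite big1 // => q _; rewrite xpair_eqE andbF.
    rewrite -mulnb natrM -[y ++ x == w](mem_splits w (y, x)) -(big_delta K _ (uniq_splits w)) mulr_natl.
    case: eqVneq => [->|ba] /=; last by rewrite mulr0n big1 // => q _; rewrite xpair_eqE eqseq_cons (negbTE ba) andbF.
    by rewrite mulr1n; apply: eq_bigr => -[q1 q2] _; rewrite !xpair_eqE eqseq_cons eqxx /= andbC (eq_sym q1) (eq_sym q2).
  rewrite exchange_big; apply: eq_bigr => q _.
  by rewrite (big_delta K _ (uniq_splits u)) mem_splits eq_sym.
transitivity (sum_words N.+1 (fun u => \sum_a sum_words N (fun w =>
    \sum_(q <- splits w) (u == q.2 ++ a :: q.1)%:R * (f u * H a w)))).
  apply: eq_sum_words => u uN; rewrite big_distrr /=.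
  transitivity (\sum_(p <- splits u) \sum_a sum_words N (fun w =>
      (if p.2 is b :: v then ((b == a) && (v ++ p.1 == w))%:R else 0) * (f u * H a w))).
    rewrite big_seq [RHS]big_seq; apply: eq_bigr => -[x [|b y]] /splits_catK /= Ep.
      rewrite mulr0 big1 // => a _; rewrite -[RHS](sum_words0 N).
      by apply: eq_sum_words => w _; rewrite mul0r.
    rewrite (bigD1 b) //= eqxx big1 ?addr0 => [|a ab]; last first.
      rewrite -[RHS](sum_words0 N); apply: eq_sum_words => w _.
      by rewrite eq_sym (negbTE ab) mul0r.
    rewrite -(@sum_words_delta N (fun w => f u * H b w) (y ++ x)).
      by apply: eq_sum_words => w _; rewrite eq_sym.
    by rewrite size_cat addnC; move: uN; rewrite -Ep size_cat addnS ltnS.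
  rewrite exchange_big; apply: eq_bigr => a _; rewrite -exchange_sum_words.
  by apply: eq_sum_words => w _; rewrite -!big_distrl count.
rewrite exchange_sum_words; apply: eq_bigr => a _; rewrite exchange_sum_words2.
apply: eq_sum_words => w wN; rewrite exchange_sum_words delE big_distrl big_seq [RHS]big_seq.
apply: eq_bigr => q /splits_catK Eq /=; rewrite sum_words_delta //.
by rewrite size_cat /= addnS ltnS addnC -size_cat Eq.
Qed.

Lemma sum_words_mul N f h w : (size w <= N)%N ->
  sum_words N (fun u => sum_words N (fun v => f u * h v * (w == u ++ v)%:R)) = (f * h) w.
Proof.
move=> wN; rewrite serM.
transitivity (sum_words N (fun u => sum_words N (fun v =>
    \sum_(p <- splits w) (u == p.1)%:R * ((v == p.2)%:R * (f u * h v))))).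
  apply: eq_sum_words => u _; apply: eq_sum_words => v _.
  rewrite eq_sym -[_ == w](mem_splits w (u, v)) -(big_delta K _ (uniq_splits w)) big_distrr.
  apply: eq_bigr => -[x y] _ /=; rewrite xpair_eqE -mulnb natrM mulrC -mulrA.
  by rewrite (eq_sym x) (eq_sym y).
under eq_sum_words => u _ do rewrite exchange_sum_words.
rewrite exchange_sum_words big_seq [RHS]big_seq; apply: eq_bigr => p /splits_catK Ep.
under eq_sum_words => u _ do rewrite sum_wordsM.
rewrite sum_words_delta; last by apply: leq_trans wN; rewrite -Ep size_cat leq_addr.
by rewrite sum_words_delta //; apply: leq_trans wN; rewrite -Ep size_cat leq_addl.
Qed.

Lemma sum_words_mulz N f h t w : (size w <= N)%N ->
  (gen K t * (f * h)) w
  = sum_words N (fun u => sum_words N (fun v => f u * h v * (w == t :: u ++ v)%:R)).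
Proof.
case: w => [|c w] wN.
  rewrite mul_genl0 -[LHS](sum_words0 N); apply: eq_sum_words => u _.
  by rewrite -[LHS](sum_words0 N); apply: eq_sum_words => v _; rewrite mulr0.
rewrite mul_genl -(sum_words_mul f h (ltnW wN)) -sum_wordsM; apply: eq_sum_words => u _.
rewrite -sum_wordsM; apply: eq_sum_words => v _.
by rewrite eqseq_cons -mulnb natrM mulrCA.
Qed.

Lemma sum_words_mulz' N f h t w : (size w <= N)%N ->
  sum_words N (fun u => sum_words N (fun v => f u * h v * (w == u ++ t :: v)%:R))
  = (f * (gen K t * h)) w.
Proof.
move=> wN; rewrite -(sum_words_mul f (gen K t * h) wN); apply: eq_sum_words => u _.
have [Eu|Nu] := eqVneq (take (size u) w) u; last first.
  have E0 (y : W) : (w == u ++ y) = false.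
    by apply/eqP => E; case/eqP: Nu; rewrite E take_size_cat.
  by apply: eq_sum_words => v _; rewrite !E0 !mulr0.
have wy (y : W) : (w == u ++ y) = (y == drop (size u) w).
  by rewrite -{1}(cat_take_drop (size u) w) Eu eqseq_cat // eqxx eq_sym.
under [RHS]eq_sum_words => v _ do rewrite wy mulrC.
rewrite sum_words_delta; last by apply: leq_trans wN; rewrite size_drop leq_subr.
under eq_sum_words => v _ do rewrite wy.
have : (size (drop (size u) w) <= N)%N by apply: leq_trans wN; rewrite size_drop leq_subr.
case: (drop _ _) => [|c y] yN.
  rewrite mul_genl0 mulr0 -[RHS](sum_words0 N).
  by apply: eq_sum_words => v _; rewrite mulr0.
rewrite mul_genl -(sum_words_delta (fun v => f u * ((c == t)%:R * h v)) (ltnW yN)).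
apply: eq_sum_words => v _; rewrite eqseq_cons -mulnb natrM (eq_sym t).
by rewrite [RHS]mulrC -!mulrA; congr (_ * _); rewrite mulrCA.
Qed.

Definition dual a : L := match a with inl (i, c) => inl (i, ~~ c) | inr j => inr j end.

(* [Dham f] gives the values on letters of the derivation of A lifting [|f|, -]. *)
Definition Dham f s : A :=
  match s with
  | inl (i, c) => if c then del (dual s) f else - del (dual s) f
  | inr j => gen K s * del s f - del s f * gen K s
  end.

Definition nb_pair a b u v w : K :=
  match a, b with
  | inl (i, false), inl (i', true) => if i == i' then (w == u ++ v)%:R else 0
  | inl (i, true), inl (i', false) => if i == i' then - (w == u ++ v)%:R else 0
  | inr j, inr j' =>
      if j == j' then (w == inr j :: u ++ v)%:R - (w == u ++ inr j :: v)%:R else 0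
  | _, _ => 0
  end.

Lemma nb_wordE u v w :
  nb_word K u v w
  = \sum_(p <- splits u) if p.2 is a :: x then
      \sum_(r <- splits v) if r.2 is b :: y then nb_pair a b (x ++ p.1) (y ++ r.1) w else 0
    else 0.
Proof.
rewrite (splits_ord u (fun p1 p2 => if p2 is a :: x then
  \sum_(r <- splits v) if r.2 is b :: y then nb_pair a b (x ++ p1) (y ++ r.1) w else 0
  else 0)) big_ord_recr /= drop_size addr0; apply: eq_bigr => k _.
rewrite /nb_term; case: (drop k u) => [|a x]; first by rewrite big1.
rewrite (splits_ord v (fun r1 r2 => if r2 is b :: y then
  nb_pair a b (x ++ take k u) (y ++ r1) w else 0)) big_ord_recr /= drop_size addr0.
by apply: eq_bigr => l _; case: (drop l v).
Qed.

Lemma sum_nb_pair f h a b w :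
  sum_words (size w).+1 (fun u => sum_words (size w).+1 (fun v =>
    del a f u * del b h v * nb_pair a b u v w))
  = if a == dual b then
      match b with
      | inl (i, c) => (if c then del a f else - del a f) * del b h
      | inr j => (gen K b * del a f - del a f * gen K b) * del b h
      end w
    else 0.
Proof.
have zero (F : W -> W -> K) : (forall u v, F u v = 0) ->
    sum_words (size w).+1 (fun u => sum_words (size w).+1 (F u)) = 0.
  move=> F0; rewrite -[RHS](sum_words0 (size w).+1); apply: eq_sum_words => u _.
  by rewrite -[RHS](sum_words0 (size w).+1); apply: eq_sum_words.
have mul1 : sum_words (size w).+1 (fun u => sum_words (size w).+1 (fun v =>
    del a f u * del b h v * (w == u ++ v)%:R)) = (del a f * del b h) w.
  exact: sum_words_mul.
case: a b mul1 => [[i c]|j] [[i' c']|j'] mul1; last first.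
- rewrite /dual /nb_pair; have [Ej|jj'] := eqVneq j j'; last first.
    by rewrite zero ?ifN // => u v; rewrite mulr0.
  rewrite -Ej eqxx {mul1 j' Ej}; move: (del _ f) (del _ h) => F G.
  rewrite mulrBl -!mulrA serB (sum_words_mulz _ _ _ (leqnSn _)) -(sum_words_mulz' _ _ _ (leqnSn _)).
  under [LHS]eq_sum_words => u _.
    under eq_sum_words => v _ do rewrite mulrBr -[- (_ * _)]mulN1r.
    rewrite sum_wordsD sum_wordsM.
    over.
  by rewrite sum_wordsD sum_wordsM mulN1r.
- by rewrite zero // => u v; rewrite /nb_pair; case: (c'); rewrite mulr0.
- by rewrite zero // => u v; rewrite /nb_pair; case: (c); rewrite mulr0.
have -> : (inl (i, c) == dual (inl (i', c'))) = (i == i') && (c == ~~ c') by [].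
have [Ei|ii'] := eqVneq i i'; last first.
  by rewrite zero // => u v; rewrite /nb_pair; case: (c) (c') => [] []; rewrite ?(negbTE ii') mulr0.
rewrite -Ei {i' Ei} in mul1 *; case: c c' mul1 => [] [] mul1 /=; rewrite ?eqxx.
- by rewrite zero // => u v; rewrite mulr0.
- rewrite mulNr serN -mul1 -mulN1r -sum_wordsM; apply: eq_sum_words => u _.
  by rewrite -sum_wordsM; apply: eq_sum_words => v _; rewrite mulrN mulN1r.
- exact: mul1.
- by rewrite zero // => u v; rewrite mulr0.
Qed.

(** Each letter has exactly one partner in the double bracket, and cutting both words at such a pair
    multiplies two cyclic derivatives. Centrality thereby becomes a statement about the derivation
    [Dham f]. *)
Lemma nbrE f h : nbr f h = \sum_s Dham f s * del s h :> A.
Proof.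
apply: ser_ext => w; rewrite /nbr ser_sum.
transitivity (\sum_a \sum_b sum_words (size w).+1 (fun u => sum_words (size w).+1 (fun v =>
    del a f u * del b h v * nb_pair a b u v w))).
  pose H a C := sum_words (size w).+2 (fun v => h v * \sum_(r <- splits v)
    if r.2 is b :: y then nb_pair a b C (y ++ r.1) w else 0).
  transitivity (sum_words (size w).+2 (fun u => f u * \sum_(p <- splits u)
      if p.2 is a :: x then H a (x ++ p.1) else 0)).
    apply: eq_sum_words => u _.
    under eq_sum_words => v _ do rewrite nb_wordE -mulrA.
    rewrite sum_wordsM; congr (_ * _).
    under eq_sum_words => v _ do rewrite big_distrr.
    rewrite exchange_sum_words; apply: eq_bigr => -[x [|a y]] _ //=.
    by rewrite -[RHS](sum_words0 (size w).+2); apply: eq_sum_words => v _; rewrite mulr0.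
  rewrite sum_words_cut; apply: eq_bigr => a _; rewrite -exchange_sum_words.
  apply: eq_sum_words => u _; rewrite /H (sum_words_cut _ h (fun b v => nb_pair a b u v w)) big_distrr; apply: eq_bigr => b _ /=.
  by rewrite -sum_wordsM; apply: eq_sum_words => v _; rewrite mulrA.
rewrite exchange_big; apply: eq_bigr => b _; rewrite (bigD1 (dual b)) //= sum_nb_pair eqxx.
rewrite big1 ?addr0 => [|a /negbTE ab]; last by rewrite sum_nb_pair ab.
by case: b => [[i []]|j].
Qed.

End Necklace.

Lemma commute_sub (R : pzRingType) (x e u : R) :
  x * e - e * x = x * u - u * x -> x * (e - u) = (e - u) * x.
Proof.
move=> /eqP; rewrite subr_eq => /eqP E; rewrite mulrBr mulrBl E.
by rewrite [LHS]addrAC [X in X + _]addrAC subrr add0r addrC.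
Qed.

(** * Infinitesimal conjugations *)

Section Omega.
Variables (K : fieldType) (g n : nat).
Local Notation A := (ser K g n).
Local Notation W := (word g n).
Local Notation L := (letter g n).
Implicit Types (f h q : A) (u v w : W) (s t x y : L).

Definition lx (i : 'I_g) : L := inl (i, false).
Definition ly (i : 'I_g) : L := inl (i, true).
Definition lz (j : 'I_n) : L := inr j.
Definition om : A :=
  \sum_i (gen K (lx i) * gen K (ly i) - gen K (ly i) * gen K (lx i)) + \sum_j gen K (lz j).

Lemma ssumE (r : seq A) : ssum r = \sum_(f <- r) f :> A.
Proof. by elim: r => [|f r IH]; rewrite ?big_nil // big_cons -IH. Qed.

Lemma omegaE : @omega K g n = om.
Proof.
rewrite /omega /om -[sadd _ _]/((ssum _ : A) + (ssum _ : A)) !ssumE.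
by rewrite big_map big_enum [X in _ + X]big_map [X in _ + X]big_enum.
Qed.

Lemma sum_letters (F : L -> A) :
  \sum_s F s = \sum_i (F (lx i) + F (ly i)) + \sum_j F (lz j).
Proof.
rewrite big_sumType /=; congr (_ + _).
rewrite (eq_bigr (fun p : 'I_g * bool => (fun i c => F (inl (i, c))) p.1 p.2)); last by case.
rewrite -(pair_bigA _ (fun i c => F (inl (i, c)))) /=; apply: eq_bigr => i _.
by rewrite big_bool addrC.
Qed.

Lemma homog_om : homog 2 om.
Proof.
apply: homogD; apply: homog_sum => i _; last exact: (@homog_gen K g n (lz i)).
have Hx := @homog_gen K g n (lx i); have Hy := @homog_gen K g n (ly i).
by apply: homogB; [exact: (homogM Hx Hy) | exact: (homogM Hy Hx)].
Qed.

Lemma Lhat_om : Lhat om.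
Proof.
apply: LhatD; apply: Lhat_sum => i _; last exact: Lhat_gen.
by apply: Lhat_br; apply: Lhat_gen.
Qed.

Lemma om_z j : om [:: lz j] = 1.
Proof.
rewrite /om serD !ser_sum big1 ?add0r => [|i _].
  rewrite (bigD1 j) //= genE eqxx big1 ?addr0 // => i ij.
  by rewrite genE; case: eqVneq => // -[E]; rewrite E eqxx in ij.
by rewrite serB !mul_genl !genE !mulr0 subrr.
Qed.

Lemma eq_lxy i k : (lx i == ly k) = false.
Proof. by apply/eqP. Qed.
Lemma eq_lyx i k : (ly i == lx k) = false.
Proof. by apply/eqP. Qed.
Lemma eq_lx i k : (lx i == lx k) = (i == k).
Proof. by apply/eqP/eqP => [[]|->]. Qed.
Lemma eq_ly i k : (ly i == ly k) = (i == k).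
Proof. by apply/eqP/eqP => [[]|->]. Qed.

Lemma om_xy i : om [:: lx i; ly i] = 1.
Proof.
rewrite /om serD !ser_sum [X in _ + X]big1 ?addr0 => [|j _]; last by rewrite genE.
rewrite (bigD1 i) //= big1 ?addr0 => [|k ki]; rewrite serB !mul_genl !genE !eqseq_cons.
  by rewrite eq_lxy !eqxx mul1r mul0r subr0.
by rewrite eq_lxy eq_lx [i == k]eq_sym (negbTE ki) !mul0r subrr.
Qed.

Lemma om_yx i : om [:: ly i; lx i] = -1.
Proof.
rewrite /om serD !ser_sum [X in _ + X]big1 ?addr0 => [|j _]; last by rewrite genE.
rewrite (bigD1 i) //= big1 ?addr0 => [|k ki]; rewrite serB !mul_genl !genE !eqseq_cons.
  by rewrite eq_lyx !eqxx mul1r mul0r sub0r.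
by rewrite eq_lyx eq_ly [i == k]eq_sym (negbTE ki) !mul0r subrr.
Qed.

Lemma cd_br s a b h :
  cd s (gen K a * gen K b - gen K b * gen K a) h
  = (s == a)%:R *: (gen K b * h - h * gen K b) - (s == b)%:R *: (gen K a * h - h * gen K a).
Proof.
rewrite cdBl !cdM !cd_gen; set c := (s == a)%:R; set c' := (s == b)%:R.
by rewrite !scalerBr opprB [c' *: (_ * h) + _]addrC opprD addrACA.
Qed.

Lemma eq_lxz i j : (lx i == lz j) = false.
Proof. by apply/eqP. Qed.
Lemma eq_lyz i j : (ly i == lz j) = false.
Proof. by apply/eqP. Qed.
Lemma eq_lzx i j : (lz j == lx i) = false.
Proof. by apply/eqP. Qed.
Lemma eq_lzy i j : (lz j == ly i) = false.
Proof. by apply/eqP. Qed.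
Lemma eq_lz i j : (lz i == lz j) = (i == j).
Proof. by apply/eqP/eqP => [[]|->]. Qed.

Let scaleF (f : A) : (false%:R : K) *: f = 0.
Proof. exact: scale0r. Qed.

Let scaleFF (f f' : A) : (false%:R : K) *: f - (false%:R : K) *: f' = 0.
Proof. by rewrite !scaleF subrr. Qed.

Lemma cd_omE s h : cd s om h
  = \sum_i ((s == lx i)%:R *: (gen K (ly i) * h - h * gen K (ly i))
            - (s == ly i)%:R *: (gen K (lx i) * h - h * gen K (lx i)))
    + \sum_j (s == lz j)%:R *: h.
Proof.
rewrite /om cdDl !cd_suml; congr (_ + _); apply: eq_bigr => i _; first exact: cd_br.
exact: cd_gen.
Qed.

Lemma cd_om_x i h : cd (lx i) om h = gen K (ly i) * h - h * gen K (ly i).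
Proof.
rewrite cd_omE [X in _ + X]big1 ?addr0 => [|j _]; last by rewrite eq_lxz scaleF.
rewrite (bigD1 i) //= eq_lx eq_lxy eqxx scale1r scaleF subr0.
rewrite big1 ?addr0 // => k /negbTE ki.
by rewrite eq_lx eq_lxy (eq_sym i k) ki scaleFF.
Qed.

Lemma cd_om_y i h : cd (ly i) om h = h * gen K (lx i) - gen K (lx i) * h.
Proof.
rewrite cd_omE [X in _ + X]big1 ?addr0 => [|j _]; last by rewrite eq_lyz scaleF.
rewrite (bigD1 i) //= eq_ly eq_lyx eqxx scale1r scaleF sub0r opprB.
rewrite big1 ?addr0 // => k /negbTE ki.
by rewrite eq_ly eq_lyx (eq_sym i k) ki scaleFF.
Qed.

Lemma cd_om_z j h : cd (lz j) om h = h.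
Proof.
rewrite cd_omE big1 ?add0r => [|i _]; last by rewrite eq_lzx eq_lzy scaleFF.
rewrite (bigD1 j) //= eqxx scale1r big1 ?addr0 // => i /negbTE ij.
by rewrite eq_lz (eq_sym j i) ij scaleF.
Qed.

(** The moment map property of omega: its cyclic derivatives along x and y are commutators with y
    and -x, and along z the double bracket of z with itself supplies the commutator. *)
Lemma Dham_om k s :
  Dham (om ^+ k.+1) s = gen K s * (k.+1%:R *: om ^+ k) - (k.+1%:R *: om ^+ k) * gen K s.
Proof.
rewrite -scalerAl -scalerAr -scalerBr.
case: s => [[i []]|j]; rewrite /Dham /dual /= !delX.
- by rewrite -/(lx i) cd_om_x.
- by rewrite -/(ly i) cd_om_y -scalerN opprB.
- by rewrite -/(lz j) cd_om_z -scalerAl -scalerAr -scalerBr.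
Qed.

Lemma Dham_z k j s : Dham (gen K (lz j) ^+ k.+1) s = 0.
Proof.
case: s => [[i []]|i]; rewrite /Dham /dual /= !delX cd_gen.
- by rewrite -/(lx i) eq_lxz scaleF scaler0.
- by rewrite -/(ly i) eq_lyz scaleF scaler0 oppr0.
rewrite -/(lz i) eq_lz; case: eqVneq => [->|_]; last by rewrite scaleF scaler0 mulr0 mul0r subrr.
by rewrite scale1r -scalerAl -scalerAr -exprS -exprSr subrr.
Qed.

(** The derivation takes omega to the sum of the [s, del s c], which is zero by [del_euler]; being
    inner, it also takes omega to [omega, f]. *)
Lemma commute_om c f :
  (forall s, Dham c s = gen K s * f - f * gen K s) -> om * f = f * om.
Proof.
move=> H; apply/eqP; rewrite -subr_eq0; apply/eqP.
have E : \sum_s (gen K s * del s c - del s c * gen K s) = 0.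
  by rewrite sumrB del_euler subrr.
rewrite -{}E sum_letters /om mulrDl mulrDr opprD addrACA.
rewrite !big_distrl !big_distrr /= -!sumrB; congr (_ + _); apply: eq_bigr => i _; last first.
  by rewrite -(H (lz i)).
have Ex : del (ly i) c = f * gen K (lx i) - gen K (lx i) * f.
  by rewrite -[LHS]opprK -[- del _ _]/(Dham c (lx i)) H opprB.
rewrite Ex -[del (lx i) c]/(Dham c (ly i)) H.
move: (gen K (lx i)) (gen K (ly i)) => X Y.
rewrite !(mulrBl, mulrBr) !mulrA; apply: ser_ext => w; rewrite !(serD, serN); ring.
Qed.

Lemma homog_del e f s : homog (wt s + e) f -> homog e (del s f).
Proof.
move=> Hf w Hw; rewrite delE big_seq big1 // => p /splits_catK E; apply: Hf.
by rewrite wword_cat wword_cons addnCA eqn_add2l addnC -wword_cat E.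
Qed.

Lemma homog_Dham e f s : homog e.+2 f -> homog (wt s + e) (Dham f s).
Proof.
move=> Hf; case: s => [[i []]|j] /=.
- by apply: homog_del; rewrite /= !add1n.
- by apply/homogN/homog_del; rewrite /= !add1n.
have H : homog e (del (inr j) f) by apply: homog_del.
by apply: homogB; [exact: (homogM (@homog_gen K g n (inr j)) H)
                  | rewrite addnC; exact: (homogM H (@homog_gen K g n (inr j)))].
Qed.

Section Infinitesimal.
Hypothesis K0 : [pchar K] =i pred0.

(** Centrality in [|A|] up to constants, tested on monomials. *)
Definition central c : Prop := forall b : W, tr0 (nbr c (mono K b)).

Lemma central_inner c e : homog e.+2 c -> central c ->
  exists f : A, [/\ homog e f, om * f = f * om
                  & forall s, Dham c s = gen K s * f - f * gen K s].
Proof.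
move=> Hc Cc.
have [|b|f Hf Ef] := trace_zero_inner K0 (d := Dham c) (e := e).
- by move=> s; apply: homog_Dham.
- by rewrite -nbrE; apply: Cc.
by exists f; split=> //; apply: (commute_om Ef).
Qed.

Lemma del_pow_mul s f q k :
  (forall h, cd s f h = h) -> del s (f ^+ k * q) = powsum k f q + cd s q (f ^+ k).
Proof. by move=> cdf; rewrite delM cdX; congr (_ + _); apply: eq_bigr => i _; rewrite cdf. Qed.

(** Evaluating the inner derivation at x_i gives [x, e] as minus the cyclic derivative along y.
    Since that derivative of omega is -[x, -], the equation obtained is the one of [xy_run]. *)
Lemma solve_om_xy (i : 'I_g) q d : Lhat q -> homog d q -> (2 < d)%N ->
  (forall k, central (om ^+ k * q)) ->
  exists h : A, [/\ Lhat h, homog (d - 2) h & q = om * h - h * om].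
Proof.
move=> Lq Hq d2 Cq; have K2 : (2%:R : K) != 0 by rewrite natr_neq0.
have xy : lx i != ly i by rewrite eq_lxy.
have wx : wt (lx i) = 1%N by [].
have wy : wt (ly i) = 1%N by [].
have [k _|f Hf] := xy_run K2 homog_om wx wy xy (om_xy i) (om_yx i) Hq d2.
  have Hc : homog (k * 2 + d - 2).+2 (om ^+ k * q).
    rewrite -addn2 subnK ?(leq_trans (ltnW d2)) ?leq_addl //.
    by apply: homogM => //; apply/homogX/homog_om.
  have [e [He Ce De]] := central_inner Hc (Cq k).
  exists e => //; have := De (lx i); rewrite -[Dham _ _]/(- del (ly i) _) delM cdX.
  under eq_bigr do rewrite cd_om_y.
  rewrite sumrB -big_distrl -big_distrr -/(powsum k om q) /= => E.
  move: (cd _ _ _) (gen K (lx i)) (powsum k om q) E => T X P E.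
  have -> : T = - (X * e - e * X) - (P * X - X * P) by rewrite -E opprK addrAC subrr add0r.
  rewrite mulrBr mulrBl; apply: ser_ext => w; rewrite !(serD, serN); ring.
exact: (Lhat_solve (c := fun m : nat => q (xyrun (lx i) (ly i) m)) K0 Lhat_om Lq homog_om Hq d2 Hf).
Qed.

Lemma mul_gen_notin t f h w : t \notin w -> (f * (gen K t * h)) w = 0.
Proof.
move=> tw; rewrite serM big_seq big1 // => p /splits_catK Ep.
case Ep2 : p.2 => [|a v]; first by rewrite mul_genl0 mulr0.
rewrite mul_genl; case: eqVneq => [Ea|]; last by rewrite mul0r mulr0.
by move: tw; rewrite -Ep Ep2 mem_cat inE Ea eqxx orbT.
Qed.

Lemma pow_notin t k w : t \notin w -> (gen K t ^+ k.+1) w = 0.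
Proof. by move=> tw; rewrite exprS -[_ * _]mul1r mul_gen_notin. Qed.

Lemma del_pow_notin t s k q w : (1 < k)%N -> t \notin w ->
  (powsum k (gen K t) q + cd s q (gen K t ^+ k)) w = 0.
Proof.
case: k => [|[|k]] // _ tw; rewrite serD /powsum ser_sum big1 ?add0r => [|i _].
  rewrite /cd big_seq big1 // => p /splits_catK Ep; rewrite big_seq big1 // => r /splits_catK Er.
  rewrite pow_notin ?mulr0 //; apply: contra tw => tr.
  by rewrite -Ep -Er !mem_cat tr orbT.
case: i => [[|i] Hi] /=; last by rewrite exprS mul_gen_notin.
by rewrite subn1 /= exprS -!mulrA -[gen K t * _]mul1r mul_gen_notin.
Qed.

(** Powers of such a word v separate series in omega from series in z_j. *)
Lemma om_other_letter (j : 'I_n) :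
  (exists v : W, [/\ wword v = 2, om v = 1 & lz j \notin v]) \/ om = gen K (lz j).
Proof.
case: (pickP (@predT 'I_g)) => [i _|g0].
  by left; exists [:: lx i; ly i]; rewrite !wword_cons wword_nil om_xy.
case: (pickP (fun i : 'I_n => i != j)) => [i ij|n1].
  left; exists [:: lz i]; rewrite wword_cons wword_nil om_z inE; split=> //.
  by apply/eqP => -[E]; rewrite E eqxx in ij.
right; rewrite /om big1 ?add0r => [|i _]; last by have := g0 i.
by rewrite (bigD1 j) //= big1 ?addr0 // => i ij; have := n1 i; rewrite ij.
Qed.

(* The inner derivation D_c of c = z^k q is ad u with u a series in omega; reading
   D_c(z) = [z, u] on a word of weight 2e without z shows u = 0. *)
Lemma solve_z (j : 'I_n) q d : Lhat q -> homog d q -> (2 < d)%N ->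
  (forall k, central (gen K (lz j) ^+ k * q)) ->
  exists h : A, [/\ Lhat h, homog (d - 2) h & q = gen K (lz j) * h - h * gen K (lz j)].
Proof.
move=> Lq Hq d2 Cq; set z := lz j; have Hz : homog 2 (gen K z) := @homog_gen K g n z.
have zz : gen K z [:: z] = 1 by rewrite genE eqxx.
(* This [k] exceeds the weight of q, for [letter_run], and exceeds 1, for [del_pow_notin]; [e] takes
   into account that the bracket lowers weight by 2. *)
pose k := d.+2; pose e := (k * 2 + d - 2)%N.
have Ee : e.+2 = (k * 2 + d)%N by rewrite /e -addn2 subnK // (leq_trans (ltnW d2)) ?leq_addl.
have Hc : homog e.+2 (gen K z ^+ k * q) by rewrite Ee; apply: homogM => //; apply: homogX.
have [u [Hu Cu Du]] := central_inner Hc (Cq k).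
set E := powsum k (gen K z) q + cd z q (gen K z ^+ k).
have dE : del z (gen K z ^+ k * q) = E.
  by apply: del_pow_mul => h; rewrite cd_gen eqxx scale1r.
have HE : homog e E by rewrite -dE; apply: homog_del.
have CE : gen K z * (E - u) = (E - u) * gen K z.
  by apply: commute_sub; rewrite -dE -(Du z).
(* [E - u] is a polynomial in z and [u] one in omega. On the words [V a], which avoid z, [E]
   vanishes, so the two are compared there. *)
have EEu := centralizer_letter Hz (erefl (wt z)) zz (homogB HE Hu) CE.
have Eu := centralizer_letter homog_om (erefl (wt z)) (om_z j) Hu Cu.
have zu : gen K z * u = u * gen K z.
  have [[v [vt omv zv]]|noL] := om_other_letter j; last by rewrite -noL.
  suff -> : u = 0 by rewrite mulr0 mul0r.
  pose V a : W := flatten (nseq a v).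
  have zV a : z \notin V a by elim: a => //= a IH; rewrite mem_cat negb_or zv.
  have wV a : wword (V a) = (a * 2)%N.
    by elim: a => [|a IH]; rewrite ?wword_nil //= wword_cat IH vt mulSn.
  have omV a b : (om ^+ b) (V a) = (a == b)%:R.
    have [->|ab] := eqVneq a b.
      by rewrite -[om ^+ b]mul1r (mulX_run 1 b [::] homog_om vt omv) expr1n mul1r ser1.
    by rewrite (homogX homog_om) // wV eqn_pmul2r.
  have uV a : u (V a) = u (nseq a z).
    have [ae|ea] := leqP a e.
      rewrite {1}Eu ser_sum (bigD1 (Ordinal (ae : (a < e.+1)%N))) //= serZ omV eqxx mulr1.
      by rewrite big1 ?addr0 // => b; rewrite -val_eqE serZ omV eq_sym /= => /negbTE->; rewrite mulr0.
    have lt_e : (e < a * 2)%N by rewrite (leq_trans ea) // leq_pmulr.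
    by rewrite !Hu // ?wV ?wword_nseq neq_ltn lt_e orbT.
  rewrite Eu big1 // => -[[|a] ae] _ /=; apply/eqP; rewrite scaler_eq0; apply/orP; left; apply/eqP.
    by apply: Hu; rewrite wword_nil neq_ltn /e -addn2 /k; case: (d) d2 => [|[|d']].
  rewrite -[z :: nseq a z]/(nseq a.+1 z) -uV -[u](subKr E) serB [E _]del_pow_notin // sub0r EEu ser_sum big1 ?oppr0 // => -[[|b] be] _.
    by rewrite /= expr0 serZ ser1 -wword_eq0 wV mulr0.
  by rewrite serZ pow_notin ?mulr0.
have Hk : (d < k)%N by [].
have Hb w : (d < wword w)%N -> q w = 0 by move=> dw; apply: Hq; rewrite neq_ltn dw orbT.
have [|f Hf] := letter_run Hz (erefl (wt z)) zz Hb Hk (erefl E).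
  move=> v _; rewrite -[E](subrK u) mulrDr mulrDl CE zu subrr //.
exact: (Lhat_solve (c := fun m : nat => q (nseq m z)) K0 (Lhat_gen K z) Lq Hz Hq d2 (fun v _ => congr1 (fun h : A => h v) Hf)).
Qed.

(** In genus 0 there is no word x y to run along. With two boundary letters the derivation is read
    at one of them and the run uses the other; with a single one, omega is z_j itself. *)
Lemma solve_om q d : Lhat q -> homog d q -> (2 < d)%N ->
  (forall k, central (om ^+ k * q)) ->
  exists h : A, [/\ Lhat h, homog (d - 2) h & q = om * h - h * om].
Proof.
move=> Lq Hq d2 Cq.
case: (pickP (@predT 'I_g)) => [i _|g0]; first exact: (solve_om_xy i Lq Hq d2 Cq).
have omE : om = \sum_j gen K (lz j).
  by rewrite /om big1 ?add0r // => i; have := g0 i.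
case: (pickP (@predT 'I_n)) => [j _|n0]; last first.
  exists 0; split; [exact: Lhat_0 | exact: homog0 | rewrite mulr0 mul0r subrr].
  apply: ser_ext => -[|[[i b]|i] w]; [|by have := g0 i|by have := n0 i].
  by apply: Hq; rewrite wword_nil neq_ltn (ltnW (ltnW d2)).
case: (pickP (fun j' : 'I_n => j' != j)) => [j' j'j|n1]; last first.
  have omz : om = gen K (lz j).
    rewrite omE (bigD1 j) //= big1 ?addr0 // => i ij.
    by have := n1 i; rewrite ij.
  by rewrite omz in Cq *; apply: solve_z.
pose x := lz j; pose y := lz j'; have xy : x != y.
  by apply/eqP => -[E]; rewrite E eqxx in j'j.
have Hx : homog 2 (gen K x) := @homog_gen K g n x.
pose k := d.+2; pose e := (k * 2 + d - 2)%N.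
have Ee : e.+2 = (k * 2 + d)%N by rewrite /e -addn2 subnK // (leq_trans (ltnW d2)) ?leq_addl.
have Hc : homog e.+2 (om ^+ k * q).
  by rewrite Ee; apply: homogM => //; apply: homogX; apply: homog_om.
have [u [Hu Cu Du]] := central_inner Hc (Cq k).
have dE : del x (om ^+ k * q) = powsum k om q + cd x q (om ^+ k).
  by apply: del_pow_mul => h; apply: cd_om_z.
set E := _ + _ in dE.
have HE : homog e E by rewrite -dE; apply: homog_del.
have CE : gen K x * (E - u) = (E - u) * gen K x.
  by apply: commute_sub; rewrite -dE -(Du x).
have xx : gen K x [:: x] = 1 by rewrite genE eqxx.
have EEu := centralizer_letter Hx (erefl (wt x)) xx (homogB HE Hu) CE.
have Hk : (d < k)%N by [].
have Hb w : (d < wword w)%N -> q w = 0 by move=> dw; apply: Hq; rewrite neq_ltn dw orbT.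
(* The error [E] is [u], which commutes with omega, plus a polynomial in x. Its commutator with
   omega vanishes on words ending in y y, since omega absorbs at most one y and x differs from y. *)
have [|f Hf] := letter_run homog_om (erefl (wt y)) (om_z j') Hb Hk (erefl E).
  move=> v _; set w := v ++ _; rewrite -[E](subrK u) mulrDr [(_ + u) * om]mulrDl Cu opprD addrACA subrr addr0 EEu.
  rewrite big_distrl big_distrr -sumrB ser_sum big1 // => -[[|a] ae] _ /=.
    by rewrite -scalerAl -scalerAr expr0 mulr1 mul1r subrr.
  have E1 : (om * gen K x ^+ a.+1) w = 0.
    by rewrite /w exprSr mulrA -rcons_nseq -rcons_cat mul_genr eq_sym (negbTE xy) mulr0.
  have wy : wword [:: y] = 2 by rewrite wword_cons wword_nil.
  have E2 : (gen K x ^+ a.+1 * om) w = 0.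
    rewrite /w -rcons_nseq -cats1 catA (mul_homr _ _ homog_om wy) om_z mulr1.
    by rewrite -rcons_nseq -rcons_cat exprSr mul_genr eq_sym (negbTE xy) mulr0.
  rewrite -(scalerAr _ om) -(scalerAl _ _ om) -scalerBr serZ [X in _ * X = _]serB E1 E2 subrr mulr0 //.
exact: (Lhat_solve (c := fun m : nat => q (nseq m y)) K0 Lhat_om Lq homog_om Hq d2 (fun v _ => congr1 (fun h : A => h v) Hf)).
Qed.

End Infinitesimal.
End Omega.

Lemma triangle_sum (V : nmodType) M (G : nat -> nat -> V) :
  \sum_(k < M) \sum_(i < k.+1) G i (k - i)%N = \sum_(i < M) \sum_(j < M - i) G i j.
Proof.
elim: M => [|M IH]; first by rewrite !big_ord0.
rewrite big_ord_recr IH [RHS]big_ord_recr subSnn big_ord1 big_ord_recr /= subnn addrA -big_split /=.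
by congr (_ + _); apply: eq_bigr => i _; rewrite subSn ?big_ord_recr // ltnW.
Qed.

(** * Exponentials *)

Section Exponential.
Variables (K : fieldType) (g n : nat).
Local Notation A := (ser K g n).
Local Notation W := (word g n).
Local Notation L := (letter g n).
Implicit Types (f h l q : A) (u v w : W).

Definition eser l : A := sexp l.
Definition iser f : A := sinv f.

Lemma spowE f k : spow f k = f ^+ k.
Proof. by elim: k => //= k IH; rewrite exprS -IH. Qed.

Lemma expr_small f k w : f [::] = 0 -> (size w < k)%N -> (f ^+ k) w = 0.
Proof.
move=> f0; elim: k w => // k IH w wk; rewrite exprS serM big_seq big1 // => -[[|a x] y] /splits_catK E.
  by rewrite f0 mul0r.
by rewrite IH ?mulr0 //; move: wk; rewrite -E /= size_cat; lia.
Qed.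

Lemma eserE l N w : l [::] = 0 -> (size w < N)%N ->
  eser l w = \sum_(k < N) (l ^+ k) w / (k`!)%:R.
Proof.
move=> l0 wN; rewrite (big_ord_trunc (F := fun k => (l ^+ k) w / (k`!)%:R) wN).
  by apply: eq_bigr => k _; rewrite spowE.
by move=> a wa; rewrite expr_small ?mul0r.
Qed.

Lemma eser_nil l : eser l [::] = 1.
Proof. by rewrite /eser /sexp big_ord_recl big_ord0 addr0 /= fact0 divr1. Qed.

Lemma infil1P f : infil 1 f <-> f [::] = 0.
Proof.
split=> [H|f0 w]; first by apply: H; rewrite wword_nil.
by rewrite ltnS leqn0 wword_eq0 => /eqP->.
Qed.

Lemma infil_exprB l l' d k : infil 1 l -> infil 1 l' -> infil d (l' - l) ->
  infil (d + k) (l' ^+ k.+1 - l ^+ k.+1).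
Proof.
move=> Hl Hl' Hd; elim: k => [|k IH]; first by rewrite addn0 !expr1.
rewrite (_ : _ - _ = l' * (l' ^+ k.+1 - l ^+ k.+1) + (l' - l) * l ^+ k.+1).
  apply: infilD; first by rewrite addnS -add1n; apply: infilM.
  by apply: infilM => //; have := infilX (k := k.+1) Hl; rewrite muln1.
by rewrite mulrBr mulrBl -!exprS addrA subrK.
Qed.

(** Without constant terms, the powers from the second on differ only in filtration d + 1 or
    higher. *)
Lemma eserB l l' d : l [::] = 0 -> l' [::] = 0 -> infil d (l' - l) ->
  infil d.+1 (eser l' - eser l - (l' - l)).
Proof.
move=> l0 l'0 Hd w wd; rewrite !serB !(eserE (N := (size w).+2)) //.
rewrite -sumrB !big_ord_recl /= !expr0 !expr1 subrr add0r !divr1 big1 ?addr0 ?subrr // => k _.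
rewrite -mulrBl.
rewrite -[_ - _]/((l' ^+ k.+2 - l ^+ k.+2) w) (infil_exprB (k := k.+1) _ _ Hd) ?mul0r //.
- exact/infil1P.
- exact/infil1P.
- by apply: leq_trans wd _; rewrite addnS ltnS leq_addr.
Qed.

Lemma eser_infil l l' d : l [::] = 0 -> l' [::] = 0 -> infil d (l' - l) ->
  infil d (eser l' - eser l).
Proof.
move=> l0 l'0 Hd; rewrite -[_ - _](subrK (l' - l)).
by apply: (infilD _ Hd); apply: (infilW (leqnSn d) (eserB l0 l'0 Hd)).
Qed.

(** Group-likeness. Cutting the series at [size u + size v + 1] is exact, because l^k vanishes on
    words shorter than k. *)
Lemma coprod_eser l u v : [pchar K] =i pred0 -> Lhat l ->
  coprod (eser l) u v = eser l u * eser l v.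
Proof.
move=> K0 Hl; have l0 := Lhat_nil Hl; set N := (size u + size v).+1.
have fK k : (k`!)%:R != 0 :> K by rewrite natr_neq0 // -lt0n fact_gt0.
transitivity (\sum_(k < N) \sum_(i < k.+1)
    ((l ^+ i) u / (i`!)%:R) * ((l ^+ (k - i)) v / ((k - i)`!)%:R)).
  transitivity (\sum_(k < N) coprod (l ^+ k) u v / (k`!)%:R).
    rewrite /coprod; under [RHS]eq_bigr do rewrite big_distrl.
    rewrite exchange_big /= big_seq [RHS]big_seq; apply: eq_bigr => w /size_shuffle wE.
    by rewrite (eserE (N := N)) // wE.
  apply: eq_bigr => k _; rewrite coprodX // big_distrl; apply: eq_bigr => -[i ik] _ /=.
  rewrite ltnS in ik; rewrite -(bin_fact ik) !natrM; have := fK i; have := fK (k - i)%N.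
  have : 'C(k, i)%:R != 0 :> K by rewrite natr_neq0 // -lt0n bin_gt0.
  move: (_%:R) (_%:R) (_%:R) ((l ^+ i) u) ((l ^+ (k - i)) v) => c e e' a b c0 e0 e0'.
  by field; rewrite c0 e0 e0'.
rewrite (triangle_sum N (fun i j => ((l ^+ i) u / (i`!)%:R) * ((l ^+ j) v / (j`!)%:R))).
rewrite !(eserE (N := N)) // ?ltnS ?leq_addr ?leq_addl // big_distrl; apply: eq_bigr => -[i iN] _ /=.
rewrite -big_distrr /=; have [iu|ui] := leqP i (size u); last by rewrite expr_small // !mul0r.
congr (_ * _); apply/esym/(big_ord_trunc (F := fun j => (l ^+ j) v / (j`!)%:R)); first exact: leq_subr.
by move=> a Ha; rewrite expr_small ?mul0r //; move: iu Ha; rewrite /N => *; lia.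
Qed.

Lemma iserE f N w : f [::] = 1 -> (size w < N)%N ->
  iser f w = \sum_(k < N) ((1 - f) ^+ k) w.
Proof.
move=> f1 wN; rewrite (big_ord_trunc (F := fun k => ((1 - f) ^+ k) w) wN).
  by apply: eq_bigr => k _; rewrite spowE.
by move=> a wa; rewrite expr_small // serB f1 ser1 subrr.
Qed.

Lemma iser_trunc f w : f [::] = 1 ->
  exists s : A, [/\ (iser f * f) w = (s * f) w, (f * iser f) w = (f * s) w,
    (s * f) w = (1 : A) w & (f * s) w = (1 : A) w].
Proof.
move=> f1; pose N := (size w).+1; pose s : A := \sum_(k < N) (1 - f) ^+ k.
have Es v : (size v < N)%N -> iser f v = s v by move=> vN; rewrite /s ser_sum (iserE f1 vN).
have Hs : s * (1 - f) = (1 - f) * s.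
  by rewrite big_distrl big_distrr; apply: eq_bigr => k _; rewrite /= -exprS -exprSr.
have Ef : f = 1 - (1 - f) by rewrite subKr.
have Efs : f * s = 1 - (1 - f) ^+ N.
  by rewrite -[RHS]opprB subrX1 -mulNr opprB subKr.
exists s; split.
- rewrite !serM big_seq [RHS]big_seq; apply: eq_bigr => p /splits_catK E; rewrite Es //.
  by rewrite ltnS -E size_cat leq_addr.
- rewrite !serM big_seq [RHS]big_seq; apply: eq_bigr => p /splits_catK E; rewrite Es //.
  by rewrite ltnS -E size_cat leq_addl.
- have -> : s * f = f * s by rewrite [in LHS]Ef [in RHS]Ef mulrBl mulrBr Hs mulr1 mul1r.
  by rewrite Efs serB expr_small ?subr0 // serB f1 ser1 subrr.
by rewrite Efs serB expr_small ?subr0 // serB f1 ser1 subrr.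
Qed.

Lemma iserK f : f [::] = 1 -> iser f * f = 1.
Proof. by move=> f1; apply: ser_ext => w; have [s [-> _ -> _]] := iser_trunc w f1. Qed.
Lemma mul_iser f : f [::] = 1 -> f * iser f = 1.
Proof. by move=> f1; apply: ser_ext => w; have [s [_ -> _ ->]] := iser_trunc w f1. Qed.
Lemma iser_nil f : f [::] = 1 -> iser f [::] = 1.
Proof. by move=> f1; rewrite (iserE (N := 1) f1) // big_ord1 expr0 ser1. Qed.

Lemma infil_limit (Inv : nat -> A -> Prop) :
  (exists l, Inv 0%N l) ->
  (forall m l, Inv m l -> exists2 l', Inv m.+1 l' & infil m.+1 (l' - l)) ->
  exists l', forall m, exists2 l, Inv m l & infil m.+1 (l' - l).
Proof.
move=> [l0 H0] Hstep.
pose step m (x : {l | Inv m l}) := cid2 (Hstep m (sval x) (svalP x)).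
pose x m : {l | Inv m l} := nat_rect (fun m => {l | Inv m l}) (exist _ l0 H0)
  (fun m y => exist _ (s2val (step m y)) (s2valP (step m y))) m.
have xS m : infil m.+1 (sval (x m.+1) - sval (x m)).
  exact: (s2valP' (step m (x m))).
have xD m e : infil m.+1 (sval (x (m + e)%N) - sval (x m)).
  elim: e => [|e IH]; first by rewrite addn0 subrr.
  rewrite addnS -[_ - _](subrKA (sval (x (m + e)%N))); apply: (infilD _ IH).
  by apply: (infilW _ (xS _)); rewrite ltnS leq_addr.
(* The coefficient at [w] is taken from the approximation of index [wword w], from which on it is
   stable. *)
exists (fun w => sval (x (wword w)) w) => m; exists (sval (x m)); first exact: svalP.
move=> w; rewrite ltnS => /subnKC E; rewrite serB -E.
by have := xD (wword w) (m - wword w)%N w (leqnn _); rewrite serB => /eqP; rewrite subr_eq0 => /eqP->; rewrite subrr.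
Qed.

Lemma Lhat_limit f : (forall m, exists2 l : A, Lhat l & infil m.+1 (f - l)) -> Lhat f.
Proof.
move=> H u v; have [l Hl fl] := H (wword u + wword v)%N.
have E w : (wword w <= wword u + wword v)%N -> f w = l w.
  by move=> Hw; apply/eqP; rewrite -subr_eq0 -serB fl.
rewrite (E u) ?leq_addr // (E v) ?leq_addl // -Hl /coprod big_seq [RHS]big_seq.
by apply: eq_bigr => w /wword_shuffle Ew; apply: E; rewrite Ew.
Qed.

End Exponential.

(** * Substitutions *)

Section Substitution.
Variables (K : fieldType) (g n : nat).
Local Notation A := (ser K g n).
Local Notation W := (word g n).
Local Notation L := (letter g n).
Variable phi : L -> A.
Hypothesis phi_nil : forall s, phi s [::] = 0.
Implicit Types (f h l q : A) (u v w : W) (s : L).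

Definition mprod u : A := foldr (fun s f => phi s * f) 1 u.
Definition sbst f : A := subst phi f.

Lemma mprod_cat u v : mprod (u ++ v) = mprod u * mprod v.
Proof. by elim: u => [|a u IH] /=; rewrite ?mul1r // IH mulrA. Qed.

Lemma mprod_small u w : (size w < size u)%N -> mprod u w = 0.
Proof.
elim: u w => //= a u IH w wk; rewrite serM big_seq big1 // => -[[|b x] y] /splits_catK E.
  by rewrite phi_nil mul0r.
by rewrite IH ?mulr0 //; move: wk; rewrite -E /= size_cat; lia.
Qed.

Lemma sbstE f N w : (size w <= N)%N -> sbst f w = sum_words N (fun u => f u * mprod u w).
Proof.
move=> wN; rewrite /sum_words; rewrite -ltnS in wN.
rewrite (big_ord_trunc (F := fun p => \sum_(t : p.-tuple L) f (tval t) * mprod (tval t) w) wN).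
  apply: eq_bigr => p _; apply: eq_bigr => t _; congr (_ * _ w).
  by rewrite /mprod foldr_map.
move=> p wp; rewrite big1 // => t _; rewrite mprod_small ?mulr0 //.
by rewrite size_tuple.
Qed.

Lemma sbstD f h : sbst (f + h) = sbst f + sbst h.
Proof.
apply: ser_ext => w; rewrite serD !(sbstE _ (N := size w)) // -sum_wordsD.
by apply: eq_sum_words => u _; rewrite serD mulrDl.
Qed.
Lemma sbstZ c f : sbst (c *: f) = c *: sbst f.
Proof.
apply: ser_ext => w; rewrite serZ !(sbstE _ (N := size w)) // -sum_wordsM.
by apply: eq_sum_words => u _; rewrite serZ mulrA.
Qed.
Lemma sbst0 : sbst 0 = 0.
Proof. by rewrite -[X in sbst X](scale0r (0 : A)) sbstZ scale0r. Qed.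
Lemma sbstB f h : sbst (f - h) = sbst f - sbst h.
Proof. by rewrite sbstD -scaleN1r sbstZ scaleN1r. Qed.
Lemma sbst_sum (I : Type) (r : seq I) (P : pred I) (F : I -> A) :
  sbst (\sum_(i <- r | P i) F i) = \sum_(i <- r | P i) sbst (F i).
Proof. exact: (big_morph sbst sbstD sbst0). Qed.

Lemma sbst_mono u : sbst (mono K u) = mprod u.
Proof.
apply: ser_ext => w; rewrite (sbstE _ (N := size w + size u)) ?leq_addr //.
under eq_sum_words => v _ do rewrite monoE.
by rewrite sum_words_delta // leq_addl.
Qed.

Lemma sbst_gen s : sbst (gen K s) = phi s.
Proof. by have := sbst_mono [:: s]; rewrite /= !mulr1. Qed.
Lemma sbst1 : sbst 1 = 1.
Proof. exact: (sbst_mono [::]). Qed.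

Lemma sbstM f h : sbst (f * h) = sbst f * sbst h.
Proof.
apply: ser_ext => w; pose N := size w.
transitivity (sum_words N (fun v1 => sum_words N (fun v2 => f v1 * h v2 * mprod (v1 ++ v2) w))).
  rewrite (sbstE _ (N := N + N)) ?leq_addr //.
  transitivity (sum_words (N + N) (fun u => sum_words N (fun v1 => sum_words N (fun v2 =>
      (u == v1 ++ v2)%:R * (f v1 * h v2 * mprod u w))))).
    apply: eq_sum_words => u _; have [uN|Nu] := leqP (size u) N; last first.
      rewrite mprod_small // mulr0 -[LHS](sum_words0 K g n N); apply: eq_sum_words => v1 _.
      by rewrite -[LHS](sum_words0 K g n N); apply: eq_sum_words => v2 _; rewrite !mulr0.
    rewrite -(sum_words_mul f h uN) mulrC -sum_wordsM; apply: eq_sum_words => v1 _.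
    by rewrite -sum_wordsM; apply: eq_sum_words => v2 _; rewrite [LHS]mulrC [LHS]mulrAC [LHS]mulrC.
  rewrite exchange_sum_words2; apply: eq_sum_words => v1 v1N.
  rewrite exchange_sum_words2; apply: eq_sum_words => v2 v2N.
  by rewrite (sum_words_delta (fun u => f v1 * h v2 * mprod u w)) // size_cat leq_add.
rewrite serM; under eq_sum_words => v1 _ do under eq_sum_words => v2 _ do
  rewrite mprod_cat serM big_distrr.
under eq_sum_words => v1 _ do rewrite exchange_sum_words.
rewrite exchange_sum_words big_seq [RHS]big_seq; apply: eq_bigr => p /splits_catK E.
have [p1 p2] : (size p.1 <= N)%N /\ (size p.2 <= N)%N.
  by rewrite /N -E size_cat leq_addr leq_addl.
rewrite (sbstE f p1) (sbstE h p2) mulrC -sum_wordsM; apply: eq_sum_words => v1 _.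
rewrite mulrC -sum_wordsM; apply: eq_sum_words => v2 _.
by rewrite /= mulrACA.
Qed.

Lemma sbstX f k : sbst (f ^+ k) = sbst f ^+ k.
Proof. by elim: k => [|k IH]; rewrite ?expr0 ?sbst1 // !exprS sbstM IH. Qed.

(** Letters are replaced one at a time, and each replacement gains one degree. *)
Lemma sbst_mono_infil u :
  (forall s, infil (wt s).+1 (phi s - gen K s)) ->
  infil (wword u).+1 (sbst (mono K u) - mono K u).
Proof.
move=> H; rewrite sbst_mono.
have phi_wt s : infil (wt s) (phi s).
  rewrite -[phi s](subrK (gen K s)); apply: infilD (infil_homog (@homog_gen K g n s)).
  exact: infilW (leqnSn _) (H s).
have mprod_wt v : infil (wword v) (mprod v).
  elim: v => [|b v IHv]; first by rewrite wword_nil; apply: infil0.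
  by rewrite wword_cons; apply: infilM.
elim: u => [|a u IH] /=; first by rewrite subrr.
rewrite wword_cons -[_ - _](subrKA (gen K a * mprod u)) -mulrBl -mulrBr.
apply: infilD; last first.
  by rewrite -addnS; apply: infilM IH; apply: infil_homog; apply: homog_gen.
by rewrite -addSn; apply: infilM.
Qed.

(** By [ad_del] the argument is a sum of commutators in A, and these are preserved by an algebra
    morphism. *)
Lemma tr0_sbst_ad f h : tr0 (sbst (\sum_s (gen K s * f - f * gen K s) * del s h)).
Proof.
rewrite ad_del sbst_sum; apply: tr0_sum => s _.
by rewrite sbstB !sbstM; apply: tr0_br.
Qed.

End Substitution.

(** * Cyclic classes, filtration and the degree of the bracket *)

Section Trace.
Variables (K : fieldType) (g n : nat).
Local Notation A := (ser K g n).
Local Notation L := (letter g n).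
Implicit Types (f h x : A) (u v : word g n) (s : L).

Lemma wword_cut u v s : wword (v ++ s :: u) = (wt s + wword (u ++ v))%N.
Proof. by rewrite !wword_cat wword_cons addnCA [(_ v + _)%N]addnC. Qed.

Lemma infil_del m f s : infil (wt s + m) f -> infil m (del s f).
Proof.
move=> Hf w wm; rewrite delE big_seq big1 // => p /splits_catK E; apply: Hf.
by rewrite wword_cut E ltn_add2l.
Qed.

(** [del s] kills commutators and lowers the filtration by [wt s] only, so it also vanishes on the
    closure. *)
Lemma cyc_eq_tr0 f h : cyc_eq f h -> tr0 (f - h).
Proof.
move=> H s; apply: infil_eq => k; rewrite subr0; have [r Hr] := H (wt s + k)%N.
pose X : A := ssum [seq sbr p.1 p.2 | p <- r]; have HX : infil (wt s + k) (f - h - X) := Hr.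
have X0 : tr0 X.
  by rewrite /X ssumE big_map; apply: tr0_sum => p _; apply: (@tr0_br K g n p.1 p.2).
by rewrite -[f - h](subrK X) /del cdDl -/(del s X) X0 addr0; apply: infil_del.
Qed.

Lemma tr0_lowest d f h : homog d f -> infil d.+1 h -> tr0 (f + h) -> tr0 f.
Proof.
move=> Hf Hh H s; apply: ser_ext => w.
have [E|E] := eqVneq (wword w + wt s)%N d; last first.
  rewrite delE big_seq big1 // => p /splits_catK Ew; apply: Hf.
  by rewrite wword_cut Ew addnC.
rewrite -[del s f](addrK (del s h)) -[del s f + _]cdDl -/(del s _) H sub0r serN.
rewrite (infil_del (m := (wword w).+1)) ?oppr0 //.
by apply: infilW Hh; rewrite -E; lia.
Qed.

Lemma DhamD f h s : Dham (f + h) s = Dham f s + Dham h s.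
Proof.
case: s => [[i []]|j]; rewrite /Dham /del !cdDl ?opprD //.
by rewrite mulrDr mulrDl opprD addrACA.
Qed.
Lemma DhamZ c f s : Dham (c *: f) s = c *: Dham f s.
Proof.
case: s => [[i []]|j]; rewrite /Dham /del !cdZl ?scalerN //.
by rewrite -scalerAl -scalerAr scalerBr.
Qed.
Lemma eq_Dham f h s : (forall t, del t f = del t h) -> Dham f s = Dham h s.
Proof. by move=> E; case: s => [[i c]|j]; rewrite /Dham !E. Qed.

Definition nb f h : A := nbr f h.

Lemma nbDl f f' h : nb (f + f') h = nb f h + nb f' h.
Proof.
rewrite /nb !nbrE -big_split; apply: eq_bigr => s _.
by rewrite DhamD mulrDl.
Qed.
Lemma nbZl c f h : nb (c *: f) h = c *: nb f h.
Proof. by rewrite /nb !nbrE scaler_sumr; apply: eq_bigr => s _; rewrite DhamZ scalerAl. Qed.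
Lemma nbDr f h h' : nb f (h + h') = nb f h + nb f h'.
Proof.
rewrite /nb !nbrE -big_split; apply: eq_bigr => s _.
by rewrite /del cdDl mulrDr.
Qed.
Lemma eq_nb f f' h : (forall t, del t f = del t f') -> nb f h = nb f' h.
Proof. by move=> E; rewrite /nb !nbrE; apply: eq_bigr => s _; rewrite (eq_Dham s E). Qed.

(** The bracket has degree -2: [Dham f s] gains [wt s - 2] and [del s h] loses [wt s]. *)
Lemma infil_nb a b m f h : infil a f -> infil b h -> (m.+2 <= a + b)%N -> infil m (nb f h).
Proof.
move=> Hf Hh Hm; have D c e s (x : A) : infil c x -> (wt s + e <= c)%N -> infil e (del s x).
  by move=> Hx He; apply: infil_del; apply: infilW Hx.
have D0 c s (x : A) : infil c x -> infil (c - wt s) (del s x).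
  move=> Hx; have [H|H] := leqP (wt s) c; first by apply: (D c _ _ _ Hx); lia.
  by rewrite (eqP (ltnW H : c - wt s == 0)%N); apply: infil0.
rewrite /nb nbrE; apply: infil_sum => s _.
have Hh' := D0 b s h Hh.
suff Hf' : infil (a + wt s - 2) (Dham f s).
  by apply: infilW (infilM Hf' Hh'); case: (s) => [?|?] /=; lia.
case: s {Hh'} => [[i c]|j] /=.
  have -> : (a + 1 - 2 = a - wt (dual (inl (i, c)) : L))%N by rewrite /=; lia.
  by case: c; [|apply: infilN]; apply: D0.
have Hj := D0 a (inr j) f Hf; have Hg := infil_homog (@homog_gen K g n (inr j)).
apply: infilB; first by apply: infilW (infilM Hg Hj); rewrite /=; lia.
by apply: infilW (infilM Hj Hg); rewrite /=; lia.
Qed.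

Lemma homog_nb a b f h : homog a.+2 f -> homog b h -> homog (a + b) (nb f h).
Proof.
move=> Hf Hh; rewrite /nb nbrE; apply: homog_sum => s _.
have [sb|bs] := leqP (wt s) b.
  have Hd : homog (b - wt s) (del s h) by apply: homog_del; rewrite subnKC.
  have -> : (a + b = wt s + a + (b - wt s))%N by lia.
  by apply: homogM Hd; apply: homog_Dham.
suff -> : del s h = 0 by rewrite mulr0.
apply: ser_ext => w; rewrite delE big1 // => p _; apply: Hh.
by rewrite wword_cat wword_cons; lia.
Qed.

End Trace.

(** * Conjugation by successive approximation *)

Section Conjugation.
Variables (K : fieldType) (g n : nat).
Local Notation A := (ser K g n).
Local Notation W := (word g n).
Local Notation L := (letter g n).
Implicit Types (f h l q r v : A) (b u w : W) (s : L).

(** The linear term starts in weight 2(k-1) + d, one below this bound. Replacing a further z by q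
    gains d - 2 > 0, and replacing a z by r gains at least d - 1. *)
Lemma pow_expand z q r d k : homog 2 z -> infil d q -> (2 < d)%N -> infil d.+1 r ->
  infil (k * 2 + d).-1 ((z + q + r) ^+ k - z ^+ k - powsum k z q).
Proof.
move=> Hz Hq d2 Hr; set Q := z + q + r.
have HQ : infil 3 (Q - z).
  rewrite (_ : Q - z = q + r); last by rewrite /Q addrAC [z + q]addrC addrK.
  apply: infilD; first exact: infilW Hq.
  by apply: infilW Hr; lia.
have Hz2 := infil_homog Hz.
have HQ2 : infil 2 Q by rewrite -(subrK z Q); apply: infilD Hz2; apply: infilW HQ.
have HQk j : infil (j * 2).+1 (Q ^+ j - z ^+ j).
  elim: j => [|j IH]; first by rewrite subrr.
  rewrite !exprS (_ : _ - _ = (Q - z) * Q ^+ j + z * (Q ^+ j - z ^+ j)); last first.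
    by rewrite mulrBl mulrBr addrA subrK.
  apply: infilD; first by apply: (infilW _ (infilM HQ (infilX (k := j) HQ2))); lia.
  by apply: (infilW _ (infilM Hz2 IH)); lia.
elim: k => [|k IH]; first by rewrite !expr0 /powsum big_ord0 subrr subr0.
have -> : Q ^+ k.+1 - z ^+ k.+1 - powsum k.+1 z q
    = z * (Q ^+ k - z ^+ k - powsum k z q) + r * Q ^+ k + q * (Q ^+ k - z ^+ k).
  rewrite powsumS !exprS {1}/Q !mulrDl; move: (Q ^+ k) (z ^+ k) (powsum k z q) => X Y T.
  rewrite !mulrBr; apply: ser_ext => w; rewrite !(serD, serN); ring.
apply: infilD; first apply: infilD.
- by apply: (infilW _ (infilM Hz2 IH)); lia.
- by apply: (infilW _ (infilM Hr (infilX (k := k) HQ2))); lia.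
by apply: (infilW _ (infilM Hq (HQk k))); lia.
Qed.

(** All summands are rotations of z^k q. *)
Lemma del_powsum z q k s : del s (powsum k.+1 z q) = k.+1%:R *: del s (z ^+ k * q).
Proof.
rewrite /powsum /del cd_suml (eq_bigr (fun=> del s (z ^+ k * q))) => [|i _].
  by rewrite sumr_const card_ord scaler_nat.
by rewrite -[LHS]/(del s _) delC mulrA -exprD subSS subnKC // -ltnS; case: (i).
Qed.

Lemma conj_pow f h (p : A) k : h * f = 1 -> (f * p * h) ^+ k.+1 = f * p ^+ k.+1 * h.
Proof.
move=> hf; elim: k => [|k IH]; first by rewrite !expr1.
by rewrite exprS IH [p ^+ k.+2]exprS !mulrA -[_ * h * f]mulrA hf mulr1.
Qed.

Hypothesis K0 : [pchar K] =i pred0.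
Variables z P : A.
Hypotheses (Lz : Lhat z) (Hz : homog 2 z) (LP : Lhat P) (HP : infil 3 (P - z)).
Hypothesis z_inner : forall k, exists v, forall s,
  Dham (z ^+ k.+1) s = gen K s * v - v * gen K s.
Hypothesis z_solve : forall q d, Lhat q -> homog d q -> (2 < d)%N ->
  (forall k, central (z ^+ k * q)) ->
  exists v : A, [/\ Lhat v, homog (d - 2) v & q = z * v - v * z].
(** Centrality of P^(k+1), tested on series [B] with prescribed leading monomials; the comparison of
    lowest weights only sees the latter. *)
Hypothesis P_bracket : forall k b, exists2 B : A,
  infil (wword b).+1 (B - mono K b) & tr0 (nb (P ^+ k.+1) B).

(** This is (e^l P e^(-l) - z) e^l. It has the same lowest component as e^l P e^(-l) - z, and its
    coproduct and its change with l need no inverse. *)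
Definition defect l : A := eser l * P - z * eser l.

(** The coproduct of the defect R is R (x) e^l + e^l (x) R. At nonempty u and v of total weight d, R
    is evaluated on a word of weight below d and vanishes. *)
Lemma Lhat_defect l d : Lhat l -> infil d (defect l) -> Lhat (hcomp d (defect l)).
Proof.
move=> Ll HR; set f := eser l; set R := defect l in HR *.
have f_gl u w : coprod f u w = f u * f w by apply: coprod_eser.
have sf u : shmul u f = f u *: f by apply: ser_ext => w; rewrite shmulE f_gl.
have RE u w : coprod R u w = f w * R u + f u * R w.
  rewrite /R /defect -/f coprodDl coprodNl (coprod_Lhatl f u w Lz) (coprod_Lhatr f u w LP) !sf.
  rewrite -!scalerAl -!scalerAr !serZ !serB !mulrBr opprD addrACA //.
apply/LhatP; split=> [|u w u0 w0].
  rewrite /hcomp; case: eqVneq => // _.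
  rewrite -/R /R /defect serB !serM !splits_nil (Lhat_nil Lz) (Lhat_nil LP).
  by rewrite mulr0 mul0r subrr.
rewrite /coprod big_seq (eq_bigr (fun x => if (wword u + wword w == d)%N then R x else 0)); last first.
  by move=> x /wword_shuffle E; rewrite /hcomp E.
case: eqVneq => [E|_]; last by rewrite big1.
rewrite -big_seq -[LHS]/(coprod R u w) RE !HR ?mulr0 ?addr0 // -E.
  by rewrite -[X in (X < _)%N]add0n ltn_add2r lt0n wword_eq0.
by rewrite -[X in (X < _)%N]addn0 ltn_add2l lt0n wword_eq0.
Qed.

(** Conjugating by e^l does not change the class of P^(k+1), and z^(k+1) acts by an inner
    derivation. In what remains of the bracket, (k+1) z^k q against the leading monomial has the
    lowest weight. *)
Lemma central_defect l d k : Lhat l -> (2 < d)%N -> infil d (defect l) ->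
  central (z ^+ k * hcomp d (defect l)).
Proof.
move=> Ll d2 HR b; set f := eser l; set R := defect l in HR *; set q := hcomp d R.
have f1 : f [::] = 1 by exact: eser_nil.
set h := iser f; have hf : h * f = 1 := iserK f1; have fh : f * h = 1 := mul_iser f1.
have Hq : infil d q := infil_homog (@homog_hcomp K g n d R).
pose r := R * h - q.
have Hr : infil d.+1 r.
  have split_r (x y t : A) : x * t - y = (x - y) * t + y * (t - 1).
    by rewrite mulrBl mulrBr mulr1 addrA subrK.
  rewrite /r split_r.
  apply: infilD; first by apply: infilMl; apply: infil_hcomp.
  rewrite -[d.+1]addn1; apply: infilM => //; apply/infil1P.
  by rewrite serB ser1 /h iser_nil // subrr.
have EQ : f * P * h = z + q + r.
  by rewrite /r -addrA [q + _]addrC subrK /R /defect mulrBl -(mulrA z) fh mulr1 addrC subrK.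
have [B HB TB] := P_bracket k b; have [v Ev] := z_inner k.
pose Y := (z + q + r) ^+ k.+1 - z ^+ k.+1 - powsum k.+1 z q.
have HY : infil (k.+1 * 2 + d).-1 Y by apply: pow_expand.
have Edel s : del s (P ^+ k.+1) = del s (z ^+ k.+1 + k.+1%:R *: (z ^+ k * q) + Y).
  have -> : del s (P ^+ k.+1) = del s (z ^+ k.+1 + powsum k.+1 z q + Y).
    rewrite -[P ^+ _]mul1r -hf -mulrA delC -conj_pow // EQ; congr del.
    by rewrite /Y -[_ - _ - powsum _ _ _]addrA -opprD [RHS]addrC subrK.
  by rewrite /del !cdDl cdZl -!/(del s _) del_powsum.
clearbody Y; move: TB; rewrite (eq_nb B Edel) !nbDl nbZl => TB.
have T1 : tr0 (nb (z ^+ k.+1) B).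
  rewrite /nb nbrE; under eq_bigr do rewrite Ev.
  exact: tr0_ad.
have Hzq : homog (k * 2 + d - 2).+2 (z ^+ k * q).
  rewrite (_ : _.+2 = (k * 2 + d)%N); last by lia.
  by apply: homogM; [apply: homogX | apply: homog_hcomp].
have Hmono : homog (wword b) (mono K b).
  by move=> w wb; rewrite monoE; case: eqVneq => // E; rewrite E eqxx in wb.
suff : tr0 (k.+1%:R *: nb (z ^+ k * q) (mono K b)).
  by apply: tr0_scale => //; rewrite natr_neq0.
apply: (tr0_lowest (d := (k * 2 + d - 2 + wword b)%N)
  (h := k.+1%:R *: nb (z ^+ k * q) (B - mono K b) + nb Y B)).
- by apply: homogZ; apply: homog_nb.
- apply: infilD.
    by apply/infilZ/(infil_nb (infil_homog Hzq) HB); lia.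
  have HB' : infil (wword b) B.
    rewrite -(subrK (mono K b) B); apply: infilD (infil_homog Hmono).
    exact: infilW HB.
  by apply: (infil_nb HY HB'); lia.
rewrite addrA -scalerDr -nbDr [mono K b + _]addrC subrK.
have dropl (x y t : A) : x + y + t - x = y + t by rewrite addrAC [x + y]addrC addrK.
by have := tr0B TB T1; rewrite dropl.
Qed.

Lemma defect_step l d : Lhat l -> (2 < d)%N -> infil d (defect l) ->
  exists2 l' : A, Lhat l' /\ infil d.+1 (defect l') & infil (d - 2) (l' - l).
Proof.
move=> Ll d2 HR; set R := defect l in HR *; pose q := hcomp d R.
have [|//|k|v [Lv Hv Eq]] := @z_solve q d _ (@homog_hcomp K g n d R).
- exact: Lhat_defect.
- exact: central_defect.
have Iv := infil_homog Hv.
exists (l + v); last by rewrite addrAC subrr add0r.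
split; first exact: LhatD.
have l0 := Lhat_nil Ll; have l'0 := Lhat_nil (LhatD Ll Lv).
have lv : l + v - l = v by rewrite addrAC subrr add0r.
pose r := eser (l + v) - eser l - v.
have Hr : infil (d - 2).+1 r by rewrite /r -[X in _ - X]lv; apply: eserB; rewrite // lv.
have E : eser (l + v) = eser l + v + r.
  by rewrite /r -[_ - _ - v]addrA -opprD [RHS]addrC subrK.
(* From v P - z v = v (P - z) - [z, v] with [z, v] = q, the correction cancels the lowest component;
   the other terms lie in filtration d + 1. *)
have -> : defect (l + v) = (R - q) + v * (P - z) + (r * P - z * r).
  rewrite {1}Eq /R /defect E; move: (eser l) => f.
  rewrite !(mulrBr, mulrDr, mulrDl); apply: ser_ext => w; rewrite !(serD, serN); ring.
apply: infilD; first apply: infilD; first exact: infil_hcomp.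
  by apply: (infilW _ (infilM Iv HP)); lia.
have HP2 : infil 2 P.
  by rewrite -(subrK z P); apply: infilD (infil_homog Hz); apply: infilW HP.
apply: infilB; first by apply: (infilW _ (infilM Hr HP2)); lia.
by apply: (infilW _ (infilM (infil_homog Hz) Hr)); lia.
Qed.

Theorem conjugate_by_exp : exists2 l : A, Lhat l & eser l * P = z * eser l.
Proof.
(* The start l = 0 has defect P - z in filtration 3, and a defect in filtration m + 3 is corrected
   in weight m + 1, as [infil_limit] demands. *)
have [||l Hl] := @infil_limit K g n (fun m l => Lhat l /\ infil m.+3 (defect l)).
- exists 0; split; first exact: Lhat_0.
  rewrite /defect (_ : eser 0 = 1) ?mulr1 ?mul1r //.
  apply: ser_ext => w; rewrite (eserE (N := (size w).+1)) // big_ord_recl /= divr1.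
  by rewrite expr0 big1 ?addr0 // => i _; rewrite /= exprS mul0r ser0 mul0r.
- move=> m l [Ll Hl]; have [|l' Hl' Hd] := defect_step Ll _ Hl; first by [].
  by exists l'.
have Ll : Lhat l by apply: Lhat_limit => m; have [l' [? _] ?] := Hl m; exists l'.
exists l => //; apply: infil_eq => m.
have [l' [Ll' Hl'] Hd] := Hl m; set R := (X in infil _ X).
have -> : R = defect l' + ((eser l - eser l') * P - z * (eser l - eser l')).
  rewrite /R /defect; move: (eser l) (eser l') => f f'.
  rewrite !(mulrBr, mulrBl); apply: ser_ext => w; rewrite !(serD, serN); ring.
apply: infilD; first by apply: infilW Hl'; lia.
have He : infil m (eser l - eser l').
  by apply: (infilW (leqnSn m)); apply: eser_infil Hd; apply: Lhat_nil.
by apply: infilB; [apply: infilMl | apply: infilMr].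
Qed.

End Conjugation.

(** * Application to the automorphism F *)

Section Tangential.
Variables (K : fieldType) (g n : nat).
Local Notation A := (ser K g n).
Implicit Types (f h q v z : A) (s : letter g n) (b : word g n).
Hypothesis K0 : [pchar K] =i pred0.
Variable F : A -> A.
Hypothesis F_Lhat : forall f, Lhat f -> Lhat (F f).
Hypothesis F_linear : forall c f h, Lhat f -> Lhat h -> F (c *: f + h) = c *: F f + F h.
Hypothesis F_br : forall f h, Lhat f -> Lhat h -> F (f * h - h * f) = F f * F h - F h * F f.
Hypothesis F_gr : forall k f, Lhat f -> infil k f -> infil k.+1 (F f - f).
Let phi s : A := F (gen K s).
Hypothesis F_bracket : forall f h, tr0 (sbst phi (nb f h) - nb (sbst phi f) (sbst phi h)).

Let phi_nil s : phi s [::] = 0. Proof. exact/Lhat_nil/F_Lhat/Lhat_gen. Qed.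

Lemma F_add f h : Lhat f -> Lhat h -> F (f + h) = F f + F h.
Proof. by move=> Hf Hh; have := F_linear 1 Hf Hh; rewrite !scale1r. Qed.

Lemma F_zero : F 0 = 0.
Proof.
have : F (0 + 0) = F 0 + F 0 by apply: F_add; apply: Lhat_0.
by rewrite addr0 => /eqP; rewrite -[X in X == _]addr0 (inj_eq (addrI _)) eq_sym => /eqP.
Qed.

Lemma F_sum (I : Type) (r : seq I) (G : I -> A) : (forall i, Lhat (G i)) ->
  F (\sum_(i <- r) G i) = \sum_(i <- r) F (G i).
Proof.
move=> HG; elim: r => [|i r IH]; first by rewrite !big_nil F_zero.
by rewrite !big_cons F_add ?IH //; apply: Lhat_sum.
Qed.

(** F is controlled only on primitive series; as omega is a finite Lie polynomial in the letters, F
    agrees on it with the extension to A. *)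
Lemma F_om : F (@om K g n) = sbst phi (@om K g n).
Proof.
have Hbr i : Lhat (gen K (lx n i) * gen K (ly n i) - gen K (ly n i) * gen K (lx n i) : A).
  by apply: Lhat_br; apply: Lhat_gen.
have Hz i : Lhat (gen K (lz g i) : A) by apply: Lhat_gen.
rewrite /om F_add; try exact: Lhat_sum.
rewrite !F_sum // (sbstD phi_nil) !(sbst_sum phi_nil); congr (_ + _); apply: eq_bigr => i _; last by rewrite sbst_gen.
have sbst_br f h : sbst phi (f * h - h * f) = sbst phi f * sbst phi h - sbst phi h * sbst phi f.
  by rewrite (sbstB phi_nil) !(sbstM phi_nil).
by rewrite sbst_br !(sbst_gen phi_nil); apply: F_br; apply: Lhat_gen.
Qed.

Lemma F_conjugate z : Lhat z -> homog 2 z -> F z = sbst phi z ->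
  (forall k, exists v, forall s, Dham (z ^+ k.+1) s = gen K s * v - v * gen K s) ->
  (forall q d, Lhat q -> homog d q -> (2 < d)%N -> (forall k, central (z ^+ k * q)) ->
    exists v, [/\ Lhat v, homog (d - 2) v & q = z * v - v * z]) ->
  exists f, grouplike f /\ F z = iser f * (z * f).
Proof.
move=> Lz Hz Fz z_inner z_solve.
have [||k b|l Ll E] := conjugate_by_exp K0 (P := F z) Lz Hz _ _ z_inner z_solve.
- exact: F_Lhat.
- exact: (F_gr Lz (infil_homog Hz)).
(* The bracket of z^(k+1) with the monomial is a sum of commutators, hence so is its image, which
   the invariance of the bracket compares with the bracket of P^(k+1) and this series. *)
- exists (sbst phi (mono K b)).
    apply: sbst_mono_infil => // s; apply: F_gr; first exact: Lhat_gen.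
    exact/infil_homog/homog_gen.
  have [v Ev] := z_inner k; have := F_bracket (z ^+ k.+1) (mono K b).
  rewrite sbstX // -Fz => H.
  have T : tr0 (sbst phi (nb (z ^+ k.+1) (mono K b))).
    by rewrite /nb nbrE; under eq_bigr do rewrite Ev; apply: tr0_sbst_ad.
  by have := tr0B T H; rewrite subKr.
exists (eser l); split; first by exists l.
by rewrite -E mulrA iserK ?mul1r // eser_nil.
Qed.

Lemma F_tangential_z j : exists f, grouplike f /\ F (gen K (lz g j)) = iser f * (gen K (lz g j) * f).
Proof.
apply: F_conjugate.
- exact: Lhat_gen.
- exact: (@homog_gen K g n (lz g j)).
- by rewrite sbst_gen.
- by move=> k; exists 0 => s; rewrite Dham_z mulr0 mul0r subrr.
by move=> q d; apply: solve_z.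
Qed.

Lemma F_tangential_om : exists f, grouplike f /\ F (@om K g n) = iser f * (@om K g n * f).
Proof.
apply: F_conjugate.
- exact: Lhat_om.
- exact: homog_om.
- exact: F_om.
- by move=> k; exists (k.+1%:R *: @om K g n ^+ k) => s; apply: Dham_om.
by move=> q d; apply: solve_om.
Qed.

End Tangential.

Theorem theorem2p7 (K : fieldType) (g n : nat) (F : series K g n -> series K g n) :
  [pchar K] =i pred0 ->
  (* F is a K-linear automorphism of the Lie algebra Lhat *)
  (forall f, Lhat f -> Lhat (F f)) ->
  (forall (c : K) f h, Lhat f -> Lhat h ->
     F (sadd (sscale c f) h) = sadd (sscale c (F f)) (F h)) ->
  (forall f h, Lhat f -> Lhat h -> F (sbr f h) = sbr (F f) (F h)) ->
  (forall f h, Lhat f -> Lhat h -> F f = F h -> f = h) ->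
  (forall h, Lhat h -> exists f, Lhat f /\ F f = h) ->
  (* filtration preserving *)
  (forall k f, Lhat f -> infil k f -> infil k (F f)) ->
  (* gr F = id *)
  (forall k f, Lhat f -> infil k f -> infil k.+1 (ssub (F f) f)) ->
  (* the induced map on |A| preserves the necklace bracket *)
  (forall a b : series K g n,
     cyc_eq (subst (fun s => F (@sgen K g n s)) (nbr a b))
            (nbr (subst (fun s => F (@sgen K g n s)) a) (subst (fun s => F (@sgen K g n s)) b))) ->
  (forall j : 'I_n, exists fj, grouplike fj /\
       F (@zg K g n j) = smul (sinv fj) (smul (@zg K g n j) fj)) /\
  (exists f0, grouplike f0 /\
       F (@omega K g n) = smul (sinv f0) (smul (@omega K g n) f0)).
Proof.
move=> K0 FL Flin Fbr _ _ _ Fgr Fnbr.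
have Fnb (f h : ser K g n) := cyc_eq_tr0 (Fnbr f h).
split=> [j|]; first exact: (F_tangential_z K0 FL Fgr Fnb j).
by rewrite omegaE; apply: (F_tangential_om K0 FL Flin Fbr Fgr Fnb).
Qed.
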